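(* Let $(A,\alpha)$ and $(B,\beta)$ be C*-dynamical systems (unital C*-algebras with unital $*$-endomorphisms). Suppose that at least one of the following holds: \begin{itemize} \item $A$ has trivial centre, $Z(A)=\mathbb{C}1$; \item $A$ is abelian; \item $A$ is finite; \item $\alpha(A)'$, the commutant of $\alpha(A)$ in $A$, is finite; \item $\alpha(R_\alpha)=R_\alpha$, where $R_\alpha=\overline{\bigcup_{k\ge1}\ker(\alpha^k)}$; \item $\alpha(\operatorname{ann}(R_\alpha))\subseteq\operatorname{ann}(R_\alpha)$. \end{itemize} Then the semicrossed products $A\times_\alpha \mathbb{Z}_+$ and $B\times_\beta \mathbb{Z}_+$ are isometrically isomorphic if and only if $(A,\alpha)$ and $(B,\beta)$ are outer conjugate.
   Context: A C*-dynamical system $(A,\alpha)$ is a unital C*-algebra $A$ together with a unital $*$-endomorphism $\alpha$ of $A$. Semicrossed product: a covariant representation of $(A,\alpha)$ is a pair $(\pi,V)$ where $\pi$ is a $*$-representation of $A$ on a Hilbert space $H$ and $V\in B(H)$ is a contraction with $\pi(a)V=V\pi(\alpha(a))$ for all $a\in A$. Let $\mathcal{P}$ be the algebra of formal polynomials $\sum_{k=0}^n \mathbf{v}^k a_k$ ($a_k\in A$) with multiplication determined by $a\mathbf{v}=\mathbf{v}\alpha(a)$. Each covariant pair gives a representation $(\pi\times V)(\sum \mathbf{v}^k a_k)=\sum V^k\pi(a_k)$ of $\mathcal{P}$. The semicrossed product $A\times_\alpha\mathbb{Z}_+$ is the operator algebra obtained by completing $\mathcal{P}$ in the norm $\|p\|=\sup_{(\pi,V)}\|(\pi\times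 V)(p)\|$ (and the analogous norms on matrices over $\mathcal{P}$), the supremum being over all covariant representations. Two semicrossed products are isometrically isomorphic if there is a surjective isometric algebra isomorphism between them. $(A,\alpha)$ and $(B,\beta)$ are outer conjugate if there are a $*$-isomorphism $\gamma$ of $A$ onto $B$ and a unitary $v\in A$ such that $\alpha(a)=v\,(\gamma^{-1}\beta\gamma(a))\,v^*$ for all $a\in A$. A unital C*-algebra is finite if it contains no proper isometries (i.e. $s^*s=1$ implies $ss^*=1$). For a closed two-sided ideal $J$ of $A$, $\operatorname{ann}(J)=\{a\in A: aJ=0\}=\{a\in A: Ja=0\}$. *)

(* Defs.v *)
From HB Require Import structures.
From mathcomp Require Import all_boot all_order all_algebra.
From mathcomp Require Import complex.
From mathcomp Require Import all_classical all_reals all_analysis.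
Set Implicit Arguments.
Unset Strict Implicit.
Unset Printing Implicit Defensive.
Import Order.TTheory GRing.Theory Num.Theory.
Import numFieldNormedType.Exports.
Local Open Scope classical_set_scope.
Local Open Scope ring_scope.

(* In a normed space over R[i] the norm is an element of R[i]; [rnorm] is that
   norm as a real number. *)
Definition rnorm (R : realType) (V : normedZmodType R[i]) (x : V) : R :=
  complex.Re `|x|.

(* The norm of an algebra is a field of its own, with values in R, because the
   hierarchy has no join of [normedModType] and [algType]. *)
HB.mixin Record isBanachAlgebra (R : realType) A & GRing.Algebra R[i] A := {
  anorm : A -> R;
  anormD : forall x y : A, anorm (x + y) <= anorm x + anorm y;
  anormZ : forall (c : R[i]) (x : A), anorm (c *: x) = rnorm c * anorm x;
  anorm0_eq0 : forall x : A, anorm x = 0 -> x = 0;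
  anormM : forall x y : A, anorm (x * y) <= anorm x * anorm y;
  anorm_complete : forall u : nat -> A,
    (forall e : R, 0 < e -> exists N : nat, forall m n : nat,
       (N <= m)%N -> (N <= n)%N -> anorm (u m - u n) < e) ->
    exists l : A, (fun n => anorm (u n - l)) @ \oo --> (0 : R)
}.

#[short(type="banachAlgType")]
HB.structure Definition BanachAlgebra (R : realType) :=
  {A of GRing.Algebra R[i] A & isBanachAlgebra R A}.

HB.mixin Record isCStarAlgebra (R : realType) A & BanachAlgebra R A := {
  star : A -> A;
  starD : forall x y : A, star (x + y) = star x + star y;
  starZ : forall (c : R[i]) (x : A), star (c *: x) = c^* *: star x;
  starM : forall x y : A, star (x * y) = star y * star x;
  starK : involutive star;
  anorm_star : forall x : A, anorm (star x * x) = anorm x ^+ 2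
}.

#[short(type="cstarAlgType")]
HB.structure Definition CStarAlgebra (R : realType) :=
  {A of BanachAlgebra R A & isCStarAlgebra R A}.

HB.mixin Record isHilbert (R : realType) H & CompleteNormedModule R[i] H := {
  inner : H -> H -> R[i];
  inner_linearl : forall (c : R[i]) (x y z : H),
    inner (c *: x + y) z = c * inner x z + inner y z;
  innerC : forall x y : H, inner y x = (inner x y)^*;
  innerxx : forall x : H, inner x x = `|x| ^+ 2
}.

#[short(type="hilbertType")]
HB.structure Definition Hilbert (R : realType) :=
  {H of CompleteNormedModule R[i] H & isHilbert R H}.

Section CStarNotions.
Context {R : realType}.
Implicit Types A B : cstarAlgType R.

(* The morphisms of type {lrmorphism A -> B} are linear, multiplicative and
   unital; this adds the compatibility with the involutions. *)
Definition star_morphism A B (f : {lrmorphism A -> B}) : Prop :=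
  forall a : A, f (star a) = star (f a).

Definition unitary A (v : A) : Prop := star v * v = 1 /\ v * star v = 1.

Definition outer_conjugate A B (alpha : {lrmorphism A -> A})
    (beta : {lrmorphism B -> B}) : Prop :=
  exists (gamma : {lrmorphism A -> B}) (gamma_inv : B -> A) (v : A),
    [/\ star_morphism gamma, cancel gamma gamma_inv, cancel gamma_inv gamma,
        unitary v &
        forall a : A, alpha a = v * gamma_inv (beta (gamma a)) * star v].

Definition center A : set A := [set a | forall b, a * b = b * a].

Definition trivial_center A : Prop :=
  @center A = [set c%:A | c in [set: R[i]]].

Definition abelian_alg A : Prop := forall a b : A, a * b = b * a.

(* Finiteness of a unital C*-subalgebra S of A with the unit of A. *)
Definition finite_in A (S : set A) : Prop :=
  forall s : A, S s -> star s * s = 1 -> s * star s = 1.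

Definition finite_alg A : Prop := finite_in [set: A].

Definition commutant A (S : set A) : set A :=
  [set b | forall a, S a -> a * b = b * a].

Definition norm_closure A (S : set A) : set A :=
  [set a | forall e : R, 0 < e -> exists2 b, S b & anorm (a - b) < e].

Definition radical A (alpha : A -> A) : set A :=
  norm_closure (\bigcup_(k in [set k : nat | (1 <= k)%N])
                  [set a | iter k alpha a = 0]).

Definition ann A (J : set A) : set A := [set a | forall j, J j -> a * j = 0].

End CStarNotions.

(* Formal polynomials \sum_k v^k a_k, coefficients on the right of the powers,
   represented by their coefficient sequences. *)
Definition skew_poly (R : realType) (A : cstarAlgType R)
  (alpha : {lrmorphism A -> A}) : Type := {poly A}.

Section SkewPoly.
Context {R : realType} {A : cstarAlgType R} {alpha : {lrmorphism A -> A}}.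
Local Notation P := (skew_poly alpha).

HB.instance Definition _ := GRing.Zmodule.copy P {poly A}.

(* a v = v alpha(a) gives (v^i a) (v^j b) = v^(i + j) alpha^j(a) b *)
Definition skew_mul (p q : P) : P :=
  \poly_(n < size (p : {poly A}) + size (q : {poly A}))
     \sum_(j < n.+1) iter j alpha (p : {poly A})`_(n - j) * (q : {poly A})`_j.

Definition skew_one : P := (1 : {poly A}).

Definition skew_scale (c : R[i]) (p : P) : P := c%:A *: (p : {poly A}).

Lemma iter_alpha0 k : iter k alpha 0 = 0.
Proof. by elim: k => //= k ->; rewrite rmorph0. Qed.

Lemma iter_alpha1 k : iter k alpha 1 = 1.
Proof. by elim: k => //= k ->; rewrite rmorph1. Qed.

Lemma iter_alphaD k : {morph iter k alpha : a b / a + b}.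
Proof. by elim: k => [|k IH] a b //; rewrite !iterS IH rmorphD. Qed.

Lemma iter_alphaM k : {morph iter k alpha : a b / a * b}.
Proof. by elim: k => [|k IH] a b //; rewrite !iterS IH rmorphM. Qed.

Lemma iter_alphaZ k (c : R[i]) a : iter k alpha (c *: a) = c *: iter k alpha a.
Proof. by elim: k => [|k IH] //; rewrite !iterS IH linearZ. Qed.

Lemma iter_alpha_sum k n (F : 'I_n -> A) :
  iter k alpha (\sum_(i < n) F i) = \sum_(i < n) iter k alpha (F i).
Proof. exact: (big_morph _ (iter_alphaD k) (iter_alpha0 k)). Qed.

Lemma coef_skew_mul (p q : P) n :
  (skew_mul p q : {poly A})`_n =
  \sum_(j < n.+1) iter j alpha (p : {poly A})`_(n - j) * (q : {poly A})`_j.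
Proof.
rewrite /skew_mul coef_poly; case: ltnP => // le_n; symmetry.
apply: big1 => j _.
have [lt_j|le_j] := ltnP j (size (q : {poly A})); last first.
  by rewrite (nth_default _ le_j) mulr0.
rewrite (@nth_default _ 0 p) ?iter_alpha0 ?mul0r//.
rewrite -(leq_add2r j) subnK; last by rewrite -ltnS.
by rewrite (leq_trans _ le_n)// leq_add2l ltnW.
Qed.

Lemma coef_skew_scale (c : R[i]) (p : P) n :
  (skew_scale c p : {poly A})`_n = c *: (p : {poly A})`_n.
Proof. by rewrite coefZ -scalerAl mul1r. Qed.

Lemma skew_mulA : associative skew_mul.
Proof.
move=> p q r; apply/polyP => n; rewrite !coef_skew_mul.
pose F (j k : nat) := iter j alpha (p : {poly A})`_(n - j) *
  (iter k alpha (q : {poly A})`_(j - k) * (r : {poly A})`_k).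
transitivity (\sum_(j < n.+1) \sum_(k < n.+1 | (k <= j)%N) F j k).
  apply: eq_bigr => j _; rewrite coef_skew_mul big_distrr /=.
  by rewrite (big_ord_narrow_leq (ltnSE (ltn_ord j))).
rewrite (exchange_big_dep predT) //=; apply: eq_bigr => k _.
rewrite coef_skew_mul iter_alpha_sum big_distrl /=.
have lekn : (k <= n)%N by rewrite -ltnS.
rewrite -(big_mkord (fun j => (k <= j)%N) (fun j => F j k)).
rewrite -(big_mkord predT (fun i =>
  iter k alpha (iter i alpha (p : {poly A})`_(n - k - i) *
                (q : {poly A})`_i) * (r : {poly A})`_k)).
rewrite (big_cat_nat (n := k)) ?leqW//= big_nat_cond big1 ?add0r; last first.
  by move=> i /andP[/andP[_ lti]]; rewrite leqNgt lti.
rewrite -{1}[nat_of_ord k]add0n big_addn subSn// big_nat_cond.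
rewrite [RHS]big_nat_cond; apply: eq_big => i; first by rewrite leq_addl !andbT.
by move=> _; rewrite /F iter_alphaM -iterD addnK mulrA subnDA subnAC addnC.
Qed.

Lemma skew_mul1 : right_id skew_one skew_mul.
Proof.
move=> p; apply/polyP => n; rewrite coef_skew_mul big_ord_recl coef1 mulr1 subn0.
by rewrite big1 ?addr0// => j _; rewrite coef1 mulr0.
Qed.

Lemma skew_1mul : left_id skew_one skew_mul.
Proof.
move=> p; apply/polyP => n; rewrite coef_skew_mul big_ord_recr /= subnn coef1.
rewrite iter_alpha1 mul1r big1 ?add0r// => j _.
by rewrite coef1 subn_eq0 leqNgt ltn_ord iter_alpha0 mul0r.
Qed.

Lemma skew_mulDl : left_distributive skew_mul +%R.
Proof.
move=> p q r; apply/polyP => n; rewrite coefD !coef_skew_mul -big_split/=.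
by apply: eq_bigr => j _; rewrite coefD iter_alphaD mulrDl.
Qed.

Lemma skew_mulDr : right_distributive skew_mul +%R.
Proof.
move=> p q r; apply/polyP => n; rewrite coefD !coef_skew_mul -big_split/=.
by apply: eq_bigr => j _; rewrite coefD mulrDr.
Qed.

Lemma skew_one_neq0 : skew_one != 0.
Proof. exact: oner_neq0. Qed.

HB.instance Definition _ := GRing.Zmodule_isNzRing.Build P
  skew_mulA skew_1mul skew_mul1 skew_mulDl skew_mulDr skew_one_neq0.

Lemma skew_scaleA (c d : R[i]) (p : P) :
  skew_scale c (skew_scale d p) = skew_scale (c * d) p.
Proof. by apply/polyP => n; rewrite !coef_skew_scale scalerA. Qed.

Lemma skew_scale1 : left_id 1 skew_scale.
Proof. by move=> p; apply/polyP => n; rewrite coef_skew_scale scale1r. Qed.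

Lemma skew_scaleDr : right_distributive skew_scale +%R.
Proof.
by move=> c p q; apply/polyP => n; rewrite coefD !coef_skew_scale coefD scalerDr.
Qed.

Lemma skew_scaleDl (p : P) : {morph skew_scale^~ p : c d / c + d}.
Proof.
by move=> c d; apply/polyP => n; rewrite coefD !coef_skew_scale scalerDl.
Qed.

HB.instance Definition _ := GRing.Zmodule_isLmodule.Build R[i] P
  skew_scaleA skew_scale1 skew_scaleDr skew_scaleDl.

Lemma skew_scaleAl (c : R[i]) (p q : P) : c *: (p * q) = (c *: p) * q.
Proof.
apply/polyP => n; rewrite coef_skew_scale !coef_skew_mul scaler_sumr.
apply: eq_bigr => j _; rewrite coef_skew_scale scalerAl.
by rewrite iter_alphaZ.
Qed.

HB.instance Definition _ := GRing.Lmodule_isLalgebra.Build R[i] P skew_scaleAl.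

Lemma skew_scaleAr (c : R[i]) (p q : P) : c *: (p * q) = p * (c *: q).
Proof.
apply/polyP => n; rewrite coef_skew_scale !coef_skew_mul scaler_sumr.
by apply: eq_bigr => j _; rewrite coef_skew_scale scalerAr.
Qed.

HB.instance Definition _ := GRing.Lalgebra_isAlgebra.Build R[i] P skew_scaleAr.

End SkewPoly.

Section SemicrossedProduct.
Context {R : realType}.

Definition bounded_op (H : hilbertType R) (T : H -> H) : Prop :=
  exists M : R, forall x : H, rnorm (T x) <= M * rnorm x.

(* cov_pi is not required to be unital. *)
Record covariant_rep (A : cstarAlgType R) (alpha : {lrmorphism A -> A})
    (H : hilbertType R) := CovariantRep {
  cov_pi : A -> {linear H -> H};
  cov_pi_bounded : forall a, bounded_op (cov_pi a);
  cov_piD : forall a b x, cov_pi (a + b) x = cov_pi a x + cov_pi b x;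
  cov_piZ : forall (c : R[i]) a x, cov_pi (c *: a) x = c *: cov_pi a x;
  cov_piM : forall a b x, cov_pi (a * b) x = cov_pi a (cov_pi b x);
  cov_pi_star : forall a x y,
    inner (cov_pi a x) y = inner x (cov_pi (star a) y);
  cov_V : {linear H -> H};
  cov_V_contraction : forall x, rnorm (cov_V x) <= rnorm x;
  cov_covariant : forall a x, cov_pi a (cov_V x) = cov_V (cov_pi (alpha a) x)
}.

Definition cov_eval (A : cstarAlgType R) (alpha : {lrmorphism A -> A})
    (H : hilbertType R) (c : covariant_rep alpha H) (p : skew_poly alpha)
    (x : H) : H :=
  \sum_(k < size (p : {poly A}))
     iter k (cov_V c) (cov_pi c (p : {poly A})`_k x).

Definition op_norm (H : hilbertType R) (T : H -> H) : \bar R :=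
  ereal_sup [set (rnorm (T x))%:E | x in [set x | rnorm x <= 1]].

Definition semicrossed_norm (A : cstarAlgType R) (alpha : {lrmorphism A -> A})
    (p : skew_poly alpha) : \bar R :=
  ereal_sup [set e | exists (H : hilbertType R) (c : covariant_rep alpha H),
                       e = op_norm (cov_eval c p)].

(* A completion of the polynomial algebra in the norm above: a Banach algebra
   with an isometric homomorphism of dense range.  It is unique up to a unique
   isometric isomorphism compatible with the embeddings. *)
Record semicrossed_product (A : cstarAlgType R)
    (alpha : {lrmorphism A -> A}) := SemicrossedProduct {
  sp_alg :> banachAlgType R;
  sp_embed : {lrmorphism skew_poly alpha -> sp_alg};
  sp_norm : forall p, (anorm (sp_embed p))%:E = semicrossed_norm p;
  sp_dense : forall (x : sp_alg) (e : R), 0 < e ->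
    exists p, anorm (x - sp_embed p) < e
}.

Definition isometrically_isomorphic (C D : banachAlgType R) : Prop :=
  exists phi : {lrmorphism C -> D},
    (forall x, anorm (phi x) = anorm x) /\ (forall y, exists x, phi x = y).

End SemicrossedProduct.

(* Main.v *)
(* Suppose Phi is an isometric isomorphism of A x_alpha Z+ onto B x_beta Z+, with
   generators v and w.  An element u of a semicrossed product with u and u^-1
   contractive lies in the coefficient algebra: its constant term is unitary, and
   in the Fock representation there is no room left for other Fourier
   coefficients.  Hence Phi restricts to a *-isomorphism gamma of A onto B.

   Write Phi(v) = b0 + w b1 + ..., and let c0 be the image under gamma of the
   constant term of Phi^-1(w).  The character w |-> c0 of B x_beta Z+ sends Phi(v)
   to 0; if |b0| were 1, a state f with f(b0^* b0) = 1 would vanish on all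
   b_k^* b_k for k > 0, so that Phi(v) and b0 would have images with the same norm
   in the GNS representation of f.  Therefore |b0| < 1.  This makes the twisted
   derivation D with D(a) = 0, D(v) = 1 along the character v |-> b0 bounded.  The
   first Fourier coefficient of Phi(x) is b1 D(x), and D(Phi^-1(y)) is s times the
   first coefficient of y, where s = D(Phi^-1(w)); evaluating at Phi^-1(w) and at
   Phi(v) gives b1 s = s b1 = 1.  The unitary part of b1 intertwines beta and
   gamma alpha gamma^-1.

   Conversely an outer conjugacy (gamma, v) extends gamma by sending the generator
   to w gamma(v)^*, which only pulls back covariant representations. *)
From HB Require Import structures.
Require Import Defs.
From mathcomp Require Import all_boot all_order all_algebra.
From mathcomp Require Import complex.
From mathcomp Require Import all_classical all_reals all_analysis.
From mathcomp Require Import ring lra.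
Set Implicit Arguments.
Unset Strict Implicit.
Unset Printing Implicit Defensive.
Import Order.TTheory GRing.Theory Num.Theory.
Import numFieldNormedType.Exports.
Local Open Scope classical_set_scope.
Local Open Scope complex_scope.
Local Open Scope ring_scope.

(** The obstacle is that Phi need not respect the grading: Phi(v) may have a nonzero constant term
    b0, and then its first coefficient b1 has no evident inverse. The first coefficient is a
    derivation twisted along the constant term, so the first coefficient of Phi(x) is governed by
    its values on A, where it is 0, and at v, where it is b1; this is why it factors through D. On
    polynomials D makes sense for every b0 and sends v^k to a noncommutative form of k b0^(k-1). But
    Phi^-1(w) is in general only a limit of polynomials, and D reaches it once the sum of the k
    |b0|^(k-1) converges. Since every Fourier coefficient is bounded by the norm, that sum, (1 -
    |b0|)^-2, bounds D.

    The strict inequality |b0| < 1 calls for approximants of Phi(v) whose higher coefficients are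
    invisible to the state f. Abel means have this property, as their coefficients are multiples of
    those of Phi(v). The character w |-> c0 is the constant term of Phi^-1 carried to B by gamma; it
    kills Phi(v) because v has no constant term. *)

(* Reflexive decision procedure for identities between noncommutative
   polynomials with integer coefficients. *)
Section NoncommutativeRing.
Variable R : pzRingType.

Inductive ncexpr :=
  | NCvar of nat | NC0 | NC1 | NCadd of ncexpr & ncexpr | NCopp of ncexpr
  | NCmul of ncexpr & ncexpr.

Fixpoint nceval (env : seq R) (e : ncexpr) : R :=
  match e with
  | NCvar i => nth 0 env i
  | NC0 => 0
  | NC1 => 1
  | NCadd e1 e2 => nceval env e1 + nceval env e2
  | NCopp e1 => - nceval env e1
  | NCmul e1 e2 => nceval env e1 * nceval env e2
  end.

Definition ncpoly := seq (int * seq nat).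

Definition ncmon (env : seq R) (m : seq nat) : R := \prod_(i <- m) nth 0 env i.

Definition ncval (env : seq R) (p : ncpoly) : R :=
  \sum_(t <- p) ncmon env t.2 *~ t.1.

Fixpoint ncinsert (c : int) (m : seq nat) (p : ncpoly) : ncpoly :=
  if p is (d, n) :: q then
    if m == n then (c + d, n) :: q else (d, n) :: ncinsert c m q
  else [:: (c, m)].

Definition ncplus (p q : ncpoly) : ncpoly :=
  foldr (fun t => ncinsert t.1 t.2) q p.

Definition nctimes (p q : ncpoly) : ncpoly :=
  foldr (fun t => ncplus [seq (t.1 * s.1, t.2 ++ s.2) | s <- q]) [::] p.

Fixpoint ncnorm (e : ncexpr) : ncpoly :=
  match e with
  | NCvar i => [:: (1, [:: i])]
  | NC0 => [::]
  | NC1 => [:: (1, [::])]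
  | NCadd e1 e2 => ncplus (ncnorm e1) (ncnorm e2)
  | NCopp e1 => [seq (- t.1, t.2) | t <- ncnorm e1]
  | NCmul e1 e2 => nctimes (ncnorm e1) (ncnorm e2)
  end.

Lemma ncval_cons env t p : ncval env (t :: p) = ncmon env t.2 *~ t.1 + ncval env p.
Proof. by rewrite /ncval big_cons. Qed.

Lemma ncval_insert env c m p :
  ncval env (ncinsert c m p) = ncmon env m *~ c + ncval env p.
Proof.
elim: p => [|[d n] q IH] /=; first by rewrite ncval_cons.
case: eqP => [->|_]; rewrite !ncval_cons /=; first by rewrite mulrzDr addrA.
by rewrite IH addrCA.
Qed.

Lemma ncval_plus env p q : ncval env (ncplus p q) = ncval env p + ncval env q.
Proof.
elim: p => [|t p IH] /=; first by rewrite /ncval big_nil add0r.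
by rewrite ncval_insert IH ncval_cons addrA.
Qed.

Lemma ncval_times env p q : ncval env (nctimes p q) = ncval env p * ncval env q.
Proof.
elim: p => [|t p IH] /=; first by rewrite /ncval !big_nil mul0r.
rewrite ncval_plus IH ncval_cons mulrDl; congr (_ + _).
rewrite /ncval big_map big_distrr /=; apply: eq_bigr => s _.
by rewrite /ncmon big_cat /= mulrzAl mulrzAr -mulrzA mulrC.
Qed.

Lemma ncnormP env e : ncval env (ncnorm e) = nceval env e.
Proof.
elim: e => [i|||e1 IH1 e2 IH2|e1 IH1|e1 IH1 e2 IH2] /=.
- by rewrite ncval_cons /ncval big_nil addr0 /ncmon big_seq1.
- by rewrite /ncval big_nil.
- by rewrite ncval_cons /ncval big_nil addr0 /ncmon big_nil.
- by rewrite ncval_plus IH1 IH2.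
- by rewrite -IH1 /ncval big_map -sumrN; apply: eq_bigr => t _; rewrite mulrNz.
- by rewrite ncval_times IH1 IH2.
Qed.

(** Cancelled monomials stay in the list with coefficient 0, so the test reads the coefficients
    instead of comparing with the empty list. *)
Lemma nc_correct env e1 e2 :
  all (fun t => t.1 == 0) (ncnorm (NCadd e1 (NCopp e2))) ->
  nceval env e1 = nceval env e2.
Proof.
move=> h; apply/eqP; rewrite -subr_eq0 -[_ - _]/(nceval env (NCadd e1 (NCopp e2))).
rewrite -ncnormP /ncval big_seq big1// => t /(allP h)/eqP ->.
by rewrite mulr0z.
Qed.

End NoncommutativeRing.

Ltac nc_index x env :=
  match env with
  | x :: _ => constr:(0%N)
  | _ :: ?env' => let n := nc_index x env' in constr:(n.+1)
  end.

Ltac nc_vars e env :=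
  match e with
  | ?a + ?b => let env1 := nc_vars a env in nc_vars b env1
  | ?a * ?b => let env1 := nc_vars a env in nc_vars b env1
  | - ?a => nc_vars a env
  | 0 => env
  | 1 => env
  (* The first branch is a membership test: it fails when [x] is not in [env], and the second one
     then adds it. *)
  | ?x => match constr:(Set) with
          | _ => let n := nc_index x env in env
          | _ => constr:(x :: env)
          end
  end.

Ltac nc_reify e env :=
  match e with
  | ?a + ?b => let u := nc_reify a env in let v := nc_reify b env in
               constr:(NCadd u v)
  | ?a * ?b => let u := nc_reify a env in let v := nc_reify b env in
               constr:(NCmul u v)
  | - ?a => let u := nc_reify a env in constr:(NCopp u)
  | 0 => constr:(NC0)
  | 1 => constr:(NC1)
  | ?x => let n := nc_index x env in constr:(NCvar n)
  end.

Ltac ncring :=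
  match goal with
  | |- @eq ?T ?a ?b =>
    let env0 := nc_vars a (@nil T) in
    let env := nc_vars b env0 in
    let u := nc_reify a env in
    let v := nc_reify b env in
    apply: (@nc_correct _ env u v); vm_compute; reflexivity
  end.

(** * Banach algebras and C*-algebras *)

Section ComplexNumbers.
Context {R : realType}.
Implicit Types (c d : R[i]) (r : R).

Lemma rnormC c : (rnorm c)%:C = `|c|.
Proof. by rewrite /rnorm RRe_real ?normr_real. Qed.

Lemma rnorm_ge0 (V : normedZmodType R[i]) (x : V) : 0 <= rnorm x.
Proof. by have := normr_ge0 x; rewrite /rnorm lecE => /andP[_]. Qed.

Lemma rnormVC (V : normedZmodType R[i]) (x : V) : (rnorm x)%:C = `|x|.
Proof. by rewrite /rnorm RRe_real ?normr_real. Qed.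

Lemma rnormM c d : rnorm (c * d) = rnorm c * rnorm d.
Proof. by apply: complexI; rewrite rmorphM /= !rnormC normrM. Qed.

Lemma rnorm_real r : rnorm (r%:C) = `|r|.
Proof. by rewrite /rnorm normc_def /= expr0n /= addr0 sqrtr_sqr. Qed.

Lemma rnormD c d : rnorm (c + d) <= rnorm c + rnorm d.
Proof. by rewrite -lecR rmorphD /= !rnormC ler_normD. Qed.

Lemma conjcE c : c^* = conjc c.
Proof. by []. Qed.

Lemma rnorm_conj c : rnorm (c^*) = rnorm c.
Proof. by rewrite /rnorm norm_conjC. Qed.

Lemma rnorm_i : rnorm ('i%C : R[i]) = 1.
Proof. by rewrite /rnorm normc_def /= expr0n /= add0r expr1n sqrtr1. Qed.

Lemma conj_real r : (r%:C)^* = r%:C :> R[i].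
Proof. by rewrite conjcE conjc_real. Qed.

Lemma conj_i : ('i%C : R[i])^* = - 'i%C.
Proof. by rewrite conjcE; simpc. Qed.

Lemma normc_rnorm_sq c : c * c^* = (rnorm c ^+ 2)%:C.
Proof. by rewrite rmorphXn /= rnormC normCK. Qed.

Lemma Re_le_rnorm c : complex.Re c <= rnorm c.
Proof.
rewrite (le_trans (ler_norm _))// -lecR rnormC; exact: normc_ge_Re.
Qed.

End ComplexNumbers.

Section BanachAlgebras.
Context {R : realType} {Z : banachAlgType R}.
Implicit Types (x y z l : Z) (u v : nat -> Z).

Lemma anormZr (r : R) x : anorm (r%:C *: x) = `|r| * anorm x.
Proof. by rewrite anormZ rnorm_real. Qed.

Lemma anorm0 : anorm (0 : Z) = 0.
Proof. by rewrite -(scale0r (0 : Z)) -[0]/((0 : R)%:C) anormZr normr0 mul0r. Qed.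

Lemma anormN x : anorm (- x) = anorm x.
Proof.
by rewrite -scaleN1r -[-1]/(- (1 : R)%:C) -rmorphN anormZr normrN1 mul1r.
Qed.

Lemma anormB x y : anorm (x - y) <= anorm x + anorm y.
Proof. by rewrite -(anormN y) anormD. Qed.

Lemma anorm_ge0 x : 0 <= anorm x.
Proof. by have := anormB x x; rewrite subrr anorm0; lra. Qed.

Lemma anorm_distC x y : anorm (x - y) = anorm (y - x).
Proof. by rewrite -anormN opprB. Qed.

Lemma anorm_sub x y : anorm x - anorm y <= anorm (x - y).
Proof. by have := anormD (x - y) y; rewrite subrK; lra. Qed.

Lemma anorm_triangle y x z : anorm (x - z) <= anorm (x - y) + anorm (y - z).
Proof. by rewrite -(subrKA y) anormD. Qed.

Lemma anorm_sum (I : Type) (s : seq I) (P : pred I) (F : I -> Z) :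
  anorm (\sum_(i <- s | P i) F i) <= \sum_(i <- s | P i) anorm (F i).
Proof.
elim/big_ind2 : _ => [|a b c d h1 h2|//]; first by rewrite anorm0.
by rewrite (le_trans (anormD _ _))// lerD.
Qed.

Lemma anorm_small x : (forall e : R, 0 < e -> anorm x <= e) -> x = 0.
Proof.
move=> h; apply: anorm0_eq0; apply/eqP; rewrite eq_le anorm_ge0 andbT.
by apply/ler_addgt0Pl => e e0; rewrite addr0 h.
Qed.

(** The norm of the unit appears as a hypothesis because the axioms of [banachAlgType] do not
    normalise it. *)
Lemma anormX_le x n : anorm (1 : Z) <= 1 -> anorm (x ^+ n) <= anorm x ^+ n.
Proof.
move=> n1; elim: n => [//|n IH]; rewrite !exprS (le_trans (anormM _ _))//.
by rewrite ler_wpM2l// anorm_ge0.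
Qed.

Definition acvg u l : Prop :=
  forall e : R, 0 < e -> exists N, forall n, (N <= n)%N -> anorm (u n - l) < e.

Lemma acvg_cst l : acvg (fun=> l) l.
Proof. by move=> e e0; exists 0%N => n _; rewrite subrr anorm0. Qed.

Lemma acvg_uniq u l z : acvg u l -> acvg u z -> l = z.
Proof.
move=> hl hz; apply/eqP; rewrite -subr_eq0; apply/eqP; apply: anorm_small.
move=> e e0; have e2 : 0 < e / 2 by rewrite divr_gt0.
have [N1 h1] := hl _ e2; have [N2 h2] := hz _ e2.
have := h1 _ (leq_maxl N1 N2); have := h2 _ (leq_maxr N1 N2).
have := anorm_triangle (u (maxn N1 N2)) l z; rewrite (anorm_distC l (u _)); lra.
Qed.

Lemma acvgD u v l z : acvg u l -> acvg v z -> acvg (fun n => u n + v n) (l + z).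
Proof.
move=> hl hz e e0; have e2 : 0 < e / 2 by rewrite divr_gt0.
have [N1 h1] := hl _ e2; have [N2 h2] := hz _ e2.
exists (maxn N1 N2) => n; rewrite geq_max => /andP[/h1 a1 /h2 a2].
by have := anormD (u n - l) (v n - z); rewrite addrACA -opprD /=; lra.
Qed.

Lemma acvg_lip (Z' : banachAlgType R) (T : Z -> Z') (C : R) u l :
  (forall x y, anorm (T x - T y) <= C * anorm (x - y)) ->
  acvg u l ->
  forall e : R, 0 < e -> exists N, forall n, (N <= n)%N ->
    anorm (T (u n) - T l) < e.
Proof.
move=> hT hl e e0; have C1 : 0 < `|C| + 1 by rewrite ltr_pwDr.
have [N hN] := hl (e / (`|C| + 1)) (divr_gt0 e0 C1).
exists N => n /hN; rewrite ltr_pdivlMr// => h; apply: le_lt_trans (hT _ _) _.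
apply: le_lt_trans h; rewrite mulrC ler_wpM2l ?anorm_ge0//.
by have := ler_norm C; lra.
Qed.

Lemma acvgMl x u l : acvg u l -> acvg (fun n => x * u n) (x * l).
Proof.
apply: (@acvg_lip Z (fun y => x * y) (anorm x)) => y z.
by rewrite -mulrBr anormM.
Qed.

Lemma acvgMr x u l : acvg u l -> acvg (fun n => u n * x) (l * x).
Proof.
apply: (@acvg_lip Z (fun y => y * x) (anorm x)) => y z.
by rewrite -mulrBl mulrC anormM.
Qed.

Lemma acvgZ (c : R[i]) u l : acvg u l -> acvg (fun n => c *: u n) (c *: l).
Proof.
by apply: (@acvg_lip Z (fun y => c *: y) (rnorm c)) => y z; rewrite -scalerBr anormZ.
Qed.

Lemma acvgB u v l z : acvg u l -> acvg v z -> acvg (fun n => u n - v n) (l - z).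
Proof.
move=> hu /(acvgZ (-1)); rewrite scaleN1r => hv e e0.
have [N hN] := acvgD hu hv e0; exists N => n /hN; by rewrite scaleN1r.
Qed.

Lemma acvg_bounded u l : acvg u l ->
  exists (M : R) (N : nat), forall n, (N <= n)%N -> anorm (u n) <= M.
Proof.
move=> /(_ _ ltr01)[N hN]; exists (anorm l + 1), N => n /hN h.
by have := anorm_sub (u n) l; lra.
Qed.

Lemma acvgM u v l z : acvg u l -> acvg v z -> acvg (fun n => u n * v n) (l * z).
Proof.
move=> hu hv e e0; have [M [N0 h0]] := acvg_bounded hv.
have M1 : 0 < `|M| + 1 by rewrite ltr_pwDr.
have e2 : 0 < e / 2 by rewrite divr_gt0.
have [N1 h1] := hu _ (divr_gt0 e2 M1).
have [N2 h2] := acvgMl l hv e2.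
exists (maxn N0 (maxn N1 N2)) => n; rewrite !geq_max.
move=> /and3P[/h0 a0 /h1 a1 /h2 a2].
have := anorm_triangle (l * v n) (u n * v n) (l * z).
rewrite -mulrBl; have := anormM (u n - l) (v n).
move: a1; rewrite ltr_pdivlMr// => a1.
have : anorm (u n - l) * anorm (v n) <= anorm (u n - l) * (`|M| + 1).
  by rewrite ler_wpM2l ?anorm_ge0//; have := ler_norm M; lra.
lra.
Qed.

Lemma acvg_anorm_le u l (C : R) :
  acvg u l -> (forall n, anorm (u n) <= C) -> anorm l <= C.
Proof.
move=> hu hC; apply/ler_addgt0Pl => e e0.
have [N /(_ _ (leqnn _)) hN] := hu _ e0; have := hC N.
have := anorm_sub l (u N); rewrite anorm_distC; lra.
Qed.

Definition acauchy u : Prop :=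
  forall e : R, 0 < e -> exists N : nat, forall m n : nat,
    (N <= m)%N -> (N <= n)%N -> anorm (u m - u n) < e.

Lemma acauchy_cvg u : acauchy u -> exists l, acvg u l.
Proof.
move=> /anorm_complete[l hl]; exists l => e e0.
move/cvgrPdist_lt : hl => /(_ e e0)[N _ hN]; exists N => n /hN /=.
by rewrite sub0r normrN ger0_norm ?anorm_ge0.
Qed.

Lemma acvg_cauchy u l : acvg u l -> acauchy u.
Proof.
move=> hu e e0; have e2 : 0 < e / 2 by rewrite divr_gt0.
have [N hN] := hu _ e2; exists N => m n /hN hm /hN hn.
by have := anorm_triangle l (u m) (u n); rewrite (anorm_distC l); lra.
Qed.

End BanachAlgebras.

Lemma inv_small (R : realType) (e : R) (C : R) : 0 < e ->
  exists N, forall n, (N <= n)%N -> C / n.+1%:R < e.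
Proof.
move=> e0; have C1 : 0 < `|C| + 1 by rewrite ltr_pwDr.
have := archi_boundP (divr_ge0 (ltW C1) (ltW e0)).
rewrite ltr_pdivrMr// => h; exists (Num.bound ((`|C| + 1) / e)) => n hn.
rewrite ltr_pdivrMr ?ltr0n// mulrC.
have : (Num.bound ((`|C| + 1) / e))%:R <= n.+1%:R :> R.
  by rewrite ler_nat (leq_trans hn).
move=> /(ler_wpM2r (ltW e0)); have := ler_norm C; lra.
Qed.

Section StarBasics.
Context {R : realType} {A : cstarAlgType R}.
Implicit Types (a b x y z : A) (r t : R).

Lemma starZr r x : star (r%:C *: x) = r%:C *: star x.
Proof. by rewrite starZ conj_real. Qed.

Lemma star0 : star (0 : A) = 0.
Proof. by rewrite -(scale0r (0 : A)) -[0]/((0 : R)%:C) starZr !scale0r. Qed.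

Lemma starN x : star (- x) = - star x.
Proof. by apply/eqP; rewrite -addr_eq0 -starD addNr star0. Qed.

Lemma starB x y : star (x - y) = star x - star y.
Proof. by rewrite starD starN. Qed.

Lemma star1 : star (1 : A) = 1.
Proof. by have := starM (star (1 : A)) 1; rewrite mulr1 starK mulr1 => <-. Qed.

(** |y|^2 = |y^* y| <= |y^*| |y|, applied to x and to x^*. *)
Lemma anorm_starE x : anorm (star x) = anorm x.
Proof.
have le y : anorm y <= anorm (star y).
  have [->|y0] := eqVneq y 0; first by rewrite star0.
  have ny : 0 < anorm y.
    rewrite lt_neqAle anorm_ge0 andbT; apply: contra_neq y0 => h.
    exact: anorm0_eq0.
  by have := anormM (star y) y; rewrite anorm_star expr2 ler_pM2r.
by apply/eqP; rewrite eq_le le andbT -{2}(starK x) le.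
Qed.

Lemma anorm1 : anorm (1 : A) = 1.
Proof.
have := anorm_star (1 : A); rewrite star1 mulr1 => h.
have h0 : anorm (1 : A) != 0.
  by apply/eqP => /anorm0_eq0 /eqP; rewrite oner_eq0.
apply: (mulfI h0); rewrite mulr1 -expr2; exact/esym.
Qed.

Lemma anorm_cst r : anorm (r%:C *: (1 : A)) = `|r|.
Proof. by rewrite anormZr anorm1 mulr1. Qed.

Lemma anorm_sq x : star x = x -> anorm (x * x) = anorm x ^+ 2.
Proof. by move=> hx; rewrite -anorm_star hx. Qed.

Lemma acvg_star (u : nat -> A) l : acvg u l -> acvg (fun n => star (u n)) (star l).
Proof. by move=> hu e /hu[N hN]; exists N => n /hN; rewrite -starB anorm_starE. Qed.

End StarBasics.

(** * Square roots by iteration *)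

Section SquareRoot.
Context {R : realType} {A : cstarAlgType R}.
Implicit Types (a b x y z : A) (r t c : R).

(* The iteration converges to 1 - sqrt (1 - x); its scalar majorant is the
   iteration at x = 1. *)
Fixpoint visser x (n : nat) : A :=
  if n is m.+1 then (2^-1)%:C *: (x + visser x m * visser x m) else 0.

Fixpoint visser_bound (n : nat) : R :=
  if n is m.+1 then (1 + visser_bound m ^+ 2) / 2 else 0.

Lemma visser_bound_ge0 n : 0 <= visser_bound n.
Proof. by case: n => //= n; rewrite divr_ge0// addr_ge0// sqr_ge0. Qed.

(** At x = 1 convergence is only of order 1/n, so this explicit lower bound takes the place of a
    geometric rate: the increments after N telescope to at most 2 / (N + 2). *)
Lemma visser_bound_lt1 n : 1 - 2 / n.+2%:R <= visser_bound n <= 1.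
Proof.
elim: n => [|n /andP[IH1 IH2]] /=; first by rewrite divff ?subrr ?lexx ?ler01.
have t0 := visser_bound_ge0 n; set t := visser_bound n in IH1 IH2 t0 *.
apply/andP; split; last by nra.
have n3 : (0 : R) < n.+3%:R by [].
have n2 : (0 : R) < n.+2%:R by [].
have e3 : n.+3%:R = n.+2%:R + 1 :> R by rewrite -natr1.
set m : R := n.+2%:R in IH1 n2 e3; rewrite e3 in n3 *.
have m2 : 2 <= m by rewrite /m ler_nat.
have step : 1 - 2 / (m + 1) <= (1 + (1 - 2 / m) ^+ 2) / 2.
  rewrite -subr_ge0 [X in 0 <= X](_ : _ = 2 / (m ^+ 2 * (m + 1))); last first.
    by field; rewrite !gt_eqF.
  by rewrite divr_ge0// mulr_ge0 ?sqr_ge0 ?ltW.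
apply: le_trans step _.
have h0 : 0 <= 1 - 2 / m by rewrite subr_ge0 ler_pdivrMr// mul1r.
by rewrite ler_pM2r ?invr_gt0// lerD2l lerXn2r ?nnegrE.
Qed.

Lemma visser_norm x n : anorm x <= 1 -> anorm (visser x n) <= visser_bound n.
Proof.
move=> hx; elim: n => /= [|n IH]; first by rewrite anorm0.
rewrite anormZr ger0_norm ?invr_ge0//.
have := anormD x (visser x n * visser x n).
have := anormM (visser x n) (visser x n); have := anorm_ge0 (visser x n); nra.
Qed.

(** Writing u u - v v as u (u - v) + (u - v) v bounds it by (t1 + t0) (t1 - t0), which is the same
    difference for the scalar majorant. *)
Lemma visser_step x n : anorm x <= 1 ->
  anorm (visser x n.+1 - visser x n) <= visser_bound n.+1 - visser_bound n.
Proof.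
move=> hx; elim: n => [|n IH].
  by have := visser_norm 1 hx; rewrite /= !subr0.
have b1 := visser_norm n hx; have b2 := visser_norm n.+1 hx.
have bS m : visser_bound m.+1 = (1 + visser_bound m ^+ 2) / 2 by [].
have -> : visser x n.+2 - visser x n.+1 = (2^-1)%:C *:
    (visser x n.+1 * visser x n.+1 - visser x n * visser x n).
  by rewrite /= -scalerBr opprD addrACA subrr add0r.
have -> : visser_bound n.+2 - visser_bound n.+1 =
    (visser_bound n.+1 ^+ 2 - visser_bound n ^+ 2) / 2.
  by rewrite !bS; field.
move: b1 b2 IH; set u := visser x n.+1; set v := visser x n.
move: (visser_bound n.+1) (visser_bound n) => t1 t0 b1 b2 IH.
have -> : u * u - v * v = u * (u - v) + (u - v) * v.
  by rewrite mulrBr mulrBl addrA subrK.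
rewrite anormZr ger0_norm ?invr_ge0//.
have := anormD (u * (u - v)) ((u - v) * v).
have := anormM u (u - v); have := anormM (u - v) v.
have : (anorm u + anorm v) * anorm (u - v) <=
    (t1 + t0) * (t1 - t0).
  by rewrite ler_pM ?addr_ge0 ?anorm_ge0// lerD.
nra.
Qed.

Lemma visser_cauchy x : anorm x <= 1 -> acauchy (visser x).
Proof.
move=> hx.
have tele n k : anorm (visser x (n + k) - visser x n) <=
    visser_bound (n + k) - visser_bound n.
  elim: k => [|k IH]; first by rewrite addn0 !subrr anorm0.
  have := anorm_triangle (visser x (n + k)) (visser x (n + k).+1) (visser x n).
  by rewrite addnS; have := visser_step (n + k) hx; lra.
have tail N n : (N <= n)%N -> anorm (visser x n - visser x N) <= 2 / N.+1%:R.
  move=> /subnKC <-; apply: le_trans (tele _ _) _.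
  have /andP[_ h1] := visser_bound_lt1 (N + (n - N)).
  have /andP[h2 _] := visser_bound_lt1 N.
  have : 2 / N.+2%:R <= 2 / N.+1%:R :> R.
    by rewrite ler_wpM2l// lef_pV2 ?posrE// ler_nat.
  move: h1 h2; move: (2 / N.+2%:R) (2 / N.+1%:R) => r2 r1; lra.
move=> e e0; have e2 : 0 < e / 2 by rewrite divr_gt0.
have [N hN] := inv_small 2 e2; exists N => m n hm hn.
have := anorm_triangle (visser x N) (visser x m) (visser x n).
rewrite (anorm_distC (visser x N)).
have := tail _ _ hm; have := tail _ _ hn; have := hN _ (leqnn N).
by move: (2 / N.+1%:R) => r; lra.
Qed.

Definition visser_lim x : A := xget 0 [set l | acvg (visser x) l].

Lemma visser_limP x : anorm x <= 1 -> acvg (visser x) (visser_lim x).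
Proof.
move=> /visser_cauchy/acauchy_cvg[l hl]; rewrite /visser_lim.
by case: xgetP => [l' -> //|/(_ l)].
Qed.

Lemma visser_lim_eq x : anorm x <= 1 ->
  visser_lim x = (2^-1)%:C *: (x + visser_lim x * visser_lim x).
Proof.
move=> hx; have h := visser_limP hx; apply: (@acvg_uniq _ _ (fun n => visser x n.+1)).
  by move=> e /h[N hN]; exists N => n hn; rewrite hN// leqW.
have := acvgZ (2^-1)%:C (acvgD (acvg_cst x) (acvgM h h)); exact.
Qed.

Lemma visser_lim_norm x : anorm x <= 1 -> anorm (visser_lim x) <= 1.
Proof.
move=> hx; apply: acvg_anorm_le (visser_limP hx) _ => n.
apply: le_trans (visser_norm _ hx) _.
by have /andP[] := visser_bound_lt1 n.
Qed.

(** Two different arguments are allowed so that b can be moved past functions of b^* b, which turn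
    into functions of b b^*. *)
Lemma visser_comm x y z n : z * x = y * z -> z * visser x n = visser y n * z.
Proof.
move=> h; elim: n => /= [|n IH]; first by rewrite mulr0 mul0r.
by rewrite -scalerAr -scalerAl mulrDr mulrDl h mulrA IH -mulrA IH mulrA.
Qed.

Lemma visser_lim_comm x y z : anorm x <= 1 -> anorm y <= 1 ->
  z * x = y * z -> z * visser_lim x = visser_lim y * z.
Proof.
move=> hx hy h; apply: acvg_uniq (acvgMl z (visser_limP hx)) _.
move=> e /(acvgMr z (visser_limP hy))[N hN]; exists N => n /hN.
by rewrite (visser_comm n h).
Qed.

Lemma visser_star x n : star x = x -> star (visser x n) = visser x n.
Proof.
by move=> hx; elim: n => /= [|n IH]; rewrite ?star0// starZr starD starM IH hx.
Qed.

Lemma visser_lim_star x : anorm x <= 1 -> star x = x ->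
  star (visser_lim x) = visser_lim x.
Proof.
move=> hx sx; apply: acvg_uniq (acvg_star (visser_limP hx)) _.
move=> e /(visser_limP hx)[N hN]; exists N => n /hN.
by rewrite (visser_star n sx).
Qed.

(** The square root of c - x for |x| <= c, as sqrt c times sqrt (1 - x / c). At c = 0 the convention
    0^-1 = 0 makes it 0, which is correct because x is then 0. *)
Definition asqrt c x : A :=
  (Num.sqrt c)%:C *: (1 - visser_lim (c^-1%:C *: x)).

Lemma anorm_scaled c x : anorm x <= c -> anorm (c^-1%:C *: x) <= 1.
Proof.
move=> h; have c0 : 0 <= c by apply: le_trans h; exact: anorm_ge0.
rewrite anormZr ger0_norm ?invr_ge0//.
have [->|cn0] := eqVneq c 0; first by rewrite invr0 mul0r.
by rewrite mulrC ler_pdivrMr ?mul1r// lt_neqAle eq_sym cn0.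
Qed.

Lemma asqrt_star c x : anorm x <= c -> star x = x -> star (asqrt c x) = asqrt c x.
Proof.
move=> h sx; rewrite /asqrt starZr starB star1 visser_lim_star//.
  exact: anorm_scaled.
by rewrite starZr sx.
Qed.

Lemma asqrt_sq c x : anorm x <= c -> asqrt c x * asqrt c x = c%:C *: 1 - x.
Proof.
move=> h; have c0 : 0 <= c by apply: le_trans h; exact: anorm_ge0.
have hx := anorm_scaled h.
rewrite /asqrt -scalerAr -scalerAl scalerA -rmorphM /= -expr2 sqr_sqrtr//.
have := visser_lim_eq hx; set y := visser_lim _ => hy.
have -> : (1 - y) * (1 - y) = 1 - c^-1%:C *: x.
  have /(congr1 (fun w => (2 : R)%:C *: w)) := hy.
  rewrite scalerA -rmorphM /= divff// scale1r => h2.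
  rewrite mulrBr mulr1 mulrBl mul1r opprB addrA addrAC -[c^-1%:C *: x](addrK (y * y)).
  rewrite -h2 !opprD !opprK addrA; congr (_ + _).
  by rewrite rmorphD scalerDl scale1r opprD addrA.
have [c00|cn0] := eqVneq c 0; last first.
  by rewrite scalerBr scalerA -rmorphM /= divff// scale1r.
have -> : x = 0 by apply: anorm_small => e e0; rewrite (le_trans h)// c00 ltW.
by rewrite c00 !scale0r subrr.
Qed.

Lemma asqrt_comm c x y z : anorm x <= c -> anorm y <= c -> z * x = y * z ->
  z * asqrt c x = asqrt c y * z.
Proof.
move=> hx hy h; rewrite /asqrt -scalerAr -scalerAl mulrBr mulrBl mulr1 mul1r.
rewrite (visser_lim_comm (anorm_scaled hx) (anorm_scaled hy))//.
by rewrite -scalerAr -scalerAl h.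
Qed.

(** This is the witness that the square root is itself [positive]. *)
Lemma asqrt_near c x : anorm x <= c ->
  anorm ((Num.sqrt c)%:C *: 1 - asqrt c x) <= Num.sqrt c.
Proof.
move=> h; rewrite /asqrt -scalerBr opprB addrC subrK anormZr.
rewrite ger0_norm ?sqrtr_ge0// -[leRHS]mulr1 ler_wpM2l ?sqrtr_ge0//.
exact: visser_lim_norm (anorm_scaled h).
Qed.

End SquareRoot.

(** * Positive elements without spectral theory *)

Section Positivity.
Context {R : realType} {A : cstarAlgType R}.
Implicit Types (a b d h k m p w x y z : A) (r s t c : R).

(* Equivalent to nonnegativity of the spectrum; in this form sums of positive
   elements are positive by the triangle inequality. *)
Definition positive h : Prop :=
  star h = h /\ exists2 t : R, 0 <= t & anorm (t%:C *: 1 - h) <= t.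

Lemma positive_star h : positive h -> star h = h. Proof. by case. Qed.

Lemma star_cst r : star (r%:C *: (1 : A)) = r%:C *: 1.
Proof. by rewrite starZr star1. Qed.

Lemma cst_comm r x : r%:C *: (1 : A) * x = x * (r%:C *: 1).
Proof. by rewrite -scalerAl -scalerAr mul1r mulr1. Qed.

Lemma cstD r s : (r + s)%:C *: (1 : A) = r%:C *: 1 + s%:C *: 1.
Proof. by rewrite rmorphD scalerDl. Qed.

Lemma cstB r s : (r - s)%:C *: (1 : A) = r%:C *: 1 - s%:C *: 1.
Proof. by rewrite rmorphB scalerBl. Qed.

Lemma star_scalei x : star ('i%C *: x) = - ('i%C *: star x).
Proof. by rewrite starZ conj_i scaleNr. Qed.

Lemma mulii x y : ('i%C *: x) * ('i%C *: y) = - (x * y).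
Proof. by rewrite -scalerAr -scalerAl scalerA -expr2 sqr_i scaleN1r. Qed.

Lemma anorm_double x : anorm (x + x) = 2 * anorm x.
Proof.
have -> : x + x = (2 : R)%:C *: x by rewrite rmorphD scalerDl scale1r.
by rewrite anormZr ger0_norm.
Qed.

(* For w = m + ik one has w^* w = c and 2 (m^2 - k^2) = w^2 + w^{*2}. *)
Lemma norm_sub_sq k m c : 0 <= c -> star k = k -> star m = m ->
  k * m = m * k -> k * k + m * m = c%:C *: 1 -> anorm (k * k - m * m) <= c.
Proof.
move=> c0 sk sm km hc; set j := 'i%C *: k; pose w := m + j.
have sw : star w = m - j by rewrite /w starD star_scalei sk sm.
have jj : j * j = - (k * k) by rewrite mulii.
have jm : j * m = m * j by rewrite /j -scalerAl km scalerAr.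
have ww : star w * w = c%:C *: 1.
  rewrite sw /w; have -> : (m - j) * (m + j) = m * m - j * j + (m * j - j * m).
    by ncring.
  by rewrite jm subrr addr0 jj opprK addrC.
have nw : anorm w ^+ 2 = c by rewrite -anorm_star ww anorm_cst ger0_norm.
have nws : anorm (star w) ^+ 2 = c by rewrite anorm_starE.
have e : w * w + star w * star w = - ((k * k - m * m) + (k * k - m * m)).
  rewrite sw /w.
  have -> : (m + j) * (m + j) + (m - j) * (m - j) = m * m + m * m + (j * j + j * j).
    by ncring.
  by rewrite jj; ncring.
have := anormD (w * w) (star w * star w); rewrite e anormN anorm_double.
have := anormM w w; have := anormM (star w) (star w); lra.
Qed.

(** If m is the square root of c - k^2, then c - 2 k^2 = m^2 - k^2 while k^2 + m^2 = c, so
    [norm_sub_sq] applies. Averaging with c itself gives [sq_near1], the positivity of squares. *)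
Lemma sq_near k c : star k = k -> anorm k ^+ 2 <= c ->
  anorm (c%:C *: 1 - (k * k + k * k)) <= c.
Proof.
move=> sk hc; have nk : anorm (k * k) <= c by rewrite anorm_sq.
have skk : star (k * k) = k * k by rewrite starM sk.
have c0 : 0 <= c by apply: le_trans nk; exact: anorm_ge0.
have sm := asqrt_star nk skk; have mm := asqrt_sq nk.
set m := asqrt c (k * k) in sm mm.
have km : k * m = m * k by apply: asqrt_comm => //; rewrite mulrA.
have -> : c%:C *: 1 - (k * k + k * k) = m * m - k * k by rewrite mm; ncring.
by apply: norm_sub_sq; rewrite ?km// mm subrK.
Qed.

Lemma sq_near1 k c : star k = k -> anorm k ^+ 2 <= c ->
  anorm (c%:C *: 1 - k * k) <= c.
Proof.
move=> sk hc; have := sq_near sk hc.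
set u := c%:C *: 1 => h.
have : anorm ((u - k * k) + (u - k * k)) <= anorm (u - (k * k + k * k)) + anorm u.
  have -> : (u - k * k) + (u - k * k) = (u - (k * k + k * k)) + u by ncring.
  exact: anormD.
rewrite anorm_double anorm_cst ger0_norm; first by lra.
by apply: le_trans hc; rewrite sqr_ge0.
Qed.

Lemma positive_sq k : star k = k -> positive (k * k).
Proof.
move=> sk; split; first by rewrite starM sk.
exists (anorm k ^+ 2); rewrite ?sqr_ge0//.
exact: sq_near1.
Qed.

Lemma positiveD x y : positive x -> positive y -> positive (x + y).
Proof.
move=> [sx [t t0 ht]] [sy [s s0 hs]]; split; first by rewrite starD sx sy.
exists (t + s); rewrite ?addr_ge0// cstD opprD addrACA.
by rewrite (le_trans (anormD _ _))// lerD.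
Qed.

Lemma positiveZ r x : 0 <= r -> positive x -> positive (r%:C *: x).
Proof.
move=> r0 [sx [t t0 ht]]; split; first by rewrite starZr sx.
exists (r * t); first by rewrite mulr_ge0.
by rewrite rmorphM -scalerA -scalerBr anormZr ger0_norm// ler_wpM2l.
Qed.

Lemma positive_cst r : 0 <= r -> positive (r%:C *: 1).
Proof.
by move=> r0; split; [exact: star_cst|exists r; rewrite ?subrr ?anorm0].
Qed.

Lemma positive_cst_inv r : positive (r%:C *: 1) -> 0 <= r.
Proof. by case=> _ [t t0]; rewrite -cstB anorm_cst ler_norml; lra. Qed.

Lemma positive_norm_sub h : star h = h -> positive ((anorm h)%:C *: 1 - h).
Proof.
move=> sh; split; first by rewrite starB star_cst sh.
exists (anorm h); first exact: anorm_ge0.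
by rewrite opprB addrC subrK.
Qed.

(** h = t - (t - h) with |t - h| <= t, which is the form that [asqrt] accepts; the last clause holds
    because the iteration only involves h and scalars. *)
Lemma positive_sqrt h : positive h -> exists k, [/\ star k = k, k * k = h,
  positive k & forall z, z * h = h * z -> z * k = k * z].
Proof.
move=> [sh [t t0 ht]]; have sth : star (t%:C *: 1 - h) = t%:C *: 1 - h.
  by rewrite starB star_cst sh.
exists (asqrt t (t%:C *: 1 - h)); split.
- exact: asqrt_star.
- by rewrite asqrt_sq// opprB addrC subrK.
- split; first exact: asqrt_star.
  by exists (Num.sqrt t); [exact: sqrtr_ge0|exact: asqrt_near].
- move=> z hz; apply: asqrt_comm => //.
  by rewrite mulrBr mulrBl hz cst_comm.
Qed.

(** If k and l are the roots of c - z and c + z, then l^2 + k^2 = 2c and l^2 - k^2 = 2z, and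
    [norm_sub_sq] yields 2|z| <= 2c. *)
Lemma positive_norm_le c z : 0 <= c -> positive (c%:C *: 1 - z) ->
  positive (c%:C *: 1 + z) -> anorm z <= c.
Proof.
move=> c0 /positive_sqrt[k [sk kk _ ck]] /positive_sqrt[l [sl ll _ cl]].
have cz : (c%:C *: 1 + z) * (c%:C *: 1 - z) = (c%:C *: 1 - z) * (c%:C *: 1 + z).
  have := cst_comm c z; set u := c%:C *: 1 => uz.
  have -> : (u + z) * (u - z) =
    (u - z) * (u + z) + ((z * u - u * z) + (z * u - u * z)) by ncring.
  by rewrite uz subrr !addr0.
have kl : k * l = l * k by apply: cl; apply/esym/ck.
have := @norm_sub_sq l k (c + c) _ sl sk (esym kl).
rewrite ll kk cstD; set u := c%:C *: 1.
have -> : u + z - (u - z) = z + z by ncring.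
have -> : u + z + (u - z) = u + u by ncring.
by move=> /(_ (addr_ge0 c0 c0) erefl); rewrite anorm_double; lra.
Qed.

Lemma positive_antisym h : positive h -> positive (- h) -> h = 0.
Proof.
move=> h1 h2; apply: anorm0_eq0; apply/eqP; rewrite eq_le anorm_ge0 andbT.
by apply: positive_norm_le; rewrite // scale0r ?add0r.
Qed.

(** For self-adjoint p the C*-identity used twice gives |p|^4 = |p^4|, and p^4 = p^3 p. *)
Lemma nilpotent_sa p : star p = p -> p * p * p = 0 -> p = 0.
Proof.
move=> sp h; have : anorm p ^+ 2 ^+ 2 = 0.
  rewrite -anorm_sq// -anorm_sq; last by rewrite starM sp.
  by rewrite mulrA h mul0r anorm0.
by move=> /eqP; rewrite !expf_eq0 /= => /eqP/anorm0_eq0.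
Qed.

(* [asqrt c (c - x^2) - x] is twice the negative part of x. *)
Lemma negative_part x c : star x = x -> anorm x ^+ 2 <= c ->
  let p := asqrt c (c%:C *: 1 - x * x) - x in
  [/\ star p = p, positive (- (p * x * p)), p * x * p = 0 -> p = 0 &
      positive (p + x)].
Proof.
move=> sx hc; have nx := sq_near1 sx hc.
have scx : star (c%:C *: 1 - x * x) = c%:C *: 1 - x * x.
  by rewrite starB star_cst starM sx.
have sy := asqrt_star nx scx; have yy := asqrt_sq nx.
have py := asqrt_near nx.
have xy : x * asqrt c (c%:C *: 1 - x * x) = asqrt c (c%:C *: 1 - x * x) * x.
  by apply: asqrt_comm => //; rewrite mulrBr mulrBl cst_comm mulrA.
move: sy yy py xy; set y := asqrt c _ => sy yy py xy p.
have {}yy : y * y = x * x by rewrite yy; ncring.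
have posy : positive y by split=> //; exists (Num.sqrt c); rewrite ?sqrtr_ge0.
have sp : star p = p by rewrite starB sx sy.
have yp : y * p = p * y by rewrite /p mulrBr mulrBl xy.
have xp : x * p = - (y * p).
  by rewrite /p mulrBr mulrBr xy yy; ncring.
have e : - (p * x * p) = p * y * p by rewrite -mulrA xp mulrN opprK mulrA.
split=> //; last by rewrite /p subrK.
- rewrite e; have [k [sk kk _ ck]] := positive_sqrt posy.
  have kp : p * k = k * p by apply: ck.
  have -> : p * y * p = (k * p) * (k * p) by rewrite -kk !mulrA kp.
  by apply: positive_sq; rewrite starM sk sp kp.
(* From x p = - y p follows p^2 = (y - x) p = 2 y p, hence p^3 = - 2 p x p = 0. *)
- move=> h0; apply: nilpotent_sa => //.
  have p2 : p * p = y * p + y * p.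
    rewrite {1}/p mulrBl xp; ncring.
  rewrite p2 mulrDl -[y * p]/(y * p) yp -e h0; ncring.
Qed.

(* If p and p' are the doubled negative parts of b^* b and b b^*, then d = b p
   has both d^* d and d d^* negative, whereas d^* d + d d^* is always positive. *)
Lemma positive_starM b : positive (star b * b).
Proof.
set x := star b * b; pose x' := b * star b; pose c := anorm b ^+ 4.
have sx : star x = x by rewrite starM starK.
have sx' : star x' = x' by rewrite starM starK.
have nx : anorm x ^+ 2 <= c by rewrite anorm_star -exprM.
have nx' : anorm x' ^+ 2 <= c.
  by rewrite /x' -{1}(starK b) anorm_star anorm_starE -exprM.
have [sp pp p0 ppx] := negative_part sx nx.
have [sp' pp' _ _] := negative_part sx' nx'.
have bp : b * (asqrt c (c%:C *: 1 - x * x) - x) =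
    (asqrt c (c%:C *: 1 - x' * x') - x') * b.
  have bx : b * x = x' * b by rewrite /x /x' mulrA.
  rewrite mulrBr mulrBl bx; congr (_ - _); apply: asqrt_comm.
  - exact: sq_near1.
  - exact: sq_near1.
  - by rewrite mulrBr mulrBl cst_comm mulrA bx -mulrA bx mulrA.
move: sp pp p0 ppx sp' pp' bp; set p := _ - x; set p' := _ - x'.
move=> sp pp p0 ppx sp' pp' bp.
pose d := b * p.
have dd : star d * d = p * x * p by rewrite /d starM sp /x !mulrA.
have dd' : d * star d = p' * x' * p'.
  by rewrite /d bp starM sp' /x' !mulrA.
have pos2 : positive ((d * star d + star d * d) + (d * star d + star d * d)).
  (* Up to sign, u and v are twice the real and imaginary parts of d, and u^2 + v^2 = 2 (d d^* + d^*
     d). *)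
  pose u := d + star d; pose v := 'i%C *: (d - star d).
  have su : star u = u by rewrite /u starD starK addrC.
  have sv : star v = v by rewrite /v star_scalei starB starK -scalerN opprB.
  have := positiveD (positive_sq su) (positive_sq sv).
  rewrite /u /v mulii; congr positive; ncring.
have h1 : positive ((d * star d + star d * d)).
  have i0 : (0 : R) <= 2^-1 by rewrite invr_ge0.
  have := positiveZ i0 pos2; rewrite scalerDr -scalerDl -rmorphD /=.
  by rewrite (_ : 2^-1 + 2^-1 = 1) ?scale1r//; field.
(* Subtracting the negative element d d^* from the positive sum leaves d^* d positive; being
   negative too, it is 0. *)
have h2 : positive (star d * d).
  have := positiveD h1 pp'; rewrite -dd'; congr positive; ncring.
have dd0 : star d * d = 0 by apply: positive_antisym; rewrite // dd.
by move: ppx; rewrite p0 ?add0r// -dd.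
Qed.

Lemma positive_conj h z : positive h -> positive (star z * h * z).
Proof.
move=> /positive_sqrt[k [sk <- _ _]].
by have := positive_starM (k * z); rewrite starM sk !mulrA.
Qed.

Lemma positive_le_norm t x : positive x -> positive (t%:C *: 1 - x) -> anorm x <= t.
Proof.
move=> hx htx; have t0 : 0 <= t.
  by apply: positive_cst_inv; have := positiveD htx hx; rewrite subrK.
have t2 : 0 <= t / 2 by rewrite divr_ge0.
have tt : t%:C *: (1 : A) = (t / 2)%:C *: 1 + (t / 2)%:C *: 1.
  by rewrite -cstD -splitr.
have h : anorm (x - (t / 2)%:C *: 1) <= t / 2.
  apply: positive_norm_le => //.
    move: htx; rewrite tt; set u := (t / 2)%:C *: 1.
    by congr positive; ncring.
  by rewrite addrC subrK.
have := anormD (x - (t / 2)%:C *: 1) ((t / 2)%:C *: 1).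
by rewrite subrK anorm_cst ger0_norm//; lra.
Qed.

(** The lower bound comes from |1 + h| - (1 + h) >= 0, which says h <= |1 + h| - 1. *)
Lemma anorm1_positive h : positive h -> anorm (1 + h) = 1 + anorm h.
Proof.
move=> ph; apply/eqP; rewrite eq_le; apply/andP; split.
  by rewrite (le_trans (anormD _ _))// anorm1.
rewrite addrC -lerBrDr; apply: positive_le_norm => //.
have s1 : star (1 + h) = 1 + h by rewrite starD star1 (positive_star ph).
have := positive_norm_sub s1; rewrite cstB scale1r; congr positive; ncring.
Qed.

Lemma anorm_le_positive (t : R) a : 0 <= t -> positive ((t ^+ 2)%:C *: 1 - star a * a) ->
  anorm a <= t.
Proof.
move=> t0 h; have := positive_le_norm (positive_starM a) h.
by rewrite anorm_star ler_pXn2r ?nnegrE ?anorm_ge0.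
Qed.

Lemma positive_anorm_sub a : positive ((anorm a ^+ 2)%:C *: 1 - star a * a).
Proof. by rewrite -anorm_star; apply: positive_norm_sub; rewrite starM starK. Qed.

End Positivity.

Section StarMorphisms.
Context {R : realType} {A B : cstarAlgType R} (f : {lrmorphism A -> B}).
Hypothesis sf : star_morphism f.

Lemma star_morphism_positive h : positive h -> positive (f h).
Proof.
move=> /positive_sqrt[k [sk <- _ _]]; rewrite rmorphM.
by apply: positive_sq; rewrite -sf sk.
Qed.

(** A morphism preserves squares of self-adjoint elements, hence the inequality a^* a <= |a|^2. *)
Lemma star_morphism_contractive a : anorm (f a) <= anorm a.
Proof.
apply: anorm_le_positive; first exact: anorm_ge0.
have := star_morphism_positive (positive_anorm_sub a).
by rewrite linearB linearZ /= rmorph1 -sf [f (_ * _)]rmorphM.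
Qed.

End StarMorphisms.

(** * States *)

Section HahnBanach.
Context {R : realType} {Z : banachAlgType R}.
Implicit Types (x y v : Z) (r s c : R) (G : set (Z * R)).

(* The empty graph is allowed because [Zorn_bigcup] ranges over the empty chain
   too. *)
Let partial_functional (x0 : Z) G : Prop :=
  [/\ forall x r y s c, G (x, r) -> G (y, s) -> G (x + c%:C *: y, r + c * s),
      forall x r, G (x, r) -> r <= anorm x &
      G = set0 \/ G (x0, anorm x0)].

(** Only real linearity is obtained here; the state is complexified afterwards. Partial functionals
    are handled as graphs, ordered by inclusion, so that a union of a chain is an upper bound. *)
Lemma hahn_banach_norming (x0 : Z) : exists g : Z -> R,
  [/\ forall x y, g (x + y) = g x + g y, forall r x, g (r%:C *: x) = r * g x,
      forall x, g x <= anorm x & g x0 = anorm x0].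
Proof.
have [|G [[Gl Gd Ge] Gmax]] := @Zorn_bigcup _ (partial_functional x0).
  move=> F FP Ftot; split.
  - move=> x r y s c [G1 F1 G1x] [G2 F2 G2y].
    have [h|h] := Ftot _ _ F1 F2.
      by exists G2 => //; have [+ _ _] := FP _ F2; apply=> //; apply: h.
    by exists G1 => //; have [+ _ _] := FP _ F1; apply=> //; apply: h.
  - by move=> x r [G1 /FP[_ + _]]; apply.
  - have [[G1 [F1 G1n]]|h] := pselect (exists G1, F G1 /\ G1 <> set0).
      right; exists G1 => //; by have [_ _ []] := FP _ F1.
    left; rewrite -subset0 => p [G1 F1 G1p]; apply: h; exists G1; split=> //.
    by move=> G10; rewrite G10 in G1p.
have Gx0 : G (x0, anorm x0).
  case: Ge => // G0; exfalso.
  (* An empty maximal graph would be properly contained in the graph over the line through x0. *)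
  apply: (Gmax [set p | exists c, p = (c%:C *: x0, c * anorm x0)]).
    rewrite properEneq; split; last by rewrite G0.
    apply/eqP; rewrite G0 => /seteqP[_ /(_ (x0, anorm x0))]; apply.
    by exists 1; rewrite scale1r mul1r.
  split=> [x r y s c [c1 [-> ->]] [c2 [-> ->]]|x r [c [-> ->]]|].
  - exists (c1 + c * c2).
    by rewrite rmorphD rmorphM scalerDl scalerA mulrDl mulrA.
  - by rewrite anormZr ler_wpM2r ?anorm_ge0// ler_norm.
  - by right; exists 1; rewrite scale1r mul1r.
have N1 x : (-1)%:C *: x = - x by rewrite rmorphN scaleN1r.
have G0 : G (0, 0).
  by have := Gl _ _ _ _ (-1) Gx0 Gx0; rewrite N1 subrr mulN1r subrr.
have GZ c x r : G (x, r) -> G (c%:C *: x, c * r).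
  by move=> /(Gl _ _ _ _ c G0); rewrite !add0r.
have GD x r y s : G (x, r) -> G (y, s) -> G (x + y, r + s).
  by move=> h1 h2; have := Gl _ _ _ _ 1 h1 h2; rewrite scale1r mul1r.
have total v : exists r, G (v, r).
  have [//|nv] := pselect (exists r, G (v, r)); exfalso.
  (* A value at v is admissible when it lies between all r - |x - v| and all |y + v| - s; the
     supremum of the lower bounds is such a value. *)
  pose S : set R := [set t | exists x r, G (x, r) /\ t = r - anorm (x - v)].
  have ubS y s : G (y, s) -> ubound S (anorm (y + v) - s).
    move=> hy _ [x [r [hx ->]]]; have := Gd _ _ (GD _ _ _ _ hx hy).
    have := anormD (x - v) (y + v); rewrite addrACA addNr addr0; lra.
  have S0 : S !=set0 by exists (0 - anorm (0 - v)), 0, 0.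
  have supS : has_sup S by split=> //; eexists; exact: ubS G0.
  pose al := sup S.
  have al1 x r : G (x, r) -> r - anorm (x - v) <= al.
    by move=> hx; apply: sup_upper_bound => //; exists x, r.
  have al2 y s : G (y, s) -> al <= anorm (y + v) - s.
    by move=> hy; apply: ge_sup => //; exact: ubS.
  apply: (Gmax [set p | exists x r c, G (x, r) /\
            p = (x + c%:C *: v, r + c * al)]).
    rewrite properEneq; split.
      apply/eqP => /seteqP[_ /(_ (v, al))] h; apply: nv; exists al; apply: h.
      by exists 0, 0, 1; rewrite scale1r mul1r !add0r.
    by move=> [x r] hx; exists x, r, 0; rewrite scale0r mul0r !addr0.
  split.
  - move=> _ _ _ _ c [x [r [c1 [hx [-> ->]]]]] [y [s [c2 [hy [-> ->]]]]].
    exists (x + c%:C *: y), (r + c * s), (c1 + c * c2); split; first exact: Gl.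
    rewrite scalerDr scalerA rmorphD rmorphM scalerDl addrACA; congr (_, _).
    ring.
  - move=> _ _ [x [r [c [hx [-> ->]]]]].
    have [c0|c0|->] := ltgtP c 0.
    + have d0 : 0 < - c by rewrite oppr_gt0.
      have := al1 _ _ (GZ (- c)^-1 _ _ hx).
      have -> : (- c)^-1%:C *: x - v = (- c)^-1%:C *: (x + c%:C *: v).
        by rewrite scalerDr scalerA -rmorphM /= invrN mulNr mulVf ?lt_eqF// N1.
      rewrite anormZr ger0_norm; last by rewrite invr_ge0 ltW.
      rewrite -mulrBr mulrC ler_pdivrMr//.
      by rewrite mulrN; lra.
    + have := al2 _ _ (GZ c^-1 _ _ hx).
      have -> : c^-1%:C *: x + v = c^-1%:C *: (x + c%:C *: v).
        by rewrite scalerDr scalerA -rmorphM /= mulVf ?gt_eqF// scale1r.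
      rewrite anormZr ger0_norm; last by rewrite invr_ge0 ltW.
      rewrite -mulrBr [leRHS]mulrC.
      by rewrite ler_pdivlMr//; lra.
    + by rewrite scale0r mul0r !addr0; exact: Gd.
  - by right; exists x0, (anorm x0), 0; rewrite scale0r mul0r !addr0.
have Guniq x r s : G (x, r) -> G (x, s) -> r = s.
  move=> hr hs; have := Gd _ _ (Gl _ _ _ _ (-1) hr hs).
  have := Gd _ _ (Gl _ _ _ _ (-1) hs hr); rewrite N1 subrr anorm0; lra.
pose g x := sval (cid (total x)).
have Gg x : G (x, g x) by rewrite /g; case: cid.
exists g; split.
- by move=> x y; apply: Guniq (Gg _) _; exact: GD.
- by move=> r x; apply: Guniq (Gg _) _; exact: GZ.
- by move=> x; exact: Gd (Gg x).
- exact: Guniq (Gg _) Gx0.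
Qed.

End HahnBanach.

Section States.
Context {R : realType} {A : cstarAlgType R}.

Record state := State {
  state_fun :> A -> R[i];
  stateD : forall x y, state_fun (x + y) = state_fun x + state_fun y;
  stateZ : forall (c : R[i]) x, state_fun (c *: x) = c * state_fun x;
  state_star : forall x, state_fun (star x) = (state_fun x)^*;
  state_ge0 : forall x, 0 <= state_fun (star x * x);
  state1 : state_fun 1 = 1
}.

(* Norming 1 + h instead of h = a^* a forces the functional to be 1 at 1, because
   |1 + h| = 1 + |h|. *)
Lemma exists_state (a : A) : exists f : state,
  f (star a * a) = (anorm a ^+ 2)%:C.
Proof.
set h := star a * a; have ph : positive h := positive_starM a.
have [g [gD gZ gle gx0]] := hahn_banach_norming (1 + h).
have g1 : g 1 = 1.
  have := gle 1; have := gle h; rewrite gD anorm1_positive// in gx0.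
  by rewrite anorm1; lra.
have gh : g h = anorm h.
  by move: gx0; rewrite gD anorm1_positive// g1; lra.
have g_ge0 x : positive x -> 0 <= g x.
  case=> _ [t t0 ht]; have := gle (t%:C *: 1 - x).
  have -> : t%:C *: 1 - x = t%:C *: 1 + (-1)%:C *: x by rewrite rmorphN scaleN1r.
  rewrite gD !gZ g1; move: ht.
  have -> : t%:C *: 1 - x = t%:C *: 1 + (-1)%:C *: x by rewrite rmorphN scaleN1r.
  lra.
(* Averaging g over the involution makes G vanish on i times a self-adjoint element, so that the
   complexification is real on self-adjoint elements. *)
pose G x := 2^-1 * g (x + star x).
have GD x y : G (x + y) = G x + G y.
  by rewrite /G starD addrACA gD mulrDr.
have GZ r x : G (r%:C *: x) = r * G x.
  by rewrite /G starZr -scalerDr gZ mulrCA.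
have Gs x : G (star x) = G x by rewrite /G starK addrC.
have GN x : G (- x) = - G x.
  by rewrite -scaleN1r -[-1]/(- (1 : R)%:C) -rmorphN GZ mulN1r.
have Gsa x : star x = x -> G x = g x.
  by move=> sx; rewrite /G sx gD; field.
have Gi x : star x = x -> G ('i%C *: x) = 0.
  move=> sx; have := Gs ('i%C *: x); rewrite star_scalei sx GN; lra.
clearbody G.
(* The complex-linear functional whose real part is G. *)
pose F x : R[i] := (G x)%:C - 'i%C * (G ('i%C *: x))%:C.
have FD x y : F (x + y) = F x + F y.
  by rewrite /F scalerDr !GD !rmorphD /=; ring.
have FZr (r : R) x : F (r%:C *: x) = r%:C * F x.
  have e : 'i%C *: (r%:C *: x) = r%:C *: ('i%C *: x) by rewrite !scalerA mulrC.
  by rewrite /F e !GZ !rmorphM /=; ring.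
have Fi x : F ('i%C *: x) = 'i%C * F x.
  rewrite /F scalerA -expr2 sqr_i scaleN1r GN rmorphN /=.
  by rewrite mulrBr mulrA -expr2 sqr_i; ring.
have FZ c x : F (c *: x) = c * F x.
  rewrite [c]complexE scalerDl -scalerA FD FZr Fi FZr; ring.
have Fs x : F (star x) = (F x)^*.
  rewrite /F rmorphB rmorphM /= !conj_real conj_i Gs.
  have -> : 'i%C *: star x = star (- ('i%C *: x)).
    by rewrite starN star_scalei opprK.
  by rewrite Gs GN rmorphN /=; ring.
have Fsa x : star x = x -> F x = (g x)%:C.
  by move=> sx; rewrite /F Gsa// Gi// mulr0 subr0.
have F0 x : 0 <= F (star x * x).
  by rewrite Fsa ?starM ?starK// ler0c; exact/g_ge0/positive_starM.
have F1 : F 1 = 1 by rewrite Fsa ?star1// g1.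
exists (State FD FZ Fs F0 F1) => /=.
by rewrite Fsa ?starM ?starK// gh anorm_star.
Qed.

End States.
Arguments state {R} A.

(** * Completion of a positive form to a Hilbert space *)

Section ComplexLimits.
Context {R : realType}.
Implicit Types (u : nat -> R[i]) (l z : R[i]).

Definition ccvg u l : Prop := forall e : R, 0 < e ->
  exists N, forall n, (N <= n)%N -> rnorm (u n - l) < e.

(** Only e <= 1 is tested because the uniform bounds on approximants in [cfun_bound] hold in that
    range. *)
Lemma rnorm_small z (C : R) :
  (forall e : R, 0 < e <= 1 -> rnorm z <= e * C) -> z = 0.
Proof.
move=> h; suff: rnorm z <= 0.
  move=> z0; apply/eqP; rewrite -normr_eq0 -rnormC.
  by rewrite (_ : rnorm z = 0) ?eqxx//; apply/eqP; rewrite eq_le z0 rnorm_ge0.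
apply/ler_addgt0Pl => e e0; rewrite addr0.
have C1 : 0 < `|C| + 1 by rewrite ltr_pwDr.
pose d := Num.min 1 (e / (`|C| + 1)).
have d01 : 0 < d <= 1 by rewrite lt_min ltr01 divr_gt0//= ge_min lexx.
apply: le_trans (h _ d01) _.
have : d * (`|C| + 1) <= e by rewrite -ler_pdivlMr// ge_min lexx orbT.
have := ler_norm C; have /andP[d0 _] := d01; nra.
Qed.

Lemma rnormB (x y : R[i]) : rnorm (x - y) <= rnorm x + rnorm y.
Proof. by have := rnormD x (- y); rewrite /rnorm normrN. Qed.

Lemma rnorm_distC (x y : R[i]) : rnorm (x - y) = rnorm (y - x).
Proof. by rewrite /rnorm distrC. Qed.

Lemma rnorm_triangle (y x z : R[i]) :
  rnorm (x - z) <= rnorm (x - y) + rnorm (y - z).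
Proof. by rewrite -(subrKA y) rnormD. Qed.

Lemma rnorm_ReIm z : rnorm z <= `|complex.Re z| + `|complex.Im z|.
Proof.
rewrite {1}[z]complexE; apply: le_trans (rnormD _ _) _.
by rewrite rnormM rnorm_i mul1r !rnorm_real.
Qed.

Lemma ReD (x y : R[i]) : complex.Re (x + y) = complex.Re x + complex.Re y.
Proof. by case: x; case: y. Qed.

Lemma ReB (x y : R[i]) : complex.Re (x - y) = complex.Re x - complex.Re y.
Proof. by case: x; case: y. Qed.

Lemma ImB (x y : R[i]) : complex.Im (x - y) = complex.Im x - complex.Im y.
Proof. by case: x; case: y. Qed.

Lemma Re_norm_le z : `|complex.Re z| <= rnorm z.
Proof. by rewrite -lecR rnormC normc_ge_Re. Qed.

Lemma Im_norm_le z : `|complex.Im z| <= rnorm z.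
Proof.
have := Re_norm_le (z * 'i%C); rewrite ReiNIm normrN.
by rewrite rnormM rnorm_i mulr1.
Qed.

Lemma real_cauchy_cvg (u : nat -> R) :
  (forall e : R, 0 < e -> exists N, forall m n, (N <= m)%N -> (N <= n)%N ->
     `|u m - u n| < e) ->
  exists l : R, forall e : R, 0 < e -> exists N, forall n, (N <= n)%N ->
     `|u n - l| < e.
Proof.
move=> hu; have /cvg_ex[l hl] : cvg (u @ \oo).
  apply: cauchy_cvg; apply: cauchy_exP => e /hu[N hN].
  by exists (u N); exists N => // n /= hn; exact: hN.
exists l => e e0; move/cvgrPdist_lt : hl => /(_ e e0)[N _ hN].
by exists N => n /hN /=; rewrite distrC.
Qed.

Lemma complex_cauchy_cvg u :
  (forall e : R, 0 < e -> exists N, forall m n, (N <= m)%N -> (N <= n)%N ->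
     rnorm (u m - u n) < e) -> exists l, ccvg u l.
Proof.
move=> hu.
have [a ha] : exists a, forall e : R, 0 < e -> exists N, forall n, (N <= n)%N ->
    `|complex.Re (u n) - a| < e.
  apply: real_cauchy_cvg => e /hu[N hN]; exists N => m n hm hn.
  by apply: le_lt_trans (hN _ _ hm hn); rewrite -ReB Re_norm_le.
have [b hb] : exists b, forall e : R, 0 < e -> exists N, forall n, (N <= n)%N ->
    `|complex.Im (u n) - b| < e.
  apply: real_cauchy_cvg => e /hu[N hN]; exists N => m n hm hn.
  by apply: le_lt_trans (hN _ _ hm hn); rewrite -ImB Im_norm_le.
exists (a +i* b) => e e0; have e2 : 0 < e / 2 by rewrite divr_gt0.
have [N1 h1] := ha _ e2; have [N2 h2] := hb _ e2.
exists (maxn N1 N2) => n; rewrite geq_max => /andP[/h1 x1 /h2 x2].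
apply: le_lt_trans (rnorm_ReIm _) _; move: x1 x2.
by case: (u n) => p r /=; lra.
Qed.

Lemma ccvg_le u l z (C : R) : ccvg u l ->
  (exists N, forall n, (N <= n)%N -> rnorm (u n - z) <= C) -> rnorm (l - z) <= C.
Proof.
move=> hu [N hN]; apply/ler_addgt0Pl => e /hu[N' hN'].
have := hN _ (leq_maxl N N'); have := hN' _ (leq_maxr N N').
have := rnorm_triangle (u (maxn N N')) l z.
rewrite (rnorm_distC l (u _)); lra.
Qed.

End ComplexLimits.

Section PsdForms.
Context {R : realType}.

Record psd_form (E : lmodType R[i]) := PsdForm {
  form :> E -> E -> R[i];
  form_linearl : forall c x y z, form (c *: x + y) z = c * form x z + form y z;
  formC : forall x y, form y x = (form x y)^*;
  form_ge0 : forall x, 0 <= form x x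
}.

Context {E : lmodType R[i]} (q : psd_form E).
Implicit Types (x y z : E) (c : R[i]).

Definition fnorm x : R := Num.sqrt (complex.Re (q x x)).

Lemma formDl x y z : q (x + y) z = q x z + q y z.
Proof. by have := form_linearl q 1 x y z; rewrite scale1r mul1r. Qed.

Lemma form0l z : q 0 z = 0.
Proof. by apply: (@addIr _ (q 0 z)); rewrite -formDl !add0r. Qed.

Lemma formZl c x z : q (c *: x) z = c * q x z.
Proof. by have := form_linearl q c x 0 z; rewrite addr0 form0l addr0. Qed.

Lemma formNl x z : q (- x) z = - q x z.
Proof. by rewrite -scaleN1r formZl mulN1r. Qed.

Lemma formBl x y z : q (x - y) z = q x z - q y z.
Proof. by rewrite formDl formNl. Qed.

Lemma formDr x y z : q z (x + y) = q z x + q z y.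
Proof. by rewrite !(formC q _ z) formDl rmorphD. Qed.

Lemma formZr c x z : q z (c *: x) = c^* * q z x.
Proof. by rewrite !(formC q _ z) formZl rmorphM. Qed.

Lemma formNr x z : q z (- x) = - q z x.
Proof. by rewrite !(formC q _ z) formNl rmorphN. Qed.

Lemma formBr x y z : q z (x - y) = q z x - q z y.
Proof. by rewrite formDr formNr. Qed.

Lemma form_Re x : q x x = (complex.Re (q x x))%:C.
Proof. by rewrite RRe_real// ger0_real// form_ge0. Qed.

Lemma Re_form_ge0 x : 0 <= complex.Re (q x x).
Proof. by rewrite -ler0c -form_Re form_ge0. Qed.

Lemma fnorm_ge0 x : 0 <= fnorm x. Proof. exact: sqrtr_ge0. Qed.

Lemma fnorm_sq x : fnorm x ^+ 2 = complex.Re (q x x).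
Proof. by rewrite sqr_sqrtr// Re_form_ge0. Qed.

Lemma cauchy_schwarz x y : rnorm (q x y) <= fnorm x * fnorm y.
Proof.
set b := q x y; set a := complex.Re (q x x); set d := complex.Re (q y y).
have a0 : 0 <= a := Re_form_ge0 x; have d0 : 0 <= d := Re_form_ge0 y.
have [B BE] : exists B, B = rnorm b ^+ 2 by eexists.
have B0 : 0 <= B by rewrite BE sqr_ge0.
have bb : b * b^* = B%:C by rewrite BE; exact: normc_rnorm_sq.
have key t : 0 <= a - 2 * t * B + t ^+ 2 * B * d.
  rewrite -ler0c; have := form_ge0 q (x - (t%:C * b) *: y).
  rewrite !formBl !formBr !formZl !formZr -/b (formC q x y) -/b !rmorphM /=.
  rewrite conj_real (form_Re x) (form_Re y) -/a -/d.
  rewrite expr2 rmorphD rmorphB !rmorphM /= rmorph_nat -bb.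
  by congr (0 <= _); ring.
have : B <= a * d.
  have [d00|dn0] := eqVneq d 0.
    rewrite d00 mulr0; have [->//|Bn0] := eqVneq B 0.
    have Bp : 0 < B by rewrite lt_neqAle eq_sym Bn0.
    (* With d = 0 the inequality reads 2 t B <= a for all t; this t makes the left side a + 1. *)
    have := key ((a + 1) / (2 * B)); rewrite d00 mulr0 addr0.
    rewrite (_ : 2 * _ * B = a + 1); first by lra.
    by field.
  have dp : 0 < d by rewrite lt_neqAle eq_sym dn0.
  have := key d^-1; rewrite (_ : _ + _ = (a * d - B) / d); last by field.
  by rewrite pmulr_lge0 ?invr_gt0// subr_ge0.
rewrite /fnorm -/a -/d -sqrtrM// => h.
by rewrite -(ger0_norm (rnorm_ge0 b)) -sqrtr_sqr -BE ler_sqrt// mulr_ge0.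
Qed.

Lemma fnormZ c x : fnorm (c *: x) = rnorm c * fnorm x.
Proof.
rewrite /fnorm formZl formZr mulrA normc_rnorm_sq form_Re -rmorphM /=.
by rewrite sqrtrM ?sqr_ge0// sqrtr_sqr ger0_norm// rnorm_ge0.
Qed.

Lemma fnormN x : fnorm (- x) = fnorm x.
Proof. by rewrite /fnorm formNl formNr opprK. Qed.

Lemma fnorm_distC x y : fnorm (x - y) = fnorm (y - x).
Proof. by rewrite -fnormN opprB. Qed.

Lemma fnormD x y : fnorm (x + y) <= fnorm x + fnorm y.
Proof.
rewrite -(@ler_pXn2r _ 2)// ?nnegrE ?addr_ge0 ?fnorm_ge0//.
rewrite sqrrD !fnorm_sq formDl !formDr (formC q x y) !ReD.
have := cauchy_schwarz x y; have := Re_le_rnorm (q x y).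
have -> : complex.Re (q x y)^* = complex.Re (q x y).
  by rewrite conjcE; case: (q x y).
lra.
Qed.

Lemma fnormB x y : fnorm (x - y) <= fnorm x + fnorm y.
Proof. by rewrite -(fnormN y) fnormD. Qed.

End PsdForms.

(* The completion of a form q is realised inside the antidual of E: an element
   is a functional that is approximated by the functionals q u. *)
Section Completion.
Context {R : realType} {E : lmodType R[i]} (q : psd_form E).
Implicit Types (u v x y : E) (c : R[i]).

Definition approx (phi : E -> R[i]) (u : E) (e : R) : Prop :=
  forall x, rnorm (phi x - q u x) <= e * fnorm q x.

Definition approximable (phi : E -> R[i]) : Prop :=
  forall e : R, 0 < e -> exists u, approx phi u e.

Record completion := Completion {
  cfun :> E -> R[i];
  cfunP : approximable cfun
}.

Implicit Types (phi psi chi : completion).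

Lemma completion_eq phi psi : (forall x, phi x = psi x) -> phi = psi.
Proof.
case: phi psi => f hf [g hg] /= h; have e : f = g by apply/funext.
by case: _ / e hg => hg; congr Completion; exact: Prop_irrelevance.
Qed.

HB.instance Definition _ := gen_eqMixin completion.
HB.instance Definition _ := gen_choiceMixin completion.

Lemma approximable0 : approximable (fun=> 0).
Proof. by move=> e e0; exists 0 => x; rewrite form0l subrr /rnorm normr0 mulr_ge0 ?fnorm_ge0// ltW. Qed.

Lemma approximableD phi psi : approximable (fun x => phi x + psi x).
Proof.
move=> e e0; have e2 : 0 < e / 2 by rewrite divr_gt0.
have [u hu] := cfunP phi e2; have [v hv] := cfunP psi e2.
exists (u + v) => x; rewrite formDl opprD addrACA.
by apply: le_trans (rnormD _ _) _; have := hu x; have := hv x; lra.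
Qed.

Lemma approximableZ c phi : approximable (fun x => c * phi x).
Proof.
move=> e e0; have c1 : 0 < rnorm c + 1 by rewrite ltr_pwDr ?rnorm_ge0.
have [d d0 ed] : exists2 d, 0 < d & d * (rnorm c + 1) = e.
  by exists (e / (rnorm c + 1)); rewrite ?divr_gt0// divfK// gt_eqF.
have [u hu] := cfunP phi d0.
exists (c *: u) => x; rewrite formZl -mulrBr rnormM -ed.
have := ler_wpM2l (rnorm_ge0 c) (hu x).
have : 0 <= d * fnorm q x by rewrite mulr_ge0 ?fnorm_ge0// ltW.
lra.
Qed.

Definition completion0 := Completion approximable0.
Definition completionD phi psi := Completion (approximableD phi psi).
Definition completionZ c phi := Completion (approximableZ c phi).
Definition completionN phi := completionZ (-1) phi.

Let caddA : associative completionD.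
Proof. by move=> *; apply: completion_eq => x /=; rewrite addrA. Qed.
Let caddC : commutative completionD.
Proof. by move=> *; apply: completion_eq => x /=; rewrite addrC. Qed.
Let cadd0 : left_id completion0 completionD.
Proof. by move=> *; apply: completion_eq => x /=; rewrite add0r. Qed.
Let caddN : left_inverse completion0 completionN completionD.
Proof. by move=> *; apply: completion_eq => x /=; rewrite mulN1r addNr. Qed.

HB.instance Definition _ :=
  GRing.isZmodule.Build completion caddA caddC cadd0 caddN.

Let cscaleA c d phi : completionZ c (completionZ d phi) = completionZ (c * d) phi.
Proof. by apply: completion_eq => x /=; rewrite mulrA. Qed.
Let cscale1 : left_id 1 completionZ.
Proof. by move=> ?; apply: completion_eq => x /=; rewrite mul1r. Qed.
Let cscaleDr : right_distributive completionZ +%R.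
Proof. by move=> *; apply: completion_eq => x /=; rewrite mulrDr. Qed.
Let cscaleDl phi : {morph completionZ^~ phi : c d / c + d}.
Proof. by move=> *; apply: completion_eq => x /=; rewrite mulrDl. Qed.

HB.instance Definition _ := GRing.Zmodule_isLmodule.Build R[i] completion
  cscaleA cscale1 cscaleDr cscaleDl.

Lemma cfunD phi psi x : (phi + psi) x = phi x + psi x. Proof. by []. Qed.
Lemma cfunZ c phi x : (c *: phi) x = c * phi x. Proof. by []. Qed.
Lemma cfunN phi x : (- phi) x = - phi x.
Proof. by rewrite -mulN1r. Qed.

(** Antilinearity is no field of [completion]: it is inherited from the functionals q u that
    approximate phi. *)
Lemma cfun_addr phi x y : phi (x + y) = phi x + phi y.
Proof.
apply/eqP; rewrite -subr_eq0; apply/eqP.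
apply: (@rnorm_small _ _ (fnorm q (x + y) + fnorm q x + fnorm q y)).
move=> e /andP[e0 _]; have [u hu] := cfunP phi e0.
have := hu (x + y); have := hu x; have := hu y; rewrite formDr.
set a := phi (x + y); set b := phi x; set d := phi y; set s := q u x; set t := q u y.
have -> : a - (b + d) = (a - (s + t)) - ((b - s) + (d - t)) by ring.
have := rnormB (a - (s + t)) ((b - s) + (d - t)).
have := rnormD (b - s) (d - t); lra.
Qed.

Lemma cfun_scaler phi c x : phi (c *: x) = c^* * phi x.
Proof.
apply/eqP; rewrite -subr_eq0; apply/eqP.
apply: (@rnorm_small _ _ (fnorm q (c *: x) + rnorm c * fnorm q x)).
move=> e /andP[e0 _]; have [u hu] := cfunP phi e0.
have := hu (c *: x); have := hu x; rewrite formZr.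
set a := phi (c *: x); set b := phi x; set s := q u x; set k := c^*.
have -> : a - k * b = (a - k * s) - k * (b - s) by ring.
have := rnormB (a - k * s) (k * (b - s)); rewrite rnormM rnorm_conj.
move=> h1 h2 h3; have := ler_wpM2l (rnorm_ge0 c) h2; lra.
Qed.

Lemma cfun_subr phi x y : phi (x - y) = phi x - phi y.
Proof.
by rewrite cfun_addr -scaleN1r cfun_scaler rmorphN rmorph1 mulN1r.
Qed.

(** Testing both estimates at x = u gives |u|^2 <= (e + d) |u|. *)
Lemma approx_norm_le (f : E -> R[i]) u e d : 0 <= e -> 0 <= d ->
  (forall x, rnorm (f x) <= e * fnorm q x) -> approx f u d -> fnorm q u <= e + d.
Proof.
move=> e0 d0 he hd; have := he u; have := hd u.
have := rnorm_triangle (f u) (q u u) 0; rewrite !subr0 rnorm_distC.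
rewrite {1}form_Re rnorm_real ger0_norm ?Re_form_ge0// -fnorm_sq.
have := fnorm_ge0 q u; move: (fnorm q u) => n n0 h1 h2 h3.
have [->|nn0] := eqVneq n 0; first by rewrite addr_ge0.
have np : 0 < n by rewrite lt_neqAle eq_sym nn0.
by rewrite -(ler_pM2r np); lra.
Qed.

Lemma approx_dist (f : E -> R[i]) u v e d : 0 <= e -> 0 <= d ->
  approx f u e -> approx f v d -> fnorm q (u - v) <= e + d.
Proof.
move=> e0 d0 hu hv; rewrite -[e + d]addr0.
apply: (@approx_norm_le (q (u - v))); rewrite ?addr_ge0//.
  move=> x; rewrite formBl.
  have := rnorm_triangle (f x) (q u x) (q v x); rewrite (rnorm_distC (q u x) (f x)).
  by have := hu x; have := hv x; lra.
by move=> x; rewrite subrr /rnorm normr0 mul0r.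
Qed.

Lemma cfun_bound phi : exists M : R, [/\ 0 <= M,
  forall x, rnorm (phi x) <= M * fnorm q x &
  forall u e, 0 <= e <= 1 -> approx phi u e -> fnorm q u <= M].
Proof.
have [u0 h0] := cfunP phi ltr01; exists (fnorm q u0 + 2); split.
- by rewrite addr_ge0 ?fnorm_ge0.
- move=> x; have := h0 x; have := cauchy_schwarz q u0 x.
  have := rnormD (phi x - q u0 x) (q u0 x); rewrite subrK.
  by have := fnorm_ge0 q x; lra.
- move=> u e /andP[e0 e1] hu; have := approx_dist e0 ler01 hu h0.
  by have := fnormD q (u - u0) u0; rewrite subrK; lra.
Qed.

Definition cseq phi (n : nat) : E :=
  sval (cid (cfunP phi (divr_gt0 ltr01 (ltr0Sn R n)))).

Lemma cseqP phi n : approx phi (cseq phi n) (1 / n.+1%:R).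
Proof. by rewrite /cseq; case: cid. Qed.

(** The functional phi is evaluated along vectors tending to psi. As phi is antilinear, the result
    is linear in phi and antilinear in psi. *)
Definition cinner phi psi : R[i] :=
  xget 0 [set l | ccvg (fun n => phi (cseq psi n)) l].

Lemma cinnerP phi psi : ccvg (fun n => phi (cseq psi n)) (cinner phi psi).
Proof.
suff [l hl] : exists l, ccvg (fun n => phi (cseq psi n)) l.
  by rewrite /cinner; case: xgetP => [l' -> //|/(_ l)].
have [M [M0 hM _]] := cfun_bound phi.
apply: complex_cauchy_cvg => e e0.
have [N hN] := inv_small (2 * M) e0; exists N => m n hm hn.
rewrite -cfun_subr; apply: le_lt_trans (hM _) _.
have inv k : (N <= k)%N -> 1 / k.+1%:R <= 1 / N.+1%:R :> R.
  by move=> ?; rewrite ler_wpM2l// lef_pV2 ?posrE// ler_nat.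
have i0 k : 0 <= 1 / k.+1%:R :> R by rewrite divr_ge0.
have := approx_dist (i0 m) (i0 n) (cseqP psi m) (cseqP psi n).
have := hN _ (leqnn N); have -> : 2 * M / N.+1%:R = M * (2 * (1 / N.+1%:R)).
  by rewrite mul1r -mulrA mulrCA.
move=> h1 h2; apply: le_lt_trans h1; rewrite ler_wpM2l//.
move: h2 (inv _ hm) (inv _ hn).
by move: (1 / m.+1%:R) (1 / n.+1%:R) (1 / N.+1%:R) => a b d; lra.
Qed.

Lemma cinner_approx phi psi v (M d : R) : 0 <= M -> 0 <= d ->
  (forall x, rnorm (phi x) <= M * fnorm q x) ->
  approx psi v d -> rnorm (cinner phi psi - phi v) <= M * d.
Proof.
move=> M0 d0 hM hv; apply/ler_addgt0Pl => e e0.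
have [N hN] := inv_small M e0.
apply: ccvg_le (cinnerP phi psi) _; exists N => n hn.
rewrite -cfun_subr; apply: le_trans (hM _) _.
have i0 : 0 <= 1 / n.+1%:R :> R by rewrite divr_ge0.
have := approx_dist i0 d0 (cseqP psi n) hv.
move=> /(ler_wpM2l M0); rewrite mulrDr mul1r; have := hN _ hn.
by move: (M / n.+1%:R) => t; lra.
Qed.

Lemma approximable_form u : approximable (q u).
Proof.
move=> e e0; exists u => x.
by rewrite subrr /rnorm normr0 mulr_ge0 ?fnorm_ge0// ltW.
Qed.

Definition cembed u : completion := Completion (approximable_form u).

Lemma approx_embed u : approx (cembed u) u 0.
Proof. by move=> x; rewrite subrr /rnorm normr0 mul0r. Qed.

Lemma cinner_embedr phi v : cinner phi (cembed v) = phi v.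
Proof.
have [M [M0 hM _]] := cfun_bound phi.
apply/eqP; rewrite -subr_eq0; apply/eqP; apply: (@rnorm_small _ _ 0) => e _.
rewrite mulr0 -[leRHS](mulr0 M); apply: cinner_approx => //.
exact: approx_embed.
Qed.

Lemma cinner_linearl c phi psi chi :
  cinner (c *: phi + psi) chi = c * cinner phi chi + cinner psi chi.
Proof.
have [M1 [M10 hM1 _]] := cfun_bound phi.
have [M2 [M20 hM2 _]] := cfun_bound psi.
have [M3 [M30 hM3 _]] := cfun_bound (c *: phi + psi).
apply/eqP; rewrite -subr_eq0; apply/eqP.
apply: (@rnorm_small _ _ (M3 + rnorm c * M1 + M2)) => e /andP[e0 _].
have [v hv] := cfunP chi e0.
have h1 := cinner_approx M10 (ltW e0) hM1 hv.
have h2 := cinner_approx M20 (ltW e0) hM2 hv.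
have := cinner_approx M30 (ltW e0) hM3 hv; rewrite cfunD cfunZ.
move: h1 h2; set z := cinner (_ + _) _; set x := cinner phi _; set y := cinner psi _.
set a := phi v; set b := psi v => h1 h2 h3.
have -> : z - (c * x + y) = (z - (c * a + b)) - (c * (x - a) + (y - b)) by ring.
have := rnormB (z - (c * a + b)) (c * (x - a) + (y - b)).
have := rnormD (c * (x - a)) (y - b); rewrite rnormM.
have := ler_wpM2l (rnorm_ge0 c) h1; lra.
Qed.

(** With M independent of e, symmetry and positivity pass from q to the completion by letting e tend
    to 0. *)
Lemma cinner_close phi psi : exists M : R, forall e u v, 0 < e <= 1 ->
  approx phi u e -> approx psi v e -> rnorm (cinner phi psi - q u v) <= e * M.
Proof.
have [M1 [M10 hM1 _]] := cfun_bound phi.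
have [M2 [M20 _ hM2]] := cfun_bound psi.
exists (M1 + M2) => e u v /andP[e0 e1] hu hv.
have e01 : 0 <= e <= 1 by rewrite ltW.
have := cinner_approx M10 (ltW e0) hM1 hv; have := hu v.
have := ler_wpM2l (ltW e0) (hM2 _ _ e01 hv).
have := rnorm_triangle (phi v) (cinner phi psi) (q u v); lra.
Qed.

Lemma cinnerC phi psi : cinner psi phi = (cinner phi psi)^*.
Proof.
have [M1 h1] := cinner_close phi psi; have [M2 h2] := cinner_close psi phi.
apply/eqP; rewrite -subr_eq0; apply/eqP; apply: (@rnorm_small _ _ (M1 + M2)).
move=> e e01; have /andP[e0 _] := e01.
have [u hu] := cfunP phi e0; have [v hv] := cfunP psi e0.
have := h1 _ _ _ e01 hu hv; have := h2 _ _ _ e01 hv hu.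
rewrite -(rnorm_conj (cinner phi psi - _)) rmorphB /= -(formC q).
have := rnormB (cinner psi phi - q v u) ((cinner phi psi)^* - q v u).
rewrite opprB addrA subrK; lra.
Qed.

Lemma cinner_ge0 phi : 0 <= cinner phi phi.
Proof.
have him : complex.Im (cinner phi phi) = 0.
  by have := cinnerC phi phi; rewrite conjcE; case: (cinner _ _) => a b /= []; lra.
have hre : 0 <= complex.Re (cinner phi phi).
  have [M h] := cinner_close phi phi; apply/ler_addgt0Pr => e e0.
  have M1 : 0 < `|M| + 1 by rewrite ltr_pwDr.
  pose d := Num.min 1 (e / (`|M| + 1)).
  have d01 : 0 < d <= 1 by rewrite lt_min ltr01 divr_gt0//= ge_min lexx.
  have dM : d * (`|M| + 1) <= e by rewrite -ler_pdivlMr// ge_min lexx orbT.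
  have /andP[d0 _] := d01; have [u hu] := cfunP phi d0.
  have := h _ _ _ d01 hu hu; have := Re_form_ge0 q u.
  have := Re_norm_le (cinner phi phi - q u u); rewrite ReB ler_norml.
  move=> /andP[a1 _]; have := ler_norm M; nra.
by rewrite lecE him eqxx.
Qed.

Definition cform : psd_form completion :=
  PsdForm cinner_linearl cinnerC cinner_ge0.

Lemma fnorm_embed u : fnorm cform (cembed u) = fnorm q u.
Proof. by rewrite /fnorm /= cinner_embedr. Qed.

Lemma cfun_le phi x : rnorm (phi x) <= fnorm cform phi * fnorm q x.
Proof.
by have := cauchy_schwarz cform phi (cembed x); rewrite fnorm_embed /= cinner_embedr.
Qed.

(** Together with [cfun_le] this identifies the Hilbert norm with the norm as a functional on E, so
    that operators and limits can be estimated pointwise. *)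
Lemma cform_norm_le phi e : 0 <= e ->
  (forall x, rnorm (phi x) <= e * fnorm q x) -> fnorm cform phi <= e.
Proof.
move=> e0 he; rewrite -(@ler_pXn2r _ 2)// ?nnegrE ?fnorm_ge0// fnorm_sq /=.
have [M h] := cinner_close phi phi; apply/ler_addgt0Pl => t t0.
have C1 : 0 < `|M| + (2 * e + 1) + 1 by have := normr_ge0 M; lra.
(* For d <= 1 one has (e + d)^2 + d M <= e^2 + d (2 e + 1 + |M|). *)
pose d := Num.min 1 (t / (`|M| + (2 * e + 1) + 1)).
have d01 : 0 < d <= 1 by rewrite lt_min ltr01 divr_gt0//= ge_min lexx.
have dM : d * (`|M| + (2 * e + 1) + 1) <= t.
  by rewrite -ler_pdivlMr// ge_min lexx orbT.
have /andP[d0 d1] := d01; have [u hu] := cfunP phi d0.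
have := approx_norm_le e0 (ltW d0) he hu.
have := h _ _ _ d01 hu hu; have := fnorm_sq q u.
have := Re_norm_le (cinner phi phi - q u u); rewrite ReB ler_norml.
move=> /andP[_ a1] a2 a3 a4.
have : fnorm q u ^+ 2 <= (e + d) ^+ 2.
  by rewrite ler_pXn2r ?nnegrE ?addr_ge0 ?fnorm_ge0// ltW.
have : d * M <= d * `|M| by rewrite ler_wpM2l ?ler_norm// ltW.
have : d * d <= d by rewrite ler_piMr// ltW.
rewrite a2; lra.
Qed.

Lemma approx_embed_le phi u e : 0 <= e -> approx phi u e ->
  fnorm cform (phi - cembed u) <= e.
Proof.
by move=> e0 h; apply: cform_norm_le => // x; rewrite cfunD cfunN; exact: h.
Qed.

Let hnorm phi : R[i] := (fnorm cform phi)%:C.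

Let hnormD phi psi : hnorm (phi + psi) <= hnorm phi + hnorm psi.
Proof. by rewrite -rmorphD lecR fnormD. Qed.

Let hnormZ c phi : hnorm (c *: phi) = `|c| * hnorm phi.
Proof. by rewrite /hnorm fnormZ rmorphM /= rnormC. Qed.

Let hnorm0 phi : hnorm phi = 0 -> phi = 0.
Proof.
move=> /complexI h; apply: completion_eq => x; apply: (@rnorm_small _ _ 0) => e _.
by have := cfun_le phi x; rewrite h mul0r mulr0.
Qed.

HB.instance Definition _ :=
  Lmodule_isNormed.Build R[i] completion hnormD hnormZ hnorm0.

Lemma completion_normE phi : `|phi| = (fnorm cform phi)%:C. Proof. by []. Qed.

End Completion.

Section HilbertCompletion.
Context {R : realType} {E : lmodType R[i]} (q : psd_form E).
Local Notation H := (completion q).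
Implicit Types (u v x y : E) (phi psi : H).

Lemma completion_complete (F : set_system H) : ProperFilter F -> cauchy F -> cvg F.
Proof.
move=> FF /cauchyP Fc.
have [e [e0 esmall]] : exists e : nat -> R, (forall n, 0 < e n) /\
    forall d : R, 0 < d -> exists N, forall n, (N <= n)%N -> e n < d.
  by exists (fun n => 1 / n.+1%:R); split=> [n|d d0]; [rewrite divr_gt0|exact: inv_small].
(* A ball of radius e n belonging to F, together with a vector of E approximating its centre; the
   limit of F is the pointwise limit of the functionals of these vectors. *)
have hx n : exists p : H * E, F (ball p.1 (e n)%:C) /\ approx q p.1 p.2 (e n).
  have [|x hx] := Fc (e n)%:C; first by rewrite ltcR.
  by have [u hu] := cfunP x (e0 n); exists (x, u).
have [p hp] := choice hx.
have ballE phi psi (d : R) : ball phi d%:C psi -> fnorm (cform q) (phi - psi) < d.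
  by rewrite -ball_normE /= completion_normE ltcR.
(* The two balls meet, so their centres are within e n + e m; replacing the centres by their
   approximants costs as much again. *)
have dist m n x : rnorm (q (p n).2 x - q (p m).2 x) <=
    2 * (e n + e m) * fnorm q x.
  have [F1 a1] := hp n; have [F2 a2] := hp m.
  have [y [/ballE b1 /ballE b2]] := filter_ex (filterI F1 F2).
  have h1 := rnorm_triangle ((p n).1 x) (q (p n).2 x) (q (p m).2 x).
  have h2 := rnorm_triangle ((p m).1 x) ((p n).1 x) (q (p m).2 x).
  have h3 := cfun_le ((p n).1 - (p m).1) x.
  have h4 : fnorm (cform q) ((p n).1 - (p m).1) <= e n + e m.
    have := fnormD (cform q) ((p n).1 - y) (y - (p m).1).
    by rewrite subrKA (fnorm_distC _ y (p m).1); lra.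
  have := a1 x; have := a2 x; rewrite (rnorm_distC ((p n).1 x)).
  have := ler_wpM2r (fnorm_ge0 q x) h4.
  by move: h3; rewrite cfunD cfunN; lra.
have cvgx x : exists l, ccvg (fun n => q (p n).2 x) l.
  apply: complex_cauchy_cvg => d d0.
  have c0 : 0 < 4 * (fnorm q x + 1) by have := fnorm_ge0 q x; lra.
  have [N hN] := esmall _ (divr_gt0 d0 c0).
  exists N => m n /hN hm /hN hn; apply: le_lt_trans (dist _ _ _) _.
  move: hm hn; rewrite !ltr_pdivlMr//.
  have := e0 m; have := e0 n; have := fnorm_ge0 q x; nra.
have [f hf] := choice cvgx.
have fapprox n : approx q f (p n).2 (4 * e n).
  move=> x; have [N hN] := esmall _ (e0 n).
  apply: ccvg_le (hf x) _; exists N => m /hN hm.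
  apply: le_trans (dist _ _ _) _; rewrite ler_wpM2r ?fnorm_ge0//; lra.
have fP : approximable q f.
  move=> d d0; have d4 : 0 < d / 4 by rewrite divr_gt0.
  have [N hN] := esmall _ d4; exists (p N).2 => x.
  apply: le_trans (fapprox N x) _; rewrite ler_wpM2r ?fnorm_ge0//.
  by have := hN _ (leqnn N); lra.
apply/cvg_ex; exists (Completion fP); apply/cvgrPdist_lt => d0 d0p.
have [d dE] : exists d, d0 = d%:C.
  by exists (complex.Re d0); rewrite RRe_real// gtr0_real.
(* The six parts: four from the limit to the vector of E, one from there to the centre of the ball,
   one from the centre to y. *)
move: d0p; rewrite dE ltcR => dp; have d6 : 0 < d / 6 by rewrite divr_gt0.
have [N /(_ _ (leqnn N)) hN] := esmall _ d6.
have [FN aN] := hp N; apply: filterS FN => y /ballE hy.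
rewrite completion_normE ltcR.
have e4 : 0 <= 4 * e N by have := e0 N; lra.
have h1 := @approx_embed_le _ _ q (Completion fP) _ _ e4 (fapprox N).
have h2 := approx_embed_le (ltW (e0 N)) aN.
have := fnormD (cform q) (Completion fP - cembed q (p N).2) (cembed q (p N).2 - y).
have := fnormD (cform q) (cembed q (p N).2 - (p N).1) ((p N).1 - y).
rewrite !subrKA (fnorm_distC _ (cembed q (p N).2) (p N).1); lra.
Qed.

HB.instance Definition _ := Uniform_isComplete.Build H completion_complete.

Let cinnerxx phi : cinner phi phi = `|phi| ^+ 2.
Proof.
by rewrite completion_normE -rmorphXn /= fnorm_sq -(form_Re (cform q)).
Qed.

HB.instance Definition _ := isHilbert.Build R H
  (@cinner_linearl _ _ q) (@cinnerC _ _ q) cinnerxx.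

Lemma completion_rnorm phi : rnorm phi = fnorm (cform q) phi.
Proof. by []. Qed.

Lemma completion_innerE phi psi : inner phi psi = cinner phi psi.
Proof. by []. Qed.


(** An operator acts on functionals by composition with its adjoint, so an extension to the
    completion takes an adjoint on E that is bounded as well. *)
Record adjoint_pair := AdjointPair {
  adj_op : E -> E;
  adj_adj : E -> E;
  adj_norm : R;
  adj_norm_ge0 : 0 <= adj_norm;
  adjP : forall x y, q (adj_op x) y = q x (adj_adj y);
  adj_op_le : forall x, fnorm q (adj_op x) <= adj_norm * fnorm q x;
  adj_adj_le : forall x, fnorm q (adj_adj x) <= adj_norm * fnorm q x
}.

Lemma adj_flipP (P : adjoint_pair) x y : q (adj_adj P x) y = q x (adj_op P y).
Proof. by rewrite formC -adjP -formC. Qed.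

Definition adj_flip (P : adjoint_pair) : adjoint_pair :=
  AdjointPair (adj_norm_ge0 P) (adj_flipP P) (adj_adj_le P) (adj_op_le P).

Lemma approx_op (P : adjoint_pair) (phi : E -> R[i]) u e : 0 <= e ->
  approx q phi u e -> approx q (phi \o adj_adj P) (adj_op P u) (e * adj_norm P).
Proof.
move=> e0 h x; rewrite adjP; apply: le_trans (h _) _.
by rewrite -mulrA ler_wpM2l// adj_adj_le.
Qed.

Lemma approximable_op (P : adjoint_pair) phi :
  approximable q (phi \o adj_adj P).
Proof.
move=> e e0; have M0 := adj_norm_ge0 P.
have M1 : 0 < adj_norm P + 1 by rewrite ltr_pwDr.
have d0 := divr_gt0 e0 M1; have [u hu] := cfunP phi d0.
exists (adj_op P u) => x; apply: le_trans (approx_op P (ltW d0) hu x) _.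
rewrite ler_wpM2r ?fnorm_ge0// mulrAC ler_pdivrMr//.
by rewrite ler_wpM2l ?ltW//; lra.
Qed.

Definition completion_op (P : adjoint_pair) phi : H :=
  Completion (approximable_op P phi).

Let completion_op_linear P : linear (completion_op P).
Proof. by move=> c phi psi; apply: completion_eq. Qed.

HB.instance Definition _ P := GRing.isLinear.Build R[i] H H _ (completion_op P)
  (completion_op_linear P).

Lemma completion_opE P phi x : completion_op P phi x = phi (adj_adj P x).
Proof. by []. Qed.

Lemma completion_op_norm P phi :
  rnorm (completion_op P phi) <= adj_norm P * rnorm phi.
Proof.
have M0 := adj_norm_ge0 P.
rewrite !completion_rnorm; apply: cform_norm_le; first by rewrite mulr_ge0 ?fnorm_ge0.
move=> x; apply: le_trans (cfun_le phi (adj_adj P x)) _.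
by rewrite [_ * fnorm _ phi]mulrC -mulrA ler_wpM2l ?fnorm_ge0// adj_adj_le.
Qed.

Lemma completion_op_adj P phi psi :
  inner (completion_op P phi) psi = inner phi (completion_op (adj_flip P) psi).
Proof.
rewrite !completion_innerE; have M0 := adj_norm_ge0 P.
have [M1 [M10 hM1 _]] := cfun_bound phi.
have [M2 [M20 hM2 _]] := cfun_bound (completion_op P phi).
apply/eqP; rewrite -subr_eq0; apply/eqP.
apply: (@rnorm_small _ _ (M2 + M1 * adj_norm P)) => e /andP[e0 _].
have [v hv] := cfunP psi e0.
have h1 := cinner_approx M20 (ltW e0) hM2 hv.
have eM : 0 <= e * adj_norm P by rewrite mulr_ge0// ltW.
have h2 := cinner_approx M10 eM hM1 (approx_op (adj_flip P) (ltW e0) hv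
  : approx q (completion_op (adj_flip P) psi) _ _).
have := rnorm_triangle (phi (adj_adj P v)) (cinner (completion_op P phi) psi)
  (cinner phi (completion_op (adj_flip P) psi)).
rewrite (rnorm_distC (phi (adj_adj P v))); move: h1 h2.
rewrite completion_opE /=; lra.
Qed.

Lemma completion_op_embed P u :
  completion_op P (cembed q u) = cembed q (adj_op P u).
Proof. by apply: completion_eq => x /=; rewrite adjP. Qed.

Lemma rnorm_embed u : rnorm (cembed q u : H) = fnorm q u.
Proof. by rewrite completion_rnorm fnorm_embed. Qed.

End HilbertCompletion.

(** * The Fock representation *)

Section StateOrder.
Context {R : realType} {A : cstarAlgType R} (f : state A).

Lemma state0 : f 0 = 0.
Proof. by rewrite -(scale0r (0 : A)) stateZ mul0r. Qed.

Lemma stateN x : f (- x) = - f x.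
Proof. by rewrite -scaleN1r stateZ mulN1r. Qed.

Lemma state_positive h : positive h -> 0 <= f h.
Proof.
by move=> /positive_sqrt[k [sk <- _ _]]; rewrite -{1}sk state_ge0.
Qed.

(** M^2 - b^* b is positive and stays so after conjugation by z. *)
Lemma state_conj_le z b (M : R) : anorm b <= M ->
  f (star (b * z) * (b * z)) <= (M ^+ 2)%:C * f (star z * z).
Proof.
move=> hb; rewrite -subr_ge0 -stateZ -stateN -stateD.
have h : positive ((M ^+ 2)%:C *: 1 - star b * b).
  have -> : (M ^+ 2)%:C *: 1 - star b * b = (M ^+ 2 - anorm b ^+ 2)%:C *: 1 +
      ((anorm b ^+ 2)%:C *: 1 - star b * b) by rewrite cstB subrKA.
  apply: positiveD; last exact: positive_anorm_sub.
  by apply: positive_cst; rewrite subr_ge0 lerXn2r ?nnegrE ?anorm_ge0// (le_trans (anorm_ge0 b)).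
have := state_positive (positive_conj z h); congr (0 <= f _).
rewrite mulrBr mulrBl starM !mulrA; congr (_ - _).
by rewrite -scalerAr mulr1 scalerAl.
Qed.

End StateOrder.

Section FockForm.
Context {R : realType} {A : cstarAlgType R} (alpha : {lrmorphism A -> A}).
Hypothesis salpha : star_morphism alpha.
Variable f : state A.
Local Notation E := (skew_poly alpha).
Implicit Types (x y z : E) (a b c : A).

(* The Fock space induced from the GNS space of f, before completion: polynomials
   with a acting at level k through alpha^k. *)
Definition fock_form x y : R[i] :=
  \sum_(k < size (x : {poly A})) f (star (y : {poly A})`_k * (x : {poly A})`_k).

Lemma fock_formE N x y : (size (x : {poly A}) <= N)%N ->
  fock_form x y = \sum_(k < N) f (star (y : {poly A})`_k * (x : {poly A})`_k).
Proof.
move=> hN; rewrite /fock_form.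
rewrite (big_ord_widen N (fun k => f (star (y : {poly A})`_k * (x : {poly A})`_k)) hN).
rewrite big_mkcond /=; apply: eq_bigr => k _; case: ltnP => // hk.
by rewrite (nth_default _ hk) mulr0 state0.
Qed.

Lemma fock_form_linearl (d : R[i]) x y z :
  fock_form (d *: x + y) z = d * fock_form x z + fock_form y z.
Proof.
set N := maxn (size ((d *: x + y : E) : {poly A}))
  (maxn (size (x : {poly A})) (size (y : {poly A}))).
rewrite !(@fock_formE N) ?leq_max ?leqnn ?orbT// mulr_sumr -big_split /=.
apply: eq_bigr => k _; rewrite coefD coef_skew_scale.
by rewrite mulrDr -scalerAr stateD stateZ.
Qed.

Lemma fock_formC x y : fock_form y x = (fock_form x y)^*.
Proof.
set N := maxn (size (x : {poly A})) (size (y : {poly A})).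
rewrite !(@fock_formE N) ?leq_max ?leqnn ?orbT// rmorph_sum.
by apply: eq_bigr => k _; rewrite /= -state_star starM starK.
Qed.

Lemma fock_form_ge0 x : 0 <= fock_form x x.
Proof. by apply: sumr_ge0 => k _; exact: state_ge0. Qed.

Definition fock : psd_form E :=
  PsdForm fock_form_linearl fock_formC fock_form_ge0.

Lemma fnorm_fock_le (M : R) x y : 0 <= M ->
  fock x x <= (M ^+ 2)%:C * fock y y -> fnorm fock x <= M * fnorm fock y.
Proof.
move=> M0; rewrite (form_Re _ x) (form_Re _ y) -rmorphM lecR -!fnorm_sq -exprMn.
by rewrite ler_pXn2r ?nnegrE ?mulr_ge0 ?fnorm_ge0.
Qed.

Lemma iter_star k a : iter k alpha (star a) = star (iter k alpha a).
Proof. by elim: k => //= k ->; rewrite salpha. Qed.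

Lemma iter_contractive k a : anorm (iter k alpha a) <= anorm a.
Proof.
elim: k => //= k IH; apply: le_trans IH; exact: star_morphism_contractive.
Qed.

(** In the skew polynomials this is left multiplication by the constant a, and [fock_shift] is left
    multiplication by the generator: the left regular representation. *)
Definition fock_pi a x : E :=
  \poly_(k < size (x : {poly A})) (iter k alpha a * (x : {poly A})`_k).

Lemma coef_fock_pi a x k :
  (fock_pi a x : {poly A})`_k = iter k alpha a * (x : {poly A})`_k.
Proof.
by rewrite coef_poly; case: ltnP => // h; rewrite [x`_k]nth_default ?mulr0.
Qed.

Lemma size_fock_pi a x : (size (fock_pi a x : {poly A}) <= size (x : {poly A}))%N.
Proof. exact: size_poly. Qed.

Lemma fock_pi_adj a x y : fock (fock_pi a x) y = fock x (fock_pi (star a) y).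
Proof.
rewrite /= (fock_formE _ (size_fock_pi a x)); apply: eq_bigr => k _.
by rewrite !coef_fock_pi starM iter_star starK !mulrA.
Qed.

Lemma fock_pi_le a x : fnorm fock (fock_pi a x) <= anorm a * fnorm fock x.
Proof.
apply: fnorm_fock_le; first exact: anorm_ge0.
rewrite /= (fock_formE _ (size_fock_pi a x)) mulr_sumr; apply: ler_sum => k _.
by rewrite coef_fock_pi state_conj_le// iter_contractive.
Qed.

Lemma fock_pi_star_le a x : fnorm fock (fock_pi (star a) x) <= anorm a * fnorm fock x.
Proof. by rewrite -(anorm_starE a) fock_pi_le. Qed.

Definition fock_pi_pair a : adjoint_pair fock :=
  AdjointPair (anorm_ge0 a) (fock_pi_adj a) (fock_pi_le a) (fock_pi_star_le a).

Definition fock_shift x : E := ('X * (x : {poly A}) : {poly A}).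

Definition fock_unshift x : E :=
  \poly_(k < size (x : {poly A})) (x : {poly A})`_k.+1.

Lemma coef_fock_unshift x k : (fock_unshift x : {poly A})`_k = (x : {poly A})`_k.+1.
Proof.
rewrite coef_poly; case: ltnP => // h.
by rewrite [x`_k.+1]nth_default// leqW.
Qed.

Lemma size_fock_shift x :
  (size (fock_shift x : {poly A}) <= (size (x : {poly A})).+1)%N.
Proof.
by apply/leq_sizeP => j hj; rewrite coefXM; case: j hj => // j hj; rewrite nth_default.
Qed.

Lemma fock_shift_adj x y : fock (fock_shift x) y = fock x (fock_unshift y).
Proof.
rewrite /= (fock_formE _ (size_fock_shift x)) big_ord_recl coefXM /= mulr0 state0 add0r.
by apply: eq_bigr => k _; rewrite coefXM coef_fock_unshift.
Qed.

Lemma fock_shift_le x : fnorm fock (fock_shift x) <= 1 * fnorm fock x.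
Proof.
apply: fnorm_fock_le => //; rewrite expr1n mul1r fock_shift_adj.
rewrite (_ : fock_unshift (fock_shift x) = x)//; apply/polyP => k.
by rewrite coef_fock_unshift coefXM.
Qed.

Lemma fock_unshift_le x : fnorm fock (fock_unshift x) <= 1 * fnorm fock x.
Proof.
apply: fnorm_fock_le => //; rewrite expr1n mul1r /=.
rewrite (@fock_formE (size (x : {poly A}))) ?size_poly//.
rewrite [leRHS](@fock_formE (size (x : {poly A})).+1)//.
rewrite big_ord_recl ler_wpDl ?state_ge0//.
by apply: ler_sum => k _; rewrite coef_fock_unshift.
Qed.

Definition fock_shift_pair : adjoint_pair fock :=
  AdjointPair ler01 fock_shift_adj fock_shift_le fock_unshift_le.

Local Notation H := (completion fock).
Implicit Types (phi psi : H).

Definition fock_rep_pi a : {linear H -> H} := completion_op (fock_pi_pair a).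

Lemma fock_rep_piE a phi x : fock_rep_pi a phi x = phi (fock_pi (star a) x).
Proof. by []. Qed.

Lemma fock_rep_bounded a : bounded_op (fock_rep_pi a).
Proof. by exists (anorm a) => phi; exact: completion_op_norm. Qed.

Lemma fock_rep_piD a b phi :
  fock_rep_pi (a + b) phi = fock_rep_pi a phi + fock_rep_pi b phi.
Proof.
apply: completion_eq => x; rewrite cfunD !fock_rep_piE -cfun_addr; congr (cfun phi _).
apply/polyP => k; rewrite coefD !coef_fock_pi starD iter_alphaD mulrDl//.
Qed.

Lemma fock_rep_piZ (d : R[i]) a phi : fock_rep_pi (d *: a) phi = d *: fock_rep_pi a phi.
Proof.
apply: completion_eq => x; rewrite cfunZ !fock_rep_piE.
rewrite -[in RHS](conjCK d) -cfun_scaler; congr (cfun phi _).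
by apply/polyP => k; rewrite coef_skew_scale !coef_fock_pi starZ iter_alphaZ scalerAl.
Qed.

Lemma fock_rep_piM a b phi :
  fock_rep_pi (a * b) phi = fock_rep_pi a (fock_rep_pi b phi).
Proof.
apply: completion_eq => x; rewrite !fock_rep_piE; congr (cfun phi _).
by apply/polyP => k; rewrite !coef_fock_pi starM iter_alphaM mulrA.
Qed.

Lemma fock_rep_star a phi psi :
  inner (fock_rep_pi a phi) psi = inner phi (fock_rep_pi (star a) psi).
Proof.
rewrite [LHS]completion_op_adj; congr inner; apply: completion_eq => x.
by rewrite completion_opE fock_rep_piE starK.
Qed.

Definition fock_rep_V : {linear H -> H} := completion_op fock_shift_pair.

Lemma fock_rep_V_contraction phi : rnorm (fock_rep_V phi) <= rnorm phi.
Proof.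
have := completion_op_norm fock_shift_pair phi; by rewrite mul1r.
Qed.

Lemma fock_rep_covariant a phi :
  fock_rep_pi a (fock_rep_V phi) = fock_rep_V (fock_rep_pi (alpha a) phi).
Proof.
apply: completion_eq => x; rewrite /fock_rep_V !completion_opE /=.
congr (cfun phi _); apply/polyP => k.
by rewrite !(coef_fock_unshift, coef_fock_pi) -salpha -iterSr.
Qed.

Definition fock_rep : covariant_rep alpha H :=
  CovariantRep fock_rep_bounded fock_rep_piD fock_rep_piZ fock_rep_piM
    fock_rep_star fock_rep_V_contraction fock_rep_covariant.

Definition vacuum : H := cembed fock (1 : E).

Lemma fnorm_const a : fnorm fock (a%:P : {poly A}) ^+ 2 = complex.Re (f (star a * a)).
Proof.
rewrite fnorm_sq /= (@fock_formE 1) ?size_polyC ?leq_b1//.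
by rewrite big_ord_recl big_ord0 addr0 coefC.
Qed.

Lemma vacuum_norm : rnorm vacuum = 1.
Proof.
apply/eqP; rewrite -(@eqrXn2 _ 2)// ?rnorm_ge0// rnorm_embed.
by rewrite (fnorm_const 1) star1 mulr1 state1 expr1n.
Qed.

Lemma cembedD x y : cembed fock (x + y) = cembed fock x + cembed fock y.
Proof. by apply: completion_eq => z /=; exact: (formDl fock). Qed.

Lemma cembed_sum n (F : 'I_n -> E) :
  cembed fock (\sum_(i < n) F i) = \sum_(i < n) cembed fock (F i).
Proof.
apply: (big_morph (cembed fock) cembedD); apply: completion_eq => z /=.
exact: (form0l fock).
Qed.

Lemma fock_rep_pi_vacuum a : fock_rep_pi a vacuum = cembed fock (a%:P : {poly A}).
Proof.
rewrite /vacuum [LHS]completion_op_embed; congr cembed; apply/polyP => k.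
by rewrite coef_fock_pi coef1 coefC; case: k => [|k] /=; rewrite ?mulr1 ?mulr0.
Qed.

(** The vacuum turns p into itself as a vector, so the semicrossed norm of p dominates its norm in
    the Fock form. All lower bounds on the norm start here. *)
Lemma cov_eval_vacuum (p : E) : cov_eval fock_rep p vacuum = cembed fock p.
Proof.
have hk k x : iter k fock_rep_V (cembed fock x) =
    cembed fock ('X^k * (x : {poly A}) : {poly A}).
  elim: k => [|k IH]; first by rewrite expr0 mul1r.
  by rewrite iterS IH [LHS]completion_op_embed exprS -mulrA.
rewrite /cov_eval /=; under eq_bigr do rewrite fock_rep_pi_vacuum hk.
rewrite -(cembed_sum (fun k : 'I__ => ('X^k * ((p : {poly A})`_k)%:P : {poly A}))).
congr cembed; apply/polyP => j; rewrite coef_sum.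
under eq_bigr do rewrite coefXnM coefC.
have [hj|hj] := ltnP j (size (p : {poly A})).
  rewrite (bigD1 (Ordinal hj))//= ltnn subnn /= big1 ?addr0// => i.
  rewrite -val_eqE /= => hi; case: ltnP => // le; rewrite subn_eq0.
  by rewrite leqNgt ltn_neqAle hi le.
rewrite [RHS]nth_default// big1// => i _; rewrite ltnNge (leq_trans (ltnW (ltn_ord i)))//=.
by rewrite subn_eq0 leqNgt (leq_trans (ltn_ord i)).
Qed.

End FockForm.

(** * Skew polynomials and the semicrossed norm *)

Section LRMorphismBuilder.
Context {K : pzRingType} {U V : lalgType K}.

Definition lrmorph_of (f : U -> V) of zmod_morphism f & monoid_morphism f
  & scalable f := f.

HB.instance Definition _ f fB fM fZ :=
  GRing.isZmodMorphism.Build U V (@lrmorph_of f fB fM fZ) fB.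
HB.instance Definition _ f fB fM fZ :=
  GRing.isMonoidMorphism.Build U V (@lrmorph_of f fB fM fZ) fM.
HB.instance Definition _ f fB fM fZ :=
  GRing.isScalable.Build K U V *:%R (@lrmorph_of f fB fM fZ) fZ.

Definition lrmorphism_of f fB fM fZ : {lrmorphism U -> V} :=
  @lrmorph_of f fB fM fZ.

Lemma lrmorphism_ofE f fB fM fZ x : @lrmorphism_of f fB fM fZ x = f x.
Proof. by []. Qed.

(* [rmorphM] and its kin leave [GRing.RMorphism.sort] at the head, which lemmas
   about an [{lrmorphism _ -> _}] do not match. *)
Implicit Types (F : {lrmorphism U -> V}) (x y : U).

Lemma lrmorphD F x y : F (x + y) = F x + F y. Proof. exact: rmorphD. Qed.
Lemma lrmorphB F x y : F (x - y) = F x - F y. Proof. exact: rmorphB. Qed.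
Lemma lrmorphM F x y : F (x * y) = F x * F y. Proof. exact: rmorphM. Qed.
Lemma lrmorphX F n x : F (x ^+ n) = F x ^+ n. Proof. exact: rmorphXn. Qed.
Lemma lrmorph1 F : F 1 = 1. Proof. exact: rmorph1. Qed.
Lemma lrmorph0 F : F 0 = 0. Proof. exact: rmorph0. Qed.
Lemma lrmorphZ F c x : F (c *: x) = c *: F x. Proof. exact: linearZ. Qed.

End LRMorphismBuilder.

Section SkewMonomials.
Context {R : realType} {A : cstarAlgType R} {alpha : {lrmorphism A -> A}}.
Local Notation P := (skew_poly alpha).
Implicit Types (p q : P) (a b : A).

Definition skewX : P := ('X : {poly A}).

Definition skewC_fun a : P := (a%:P : {poly A}).

Let skewC_zmod : zmod_morphism skewC_fun.
Proof. by move=> a b; exact: (raddfB (@polyC A)). Qed.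

Lemma coef_skewM p q n : (p * q : {poly A})`_n =
  \sum_(j < n.+1) iter j alpha (p : {poly A})`_(n - j) * (q : {poly A})`_j.
Proof. exact: coef_skew_mul. Qed.

Let skewC_monoid : monoid_morphism skewC_fun.
Proof.
split=> // a b; apply/polyP => n; rewrite coef_skewM coefC.
rewrite big_ord_recl /= subn0 !coefC big1 ?addr0 => [|i _].
  by case: n => //=; rewrite mul0r.
by rewrite [b%:P`__]coefC /= mulr0.
Qed.

Let skewC_scalable : scalable skewC_fun.
Proof.
move=> c a; apply/polyP => n; rewrite coef_skew_scale !coefC.
by case: n => //=; rewrite scaler0.
Qed.

Definition skewC : {lrmorphism A -> P} :=
  lrmorphism_of skewC_zmod skewC_monoid skewC_scalable.

Lemma coef_skewC a n : (skewC a : {poly A})`_n = if n == 0%N then a else 0.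
Proof. by rewrite /skewC lrmorphism_ofE coefC. Qed.

Lemma coef_skewXM p n :
  (skewX * p : {poly A})`_n = if n == 0%N then 0 else (p : {poly A})`_n.-1.
Proof.
rewrite coef_skewM; case: n => [|n] /=.
  by rewrite big_ord_recl big_ord0 subnn coefX mul0r addr0.
rewrite big_ord_recr /= subnn coefX iter_alpha0 rmorph0 mul0r addr0.
rewrite big_ord_recr /= subSnn coefX iter_alpha1 mul1r big1 ?add0r// => i _.
rewrite coefX subSn ?(ltnW (ltn_ord i))// eqSS subn_eq0 leqNgt ltn_ord.
by rewrite iter_alpha0 mul0r.
Qed.

Lemma coef_skewXnM k p n : (skewX ^+ k * p : {poly A})`_n =
  if (n < k)%N then 0 else (p : {poly A})`_(n - k).
Proof.
elim: k n => [|k IH] n; first by rewrite expr0 mul1r subn0.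
by rewrite exprS -mulrA coef_skewXM; case: n => //= n; rewrite IH ltnS subSS.
Qed.

Lemma skewCX a : skewC a * skewX = skewX * skewC (alpha a).
Proof.
apply/polyP => n; rewrite coef_skewXM coef_skewM.
case: n => [|[|n]] /=.
- by rewrite big_ord_recl big_ord0 coefX mulr0 addr0.
- rewrite !big_ord_recl big_ord0 !coefX mulr0 add0r addr0 /= mulr1.
  by rewrite !coef_skewC.
- rewrite coef_skewC big1// => i _; rewrite coefX coef_skewC.
  case: i => [[|[|i]]] hi /=; rewrite ?mulr0//.
  by rewrite rmorph0 mul0r.
Qed.

Lemma skewCXn a k : skewC a * skewX ^+ k = skewX ^+ k * skewC (iter k alpha a).
Proof.
elim: k a => [|k IH] a; first by rewrite !expr0 mulr1 mul1r.
by rewrite exprS mulrA skewCX -[LHS]mulrA IH mulrA iterSr.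
Qed.

Lemma skew_sum N p : (size (p : {poly A}) <= N)%N ->
  p = \sum_(k < N) skewX ^+ k * skewC (p : {poly A})`_k.
Proof.
move=> hN; apply/polyP => j; rewrite (coef_sum (R := A)).
under eq_bigr do rewrite coef_skewXnM coef_skewC.
have [hj|hj] := ltnP j N.
  rewrite (bigD1 (Ordinal hj))//= ltnn subnn /= big1 ?addr0// => i.
  rewrite -val_eqE /= => hi; case: ltnP => // le; rewrite subn_eq0.
  by rewrite leqNgt ltn_neqAle hi le.
rewrite [LHS]nth_default; last exact: leq_trans hN hj.
rewrite big1// => i _; rewrite ltnNge (leq_trans (ltnW (ltn_ord i)))//=.
by rewrite subn_eq0 leqNgt (leq_trans (ltn_ord i)).
Qed.

Lemma skew_ind (Q : P -> Prop) : Q 0 -> (forall p q, Q p -> Q q -> Q (p + q)) ->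
  (forall k a, Q (skewX ^+ k * skewC a)) -> forall p, Q p.
Proof.
move=> Q0 QD QM p; rewrite (skew_sum (leqnn (size (p : {poly A})))).
by elim/big_ind : _ => // k _; exact: QM.
Qed.

End SkewMonomials.
Arguments skewX {R A alpha}.
Arguments skewC {R A alpha}.

Section SkewEval.
Context {R : realType} {A : cstarAlgType R} {alpha : {lrmorphism A -> A}}.
Local Notation P := (skew_poly alpha).
Implicit Types (p q : P) (a b : A).
Context {Z : algType R[i]} (rho : {lrmorphism A -> Z}).

Section Linear.
Variable g : nat -> Z.

(** The values g k at the powers of the generator are arbitrary in order to cover both evaluations,
    with g k = z^k, and the derivation built from [difference_quotient]. *)
Definition skew_lin p : Z :=
  \sum_(k < size (p : {poly A})) g k * rho (p : {poly A})`_k.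

Lemma skew_linE N p : (size (p : {poly A}) <= N)%N ->
  skew_lin p = \sum_(k < N) g k * rho (p : {poly A})`_k.
Proof.
move=> hN; rewrite /skew_lin.
rewrite (big_ord_widen N (fun k => g k * rho (p : {poly A})`_k) hN).
rewrite big_mkcond /=; apply: eq_bigr => k _; case: ltnP => // hk.
by rewrite (nth_default _ hk) rmorph0 mulr0.
Qed.

Lemma skew_lin_zmod : zmod_morphism skew_lin.
Proof.
move=> p q; set N := maxn (size ((p - q : P) : {poly A}))
  (maxn (size (p : {poly A})) (size (q : {poly A}))).
rewrite !(@skew_linE N) ?leq_max ?leqnn ?orbT// -sumrB.
by apply: eq_bigr => k _; rewrite coefB rmorphB mulrBr.
Qed.

Lemma skew_linD p q : skew_lin (p + q) = skew_lin p + skew_lin q.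
Proof. by have := skew_lin_zmod (p + q) q; rewrite addrK => ->; rewrite subrK. Qed.

Lemma skew_lin0 : skew_lin 0 = 0.
Proof. by have := skew_lin_zmod 0 0; rewrite !subrr. Qed.

Lemma skew_lin_scalable : scalable skew_lin.
Proof.
move=> c p; set N := maxn (size ((c *: p : P) : {poly A})) (size (p : {poly A})).
rewrite !(@skew_linE N) ?leq_max ?leqnn ?orbT// scaler_sumr.
by apply: eq_bigr => k _; rewrite coef_skew_scale linearZ -scalerAr.
Qed.

Lemma skew_lin_monom k a : skew_lin (skewX ^+ k * skewC a) = g k * rho a.
Proof.
set p : P := skewX ^+ k * skewC a.
have sz : (size (p : {poly A}) <= k.+1)%N.
  apply/leq_sizeP => j hj; rewrite coef_skewXnM coef_skewC.
  by rewrite ltnNge (ltnW hj) /= subn_eq0 leqNgt hj.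
rewrite (skew_linE sz) big_ord_recr /= big1 ?add0r => [|i _].
  by rewrite coef_skewXnM coef_skewC ltnn subnn.
by rewrite coef_skewXnM ltn_ord rmorph0 mulr0.
Qed.

End Linear.

Variable z : Z.
Local Notation skew_eval_fun := (skew_lin (fun k => z ^+ k)).

Hypothesis rho_z : forall a, rho a * z = z * rho (alpha a).

Lemma skew_evalXn k a : rho a * z ^+ k = z ^+ k * rho (iter k alpha a).
Proof.
elim: k a => [|k IH] a; first by rewrite !expr0 mulr1 mul1r.
by rewrite exprS mulrA rho_z -mulrA IH mulrA iterSr.
Qed.

Lemma skew_eval_monoid : monoid_morphism skew_eval_fun.
Proof.
have D := skew_linD (fun k => z ^+ k); have E0 := skew_lin0 (fun k => z ^+ k).
split.
  by have := (skew_lin_monom (fun k => z ^+ k)) 0 1; rewrite !rmorph1 expr0 !mulr1.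
move=> p q; move: p; apply: (@skew_ind R A alpha) => [|p1 p2 h1 h2|i a].
- by rewrite mul0r E0 mul0r.
- by rewrite mulrDl !D h1 h2 mulrDl.
move: q; apply: (@skew_ind R A alpha) => [|q1 q2 h1 h2|j b].
- by rewrite mulr0 E0 mulr0.
- by rewrite mulrDr !D h1 h2 mulrDr.
rewrite mulrA -[skewX ^+ i * skewC a * _]mulrA skewCXn mulrA -exprD -mulrA.
rewrite -rmorphM !(skew_lin_monom (fun k => z ^+ k)) rmorphM exprD.
by rewrite -!mulrA; congr (_ * _); rewrite !mulrA skew_evalXn.
Qed.

Definition skew_eval : {lrmorphism P -> Z} :=
  lrmorphism_of (skew_lin_zmod (fun k => z ^+ k)) skew_eval_monoid (skew_lin_scalable (fun k => z ^+ k)).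

Lemma skew_evalE p : skew_eval p =
  \sum_(k < size (p : {poly A})) z ^+ k * rho (p : {poly A})`_k.
Proof. by []. Qed.

Lemma skew_evalC a : skew_eval (skewC a) = rho a.
Proof. by have := (skew_lin_monom (fun k => z ^+ k)) 0 a; rewrite !expr0 !mul1r. Qed.

Lemma skew_evalX : skew_eval skewX = z.
Proof. by have := (skew_lin_monom (fun k => z ^+ k)) 1 1; rewrite !rmorph1 !expr1 !mulr1. Qed.

End SkewEval.

Lemma skew_morph_eq (R : realType) (A : cstarAlgType R)
    (alpha : {lrmorphism A -> A}) (Z : algType R[i])
    (F G : {lrmorphism skew_poly alpha -> Z}) :
  (forall a, F (skewC a) = G (skewC a)) -> F skewX = G skewX ->
  forall p, F p = G p.
Proof.
move=> hC hX; apply: (@skew_ind R A alpha) => [|p q h1 h2|k a].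
- by rewrite !rmorph0.
- by rewrite !rmorphD; congr (_ + _).
- rewrite !rmorphM !rmorphXn.
  by congr (_ * _); [congr (_ ^+ _); exact: hX|exact: hC].
Qed.

(** * Contractivity of covariant representations and scaling of V *)

Section CovariantRepresentations.
Context {R : realType} {A : cstarAlgType R} {alpha : {lrmorphism A -> A}}
  {H : hilbertType R}.
Implicit Types (c : covariant_rep alpha H) (x y : H) (a b : A)
  (p : skew_poly alpha).

Let inner_ge0 x : 0 <= inner x x.
Proof. by rewrite innerxx exprn_ge0. Qed.

Definition inner_form : psd_form H :=
  PsdForm (@inner_linearl R H) (@innerC R H) inner_ge0.

Let innerDl x y z : inner (x + y) z = inner x z + inner y z.
Proof. exact: (formDl inner_form). Qed.

Let innerBl x y z : inner (x - y) z = inner x z - inner y z.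
Proof. exact: (formBl inner_form). Qed.

Let innerBr x y z : inner x (y - z) = inner x y - inner x z.
Proof. exact: (formBr inner_form). Qed.

Let innerZl d x y : inner (d *: x) y = d * inner x y.
Proof. exact: (formZl inner_form). Qed.

(** As pi need not be unital, pi(1) is treated separately: x - pi(1) x is orthogonal to pi(1) x, so
    pi(1) is contractive. Then |a|^2 - a^* a = k^2 gives |pi(k) x|^2 + |pi(a) x|^2 = |a|^2 |pi(1)
    x|^2. *)
Lemma cov_pi_le c a x : rnorm (cov_pi c a x) <= anorm a * rnorm x.
Proof.
have sqE z : inner (cov_pi c (star z * z) x) x = `|cov_pi c z x| ^+ 2.
  by rewrite cov_piM cov_pi_star starK innerxx.
have unit_le : `|cov_pi c 1 x| ^+ 2 <= `|x| ^+ 2.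
  set y := x - cov_pi c 1 x.
  have y0 : cov_pi c 1 y = 0 by rewrite raddfB /= -cov_piM mulr1 subrr.
  have h : inner y (cov_pi c 1 x) = 0.
    rewrite -[X in inner _ (cov_pi c X _)]star1 -cov_pi_star y0.
    exact: (form0l inner_form).
  have : 0 <= inner y y by rewrite innerxx exprn_ge0.
  have -> : inner y y = inner y x - inner y (cov_pi c 1 x) by rewrite -innerBr.
  rewrite h subr0 innerBl innerxx.
  by have := sqE 1; rewrite star1 mulr1 => ->; rewrite subr_ge0.
have [k [sk kk _ _]] := positive_sqrt (positive_anorm_sub a).
have e : `|cov_pi c k x| ^+ 2 + `|cov_pi c a x| ^+ 2 =
    (anorm a ^+ 2)%:C * `|cov_pi c 1 x| ^+ 2.
  rewrite -!sqE sk star1 mulr1.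
  by rewrite -innerDl -cov_piD kk subrK cov_piZ innerZl.
have : `|cov_pi c a x| ^+ 2 <= (anorm a ^+ 2)%:C * `|x| ^+ 2.
  apply: (@le_trans _ _ ((anorm a ^+ 2)%:C * `|cov_pi c 1 x| ^+ 2)).
    by rewrite -e lerDr exprn_ge0.
  by rewrite ler_wpM2l// ler0c sqr_ge0.
rewrite -!rnormVC -!rmorphXn -rmorphM /= lecR -exprMn.
by rewrite ler_pXn2r ?nnegrE ?mulr_ge0 ?anorm_ge0 ?rnorm_ge0.
Qed.

Lemma cov_pi0 c x : cov_pi c 0 x = 0.
Proof. by rewrite -(scale0r (0 : A)) cov_piZ scale0r. Qed.

Lemma cov_evalE N c p x : (size (p : {poly A}) <= N)%N ->
  cov_eval c p x = \sum_(k < N) iter k (cov_V c) (cov_pi c (p : {poly A})`_k x).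
Proof.
move=> hN; rewrite /cov_eval.
rewrite (big_ord_widen N (fun k => iter k (cov_V c) (cov_pi c (p : {poly A})`_k x)) hN).
rewrite big_mkcond /=; apply: eq_bigr => k _; case: ltnP => // hk.
rewrite (nth_default _ hk) cov_pi0.
by elim: (nat_of_ord k) => //= j <-; rewrite raddf0.
Qed.

Lemma cov_evalC c a x : cov_eval c (skewC a) x = cov_pi c a x.
Proof.
rewrite (@cov_evalE 1) ?big_ord_recl ?big_ord0 ?addr0 /= ?coef_skewC//.
by rewrite /skewC lrmorphism_ofE size_polyC leq_b1.
Qed.

Lemma cov_evalX c x : cov_eval c skewX x = cov_V c (cov_pi c 1 x).
Proof.
rewrite (@cov_evalE 2) ?size_polyX// !big_ord_recl big_ord0 addr0 /= !coefX /=.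
by rewrite cov_pi0 add0r.
Qed.

Section Scaled.
Variables (r : R) (r0 : 0 <= r) (r1 : r <= 1) (c : covariant_rep alpha H).

Definition scaled_V : {linear H -> H} := r%:C \*: cov_V c.

Let scaled_contraction x : rnorm (scaled_V x) <= rnorm x.
Proof.
rewrite -lecR !rnormVC /= normrZ -rnormC rnorm_real ger0_norm//.
apply: (@le_trans _ _ `|cov_V c x|).
  by rewrite ler_piMl ?normr_ge0// -[1]/((1 : R)%:C) lecR.
by rewrite -!rnormVC lecR cov_V_contraction.
Qed.

Let scaled_covariant a x : cov_pi c a (scaled_V x) = scaled_V (cov_pi c (alpha a) x).
Proof. by rewrite /= linearZ /= cov_covariant. Qed.

Definition scaled_rep : covariant_rep alpha H :=
  CovariantRep (@cov_pi_bounded _ _ _ _ c) (@cov_piD _ _ _ _ c)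
    (@cov_piZ _ _ _ _ c) (@cov_piM _ _ _ _ c) (@cov_pi_star _ _ _ _ c)
    scaled_contraction scaled_covariant.

Lemma iter_scaled k x : iter k scaled_V x = (r ^+ k)%:C *: iter k (cov_V c) x.
Proof.
elim: k => [|k IH]; first by rewrite expr0 scale1r.
by rewrite !iterS IH /= linearZ /= scalerA -rmorphM -exprS.
Qed.

End Scaled.
End CovariantRepresentations.

Definition skew_dilate (R : realType) (A : cstarAlgType R)
    (alpha : {lrmorphism A -> A}) (r : R) (p : skew_poly alpha) : skew_poly alpha :=
  \poly_(k < size (p : {poly A})) ((r ^+ k)%:C *: (p : {poly A})`_k).

Section SemicrossedNorm.
Context {R : realType} {A : cstarAlgType R} {alpha : {lrmorphism A -> A}}.
Hypothesis salpha : star_morphism alpha.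
Variable S : semicrossed_product alpha.
Local Notation P := (skew_poly alpha).
Local Notation j := (sp_embed S).
Implicit Types (p q : P) (a b c : A) (r : R).

Lemma cov_eval_le (H : hilbertType R) (c : covariant_rep alpha H) p x :
  rnorm x <= 1 -> rnorm (cov_eval c p x) <= anorm (j p).
Proof.
move=> hx; rewrite -lee_fin sp_norm.
apply: (@le_trans _ _ (op_norm (cov_eval c p))).
  by apply: ereal_sup_ubound; exists x.
by apply: ereal_sup_ubound; exists H, c.
Qed.

Lemma sp_embed_le p (C : R) :
  (forall (H : hilbertType R) (c : covariant_rep alpha H) x, rnorm x <= 1 ->
     rnorm (cov_eval c p x) <= C) -> anorm (j p) <= C.
Proof.
move=> h; rewrite -lee_fin sp_norm; apply: ge_ereal_sup => _ [H [c ->]].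
by apply: ge_ereal_sup => _ [x hx <-]; rewrite lee_fin h.
Qed.

Lemma sp_embedC_le a : anorm (j (skewC a)) <= anorm a.
Proof.
apply: sp_embed_le => H c x hx; rewrite cov_evalC.
apply: le_trans (cov_pi_le c a x) _.
by rewrite ler_piMr// anorm_ge0.
Qed.

Lemma sp_embedX_le : anorm (j skewX) <= 1.
Proof.
apply: sp_embed_le => H c x hx; rewrite cov_evalX.
apply: le_trans (cov_V_contraction c _) _.
by apply: le_trans (cov_pi_le c 1 x) _; rewrite anorm1 mul1r.
Qed.

Lemma sp_anorm1_le : anorm (1 : S) <= 1.
Proof. by have := sp_embedC_le 1; rewrite !rmorph1 anorm1. Qed.

(** If (pi, V) is covariant, so is (pi, r V), and it evaluates p as (pi, V) evaluates the dilated
    polynomial. *)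
Lemma sp_dilate_le r p : 0 <= r -> r <= 1 -> anorm (j (skew_dilate r p)) <= anorm (j p).
Proof.
move=> r0 r1; apply: sp_embed_le => H c x hx.
have <- : cov_eval (scaled_rep r0 r1 c) p x = cov_eval c (skew_dilate r p) x.
  rewrite [RHS](@cov_evalE _ _ _ _ (size (p : {poly A}))) ?size_poly//.
  apply: eq_bigr => k _; rewrite coef_poly ltn_ord /= iter_scaled cov_piZ.
  move: (cov_pi c _ x) (r ^+ k) => w t.
  by elim: (nat_of_ord k) => //= i <-; rewrite linearZ.
exact: cov_eval_le.
Qed.

Lemma sp_monomials_le N (d : nat -> A) :
  anorm (j (\sum_(k < N) skewX ^+ k * skewC (d k))) <= \sum_(k < N) anorm (d k).
Proof.
rewrite rmorph_sum; apply: le_trans (anorm_sum _ _ _) _; apply: ler_sum => k _.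
rewrite /= rmorphM rmorphXn; apply: le_trans (anormM _ _) _.
rewrite -[leRHS]mul1r ler_pM ?anorm_ge0 ?sp_embedC_le//.
apply: le_trans (anormX_le _ _ sp_anorm1_le) _.
by rewrite exprn_ile1 ?anorm_ge0// sp_embedX_le.
Qed.

Lemma Re_sum n (F : 'I_n -> R[i]) :
  complex.Re (\sum_(i < n) F i) = \sum_(i < n) complex.Re (F i).
Proof. by apply: (big_morph (@complex.Re R) ReD). Qed.

Lemma Re_state_ge0 (f : state A) a : 0 <= complex.Re (f (star a * a)).
Proof. by have := state_ge0 f a; rewrite lecE => /andP[]. Qed.

Let vacuum_le (f : state A) : rnorm (vacuum alpha f) <= 1.
Proof. by rewrite vacuum_norm. Qed.

(** The full sum is the squared length of p applied to the vacuum over f; N only truncates it. *)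
Lemma state_coefs_le (f : state A) p N :
  \sum_(k < N) complex.Re (f (star (p : {poly A})`_k * (p : {poly A})`_k)) <=
  anorm (j p) ^+ 2.
Proof.
have := cov_eval_le (fock_rep salpha f) p (vacuum_le f).
rewrite cov_eval_vacuum rnorm_embed.
rewrite -(@ler_pXn2r _ 2)// ?nnegrE ?anorm_ge0 ?fnorm_ge0// fnorm_sq.
apply: le_trans; set s := size (p : {poly A}).
rewrite /= (@fock_formE _ _ _ _ (maxn N s)) ?leq_maxr// Re_sum.
rewrite (big_ord_widen (maxn N s) (fun k => complex.Re
  (f (star (p : {poly A})`_k * (p : {poly A})`_k))) (leq_maxl N s)).
by rewrite big_mkcond /=; apply: ler_sum => k _; case: ifP => // _; exact: Re_state_ge0.
Qed.

Lemma state_coef_le (f : state A) p k :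
  complex.Re (f (star (p : {poly A})`_k * (p : {poly A})`_k)) <= anorm (j p) ^+ 2.
Proof.
apply: le_trans (state_coefs_le f p k.+1); rewrite big_ord_recr /= lerDr.
by apply: sumr_ge0 => i _; exact: Re_state_ge0.
Qed.

(** Keeping the constant term shows that the other coefficients vanish under f once the constant
    term exhausts the norm. *)
Lemma state_coef2_le (f : state A) p k :
  complex.Re (f (star (p : {poly A})`_0 * (p : {poly A})`_0)) +
  complex.Re (f (star (p : {poly A})`_k.+1 * (p : {poly A})`_k.+1)) <= anorm (j p) ^+ 2.
Proof.
apply: le_trans (state_coefs_le f p k.+2).
rewrite big_ord_recl big_ord_recr /= lerD2l lerDr.
by apply: sumr_ge0 => i _; exact: Re_state_ge0.
Qed.

Lemma sp_coef_le p k : anorm (p : {poly A})`_k <= anorm (j p).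
Proof.
have [f hf] := exists_state (p : {poly A})`_k.
have := state_coef_le f p k; rewrite hf /= => h.
by rewrite -(@ler_pXn2r _ 2)// nnegrE anorm_ge0.
Qed.

Lemma sp_embedC_norm a : anorm (j (skewC a)) = anorm a.
Proof.
apply/eqP; rewrite eq_le sp_embedC_le /=.
by have := sp_coef_le (skewC a) 0; rewrite coef_skewC.
Qed.

End SemicrossedNorm.

(** * Fourier coefficients *)

Section Extension.
Context {R : realType} {A : cstarAlgType R} {alpha : {lrmorphism A -> A}}.
Variable S : semicrossed_product alpha.
Local Notation P := (skew_poly alpha).
Local Notation j := (sp_embed S).
Implicit Types (p q : P) (x y : S).

Lemma sp_limit x : exists p : nat -> P, acvg (fun n => j (p n)) x.
Proof.
have h n : exists p : P, anorm (x - j p) < 1 / n.+1%:R.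
  by apply: sp_dense; rewrite divr_gt0.
have [p hp] := choice h; exists p => e e0.
have [N hN] := inv_small 1 e0; exists N => n hn.
by rewrite anorm_distC (lt_trans (hp n))// hN.
Qed.

Context {Z : banachAlgType R}.

Lemma bounded_acvg (Y : banachAlgType R) (F : Y -> Z) (C : R) u l :
  zmod_morphism F -> (forall a, anorm (F a) <= C * anorm a) ->
  acvg u l -> acvg (F \o u) (F l).
Proof.
move=> FB FC; apply: (@acvg_lip _ Y Z F C) => a b; rewrite -FB; exact: FC.
Qed.

Lemma sp_morphism_eq (F G : S -> Z) (C D : R) :
  zmod_morphism F -> (forall x, anorm (F x) <= C * anorm x) ->
  zmod_morphism G -> (forall x, anorm (G x) <= D * anorm x) ->
  (forall p, F (j p) = G (j p)) -> forall x, F x = G x.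
Proof.
move=> FB FC GB GC h x; have [p hp] := sp_limit x.
apply: acvg_uniq (bounded_acvg FB FC hp) _.
move=> e /(bounded_acvg GB GC hp)[N hN]; exists N => n /hN.
by rewrite /= h.
Qed.

Lemma sp_extend (T : P -> Z) (C : R) : zmod_morphism T -> scalable T ->
  (forall p, anorm (T p) <= C * anorm (j p)) ->
  exists F : S -> Z, [/\ forall p, F (j p) = T p, zmod_morphism F, scalable F &
    forall x, anorm (F x) <= C * anorm x].
Proof.
move=> TB TZ TC.
have TC' p : anorm (T p) <= `|C| * anorm (j p).
  by apply: le_trans (TC p) _; rewrite ler_wpM2r ?anorm_ge0 ?ler_norm.
have diff (p q : nat -> P) x : acvg (fun n => j (p n)) x ->
    acvg (fun n => j (q n)) x -> acvg (fun n => T (p n) - T (q n)) 0.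
  move=> hp hq e e0; have C1 : 0 < `|C| + 1 by rewrite ltr_pwDr.
  have [N hN] := acvgB hp hq (divr_gt0 e0 C1); exists N => n /hN.
  rewrite !subrr !subr0 -rmorphB -TB ltr_pdivlMr// => h.
  apply: le_lt_trans (TC' _) _; apply: le_lt_trans h.
  by rewrite mulrC ler_wpM2l ?anorm_ge0//; lra.
have ex x : exists l, forall p : nat -> P, acvg (fun n => j (p n)) x ->
    acvg (fun n => T (p n)) l.
  have [p hp] := sp_limit x.
  have [l hl] : exists l, acvg (fun n => T (p n)) l.
    apply: acauchy_cvg => e e0; have C1 : 0 < `|C| + 1 by rewrite ltr_pwDr.
    have [N hN] := acvg_cauchy hp (divr_gt0 e0 C1); exists N => m n hm hn.
    have := hN _ _ hm hn; rewrite -rmorphB -TB ltr_pdivlMr// => h.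
    apply: le_lt_trans (TC' _) _; apply: le_lt_trans h.
    by rewrite mulrC ler_wpM2l ?anorm_ge0//; lra.
  exists l => q hq e e0.
  have [N hN] := acvgD (diff _ _ _ hq hp) hl e0; exists N => n /hN /=.
  by rewrite subrK add0r.
have [F hF] := choice ex.
have cstj p : acvg (fun=> j p) (j p) by exact: acvg_cst.
exists F; split.
- by move=> p; apply: acvg_uniq (hF _ _ (cstj p)) _; exact: acvg_cst.
- move=> x y; have [p hp] := sp_limit x; have [q hq] := sp_limit y.
  have hpq : acvg (fun n => j (p n - q n)) (x - y).
    by move=> e /(acvgB hp hq)[N hN]; exists N => n /hN /=; rewrite rmorphB.
  apply: acvg_uniq (hF _ _ hpq) _.
  by move=> e /(acvgB (hF _ _ hp) (hF _ _ hq))[N hN]; exists N => n /hN /=; rewrite TB.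
- move=> c x; have [p hp] := sp_limit x.
  have hcp : acvg (fun n => j (c *: p n)) (c *: x).
    move=> e /(acvgZ c hp)[N hN]; exists N => n /hN /=.
    have -> : j (c *: p n) = c *: j (p n) by exact: linearZ.
    by [].
  apply: acvg_uniq (hF _ _ hcp) _.
  by move=> e /(acvgZ c (hF _ _ hp))[N hN]; exists N => n /hN /=; rewrite TZ.
- move=> x; have [p hp] := sp_limit x; apply/ler_addgt0Pl => e e0.
  have e2 : 0 < e / 2 by rewrite divr_gt0.
  have C1 : 0 < `|C| + 1 by rewrite ltr_pwDr.
  have [N1 h1] := hF _ _ hp _ e2.
  have [N2 h2] := hp _ (divr_gt0 e2 C1).
  have := h1 _ (leq_maxl N1 N2); have := h2 _ (leq_maxr N1 N2).
  set n := maxn N1 N2; rewrite ltr_pdivlMr// => a1 a2.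
  have [C0|C0] := leP 0 C.
    have := anorm_sub (F x) (T (p n)); rewrite anorm_distC.
    have := anorm_sub (j (p n)) x; have := TC (p n).
    move=> b1 b2 b3; have := ler_wpM2l C0 b2; rewrite ger0_norm// in a1; nra.
  (* A negative C forces the norm to vanish on the dense range, hence everywhere. *)
  have z p' : anorm (j p') = 0.
    have := TC p'; have := anorm_ge0 (T p'); have := anorm_ge0 (j p').
    by move=> c1 c2 c3; apply/eqP; rewrite eq_le c1 andbT; nra.
  have x0 : anorm x <= 0.
    by apply: (acvg_anorm_le hp) => k; rewrite z.
  have -> : anorm x = 0 by apply/eqP; rewrite eq_le x0 anorm_ge0.
  rewrite mulr0 addr0; have := TC (p n); rewrite z mulr0.
  by have := anorm_sub (F x) (T (p n)); rewrite anorm_distC; lra.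
Qed.

Lemma sp_extend_lrmorphism (T : {lrmorphism P -> Z}) (C : R) :
  (forall p, anorm (T p) <= C * anorm (j p)) ->
  exists F : {lrmorphism S -> Z}, (forall p, F (j p) = T p) /\
    (forall x, anorm (F x) <= C * anorm x).
Proof.
move=> TC; have TB : zmod_morphism T by move=> p q; rewrite rmorphB.
have TZ : scalable T by move=> c p; rewrite linearZ.
have [F [Fj FB FZ FC]] := sp_extend TB TZ TC.
have FM : monoid_morphism F.
  split; first by rewrite -(rmorph1 j) Fj rmorph1.
  move=> x y; have [p hp] := sp_limit x; have [q hq] := sp_limit y.
  have hF := bounded_acvg FB FC.
  apply: acvg_uniq (hF _ _ (acvgM hp hq)) _.
  move=> e /(acvgM (hF _ _ hp) (hF _ _ hq))[N hN]; exists N => n /hN.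
  by rewrite /= -[j _ * j _]rmorphM !Fj rmorphM.
by exists (lrmorphism_of FB FM FZ).
Qed.

End Extension.

Section FourierCoefficients.
Context {R : realType} {A : cstarAlgType R} {alpha : {lrmorphism A -> A}}.
Hypothesis salpha : star_morphism alpha.
Variable S : semicrossed_product alpha.
Local Notation P := (skew_poly alpha).
Local Notation j := (sp_embed S).
Implicit Types (p q : P) (x y : S) (k : nat).

Let coef_exists k : exists F : S -> A,
  [/\ forall p, F (j p) = (p : {poly A})`_k, zmod_morphism F, scalable F &
    forall x, anorm (F x) <= 1 * anorm x].
Proof.
apply: (sp_extend (T := fun p : P => (p : {poly A})`_k)).
- by move=> p q; rewrite coefB.
- by move=> c p; rewrite coef_skew_scale.
- by move=> p; rewrite mul1r sp_coef_le.
Qed.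

Definition sp_coef k : S -> A := sval (cid (coef_exists k)).

Lemma sp_coef_embed k p : sp_coef k (j p) = (p : {poly A})`_k.
Proof. by rewrite /sp_coef; case: cid => F [] /=. Qed.

Lemma sp_coefB k : zmod_morphism (sp_coef k).
Proof. by rewrite /sp_coef; case: cid => F [] /=. Qed.

Lemma sp_coefZ k : scalable (sp_coef k).
Proof. by rewrite /sp_coef; case: cid => F [] /=. Qed.

Lemma sp_coef_norm k x : anorm (sp_coef k x) <= anorm x.
Proof. by rewrite /sp_coef; case: cid => F [] /= _ _ _ /(_ x); rewrite mul1r. Qed.

Lemma sp_coef_acvg k u x : acvg u x -> acvg (fun n => sp_coef k (u n)) (sp_coef k x).
Proof.
apply: (bounded_acvg (C := 1) (sp_coefB k)) => y; rewrite mul1r; exact: sp_coef_norm.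
Qed.

Lemma sp_coef0M x y : sp_coef 0 (x * y) = sp_coef 0 x * sp_coef 0 y.
Proof.
have [p hp] := sp_limit x; have [q hq] := sp_limit y.
apply: acvg_uniq (sp_coef_acvg 0 (acvgM hp hq)) _.
move=> e /(acvgM (sp_coef_acvg 0 hp) (sp_coef_acvg 0 hq))[N hN]; exists N => n /hN.
rewrite -[j _ * j _]rmorphM !sp_coef_embed coef_skewM.
by rewrite big_ord_recl big_ord0 addr0.
Qed.

(** A product rule, twisted by alpha on the left: the first coefficient is a derivation along the
    constant term. *)
Lemma sp_coef1M x y : sp_coef 1 (x * y) =
  sp_coef 1 x * sp_coef 0 y + alpha (sp_coef 0 x) * sp_coef 1 y.
Proof.
have [p hp] := sp_limit x; have [q hq] := sp_limit y.
apply: acvg_uniq (sp_coef_acvg 1 (acvgM hp hq)) _.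
have alpha_acvg : acvg (fun n => alpha (sp_coef 0 (j (p n)))) (alpha (sp_coef 0 x)).
  apply: (bounded_acvg (F := alpha) (C := 1)) (sp_coef_acvg 0 hp).
    by move=> a b; rewrite rmorphB.
  by move=> a; rewrite mul1r star_morphism_contractive.
move=> e /(acvgD (acvgM (sp_coef_acvg 1 hp) (sp_coef_acvg 0 hq))
  (acvgM alpha_acvg (sp_coef_acvg 1 hq)))[N hN]; exists N => n /hN.
rewrite -[j _ * j _]rmorphM !sp_coef_embed coef_skewM.
by rewrite !big_ord_recl big_ord0 addr0.
Qed.

Lemma dilate_near p (e : R) : 0 < e -> exists r : R,
  [/\ 0 <= r, r < 1 & anorm (j p - j (skew_dilate r p)) < e].
Proof.
move=> e0; set s := size (p : {poly A}).
pose C := \sum_(k < s) anorm (p : {poly A})`_k.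
have C0 : 0 <= C by apply: sumr_ge0 => k _; exact: anorm_ge0.
have C1 : 0 < s%:R * C + 1 by rewrite ltr_wpDl// mulr_ge0.
(* By Bernoulli 1 - (1 - t)^k <= k t <= s t, so the error is at most s t C. *)
pose t := Num.min 1 (e / 2 / (s%:R * C + 1)).
have t0 : 0 < t by rewrite lt_min ltr01 !divr_gt0.
have t1 : t <= 1 by rewrite ge_min lexx.
exists (1 - t); split; [lra|lra|].
have pow k : 1 - k%:R * t <= (1 - t) ^+ k <= 1.
  apply/andP; split; last by rewrite exprn_ile1//; lra.
  elim: k => [|k IH]; first by rewrite mul0r subr0.
  rewrite exprS -natr1; have k0 : 0 <= k%:R :> R by [].
  have := ler_wpM2l (_ : 0 <= 1 - t) IH; rewrite subr_ge0 => /(_ t1).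
  have : 0 <= k%:R * t * t by rewrite !mulr_ge0 ?(ltW t0).
  lra.
have -> : j p - j (skew_dilate (1 - t) p) = j (\sum_(k < s) skewX ^+ k *
    skewC ((1 - (1 - t) ^+ k)%:C *: (p : {poly A})`_k)).
  rewrite -rmorphB; congr (j _).
  rewrite {1}[p](@skew_sum _ _ _ s)// [skew_dilate _ _](@skew_sum _ _ _ s) ?size_poly//.
  rewrite -sumrB; apply: eq_bigr => k _; rewrite -mulrBr -rmorphB; congr (_ * skewC _).
  by rewrite coef_poly ltn_ord rmorphB scalerBl scale1r.
apply: le_lt_trans (sp_monomials_le _ _
  (fun k => (1 - (1 - t) ^+ k)%:C *: (p : {poly A})`_k)) _.
apply: (@le_lt_trans _ _ (s%:R * t * C)).
  rewrite mulr_sumr; apply: ler_sum => k _.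
  have /andP[a1 a2] := pow k; rewrite anormZr ger0_norm ?subr_ge0//.
  rewrite ler_wpM2r ?anorm_ge0//.
  have : k%:R * t <= s%:R * t by rewrite ler_wpM2r ?ler_nat ?(ltW t0)// ltnW.
  lra.
have : t * (s%:R * C + 1) <= e / 2 by rewrite -ler_pdivlMr// ge_min lexx orbT.
lra.
Qed.

(* Abel summation: x is approximated by polynomials whose coefficients are real
   multiples of its own Fourier coefficients. *)
Lemma sp_abel x (e : R) : 0 < e -> exists p : P,
  [/\ anorm (x - j p) < e, (p : {poly A})`_0 = sp_coef 0 x &
      forall k, exists r : R, (p : {poly A})`_k = r%:C *: sp_coef k x].
Proof.
move=> e0; have e4 : 0 < e / 8 by rewrite divr_gt0.
have [p hp] := sp_dense x e4.
have [r [r0 r1 hr]] := dilate_near p e4.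
have r1' : 0 < 1 - r by rewrite subr_gt0.
(* The tolerance for q depends on r: the coefficients of q and x differ by at most (e / 8) (1 - r),
   and the weights r^k sum to at most 1 / (1 - r). *)
have e5 : 0 < Num.min (e / 8) (e / 8 * (1 - r)) by rewrite lt_min divr_gt0//= mulr_gt0.
have [q hq] := sp_dense x e5; move: hq; rewrite lt_min => /andP[hq1 hq2].
(* The successor keeps the constant coefficient of x even when q = 0. *)
set s := (size (q : {poly A})).+1.
pose g : P := \poly_(k < s) ((r ^+ k)%:C *: sp_coef k x).
exists g; split.
- have d1 : anorm (j (skew_dilate r p) - j (skew_dilate r q)) <= anorm (j p - j q).
    have -> : j (skew_dilate r p) - j (skew_dilate r q) = j (skew_dilate r (p - q)).
      rewrite -rmorphB; congr (j _); apply/polyP => k.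
      rewrite coefB !coef_poly.
      have cf (h : P) : (if (k < size (h : {poly A}))%N then
          (r ^+ k)%:C *: (h : {poly A})`_k else 0) = (r ^+ k)%:C *: (h : {poly A})`_k.
        by case: ltnP => // hk; rewrite nth_default// scaler0.
      by rewrite !cf coefB scalerBr.
    by rewrite -rmorphB sp_dilate_le// ltW.
  have d2 : anorm (j (skew_dilate r q) - j g) <= e / 8.
    have -> : j (skew_dilate r q) - j g = j (\sum_(k < s) skewX ^+ k *
        skewC ((r ^+ k)%:C *: ((q : {poly A})`_k - sp_coef k x))).
      rewrite -rmorphB; congr (j _).
      rewrite [skew_dilate _ _](@skew_sum _ _ _ s); last first.
        by rewrite (leq_trans (size_poly _ _))// leqnSn.
      rewrite {1}[g](@skew_sum _ _ _ s) ?size_poly//.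
      rewrite -sumrB; apply: eq_bigr => k _.
      rewrite -mulrBr -rmorphB; congr (_ * skewC _).
      rewrite !coef_poly ltn_ord scalerBr; congr (_ - _).
      by case: ltnP => // hk; rewrite nth_default// scaler0.
    apply: le_trans (sp_monomials_le _ _
      (fun k => (r ^+ k)%:C *: ((q : {poly A})`_k - sp_coef k x))) _.
    apply: (@le_trans _ _ (\sum_(k < s) r ^+ k * (e / 8 * (1 - r)))).
      apply: ler_sum => k _; rewrite anormZr ger0_norm ?exprn_ge0//.
      rewrite ler_wpM2l ?exprn_ge0// -(sp_coef_embed k) -sp_coefB.
      by apply: le_trans (sp_coef_norm _ _) _; rewrite anorm_distC ltW.
    rewrite -mulr_suml mulrCA -[leRHS]mulr1 ler_wpM2l ?(ltW e4)//.
    have := subrX1 r s; set G := \sum_(_ < _) _ => hG.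
    have -> : G * (1 - r) = 1 - r ^+ s by rewrite mulrC -[1 - r]opprB mulNr -hG opprB.
    by rewrite lerBlDr lerDl exprn_ge0.
  have := anorm_triangle (j p) x (j g).
  have := anorm_triangle (j (skew_dilate r p)) (j p) (j g).
  have := anorm_triangle (j (skew_dilate r q)) (j (skew_dilate r p)) (j g).
  have := anorm_triangle x (j p) (j q); rewrite (anorm_distC (j p) x).
  lra.
- by rewrite coef_poly /= expr0 scale1r.
- move=> k; rewrite coef_poly; case: ltnP => _; first by exists (r ^+ k).
  by exists 0; rewrite scale0r.
Qed.

Lemma state_sp_coef_le (f : state A) x k :
  complex.Re (f (star (sp_coef 0 x) * sp_coef 0 x)) +
  complex.Re (f (star (sp_coef k.+1 x) * sp_coef k.+1 x)) <= anorm x ^+ 2.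
Proof.
have Re_le h : star h = h -> complex.Re (f h) <= anorm h.
  move=> /positive_norm_sub /(state_positive f); rewrite stateD stateN stateZ state1 mulr1.
  by rewrite lecE => /andP[_]; rewrite ReB /= subr_ge0.
have [p hp] := sp_limit x.
have cv i : acvg (fun n => star (sp_coef i (j (p n))) * sp_coef i (j (p n)))
    (star (sp_coef i x) * sp_coef i x).
  by apply: acvgM; [apply: acvg_star|]; exact: sp_coef_acvg.
apply/ler_addgt0Pl => e e0; have e3 : 0 < e / 3 by rewrite divr_gt0.
have D : 0 < 2 * anorm x + 1 by have := anorm_ge0 x; lra.
(* For d <= 1 one has (|x| + d)^2 <= |x|^2 + d (2 |x| + 1), which leaves an error of e / 3. *)
have e4 : 0 < Num.min 1 (e / 3 / (2 * anorm x + 1)) by rewrite lt_min ltr01 divr_gt0.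
have [N1 h1] := cv 0%N _ e3; have [N2 h2] := cv k.+1 _ e3; have [N3 h3] := hp _ e4.
set n := maxn N1 (maxn N2 N3).
have := h1 n (leq_maxl _ _).
have := h2 n (leq_trans (leq_maxl _ _) (leq_maxr _ _)).
have := h3 n (leq_trans (leq_maxr _ _) (leq_maxr _ _)).
rewrite lt_min => /andP[m1 m2].
have := state_coef2_le salpha S f (p n) k; rewrite -!sp_coef_embed.
have sub i : complex.Re (f (star (sp_coef i x) * sp_coef i x)) <=
    complex.Re (f (star (sp_coef i (j (p n))) * sp_coef i (j (p n)))) +
    anorm (star (sp_coef i (j (p n))) * sp_coef i (j (p n)) -
           star (sp_coef i x) * sp_coef i x).
  have := Re_le (star (sp_coef i x) * sp_coef i x -
    star (sp_coef i (j (p n))) * sp_coef i (j (p n))).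
  rewrite starB !starM !starK => /(_ erefl).
  by rewrite stateD stateN ReB anorm_distC; lra.
have := sub 0%N; have := sub k.+1.
move: m2; rewrite ltr_pdivlMr// => m2.
have := anorm_sub (j (p n)) x; have := anorm_ge0 (j (p n)); have := anorm_ge0 x.
have := anorm_ge0 (j (p n) - x).
move: m1 m2; move: (anorm (j (p n) - x)) (anorm x) (anorm (j (p n))) => d u w.
move=> m1 m2 d0 u0 w0 wu s1 s2 s3 s4 s5.
have : w ^+ 2 <= u ^+ 2 + e / 3.
  have : w ^+ 2 <= (u + d) ^+ 2 by rewrite ler_pXn2r ?nnegrE//; lra.
  have : d * d <= d by rewrite ler_piMr// ltW.
  nra.
lra.
Qed.

End FourierCoefficients.

(** * From an isomorphism to an outer conjugacy *)

Section Unitaries.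
Context {R : realType} {A : cstarAlgType R}.
Implicit Types (a b h v : A).

Lemma unitary_norm v : unitary v -> anorm v = 1.
Proof.
case=> h _; have : anorm v ^+ 2 = 1 by rewrite -anorm_star h anorm1.
by move=> /eqP; rewrite sqrp_eq1 ?anorm_ge0// => /eqP.
Qed.

(** Both 1 - a^* a and a^* (1 - b^* b) a = a^* a - 1 are positive, so a^* a = 1. *)
Lemma contractive_inverse a b : a * b = 1 -> b * a = 1 -> anorm a <= 1 ->
  anorm b <= 1 -> star a = b.
Proof.
move=> ab ba na nb.
have pos (x : A) : anorm x <= 1 -> positive (1 - star x * x).
  move=> nx; have := positive_anorm_sub x.
  have p0 : positive ((1 - anorm x ^+ 2)%:C *: (1 : A)).
    by apply: positive_cst; rewrite subr_ge0 expr_le1 ?anorm_ge0.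
  by move=> /(positiveD p0); rewrite cstB scale1r subrKA.
have h1 := pos _ na; have h2 := positive_conj a (pos _ nb).
have e : star a * (1 - star b * b) * a = - (1 - star a * a).
  rewrite mulrBr mulr1 mulrBl opprB; congr (_ - _).
  by rewrite mulrA -starM ba star1 mul1r ba.
rewrite e in h2; have := positive_antisym h1 h2.
by move=> /eqP; rewrite subr_eq0 => /eqP aa; rewrite -[LHS]mulr1 -ab mulrA -aa mul1r.
Qed.

(** A self-adjoint contraction h is the mean of the unitaries h + i m and h - i m with m = sqrt (1 -
    h^2); scaling and the splitting into real and imaginary parts reach every element. *)
Lemma unitary_ind (Q : A -> Prop) : (forall v, unitary v -> Q v) ->
  (forall a b, Q a -> Q b -> Q (a + b)) ->
  (forall (c : R[i]) a, Q a -> Q (c *: a)) -> forall a, Q a.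
Proof.
move=> QU QD QZ.
have Qball h : star h = h -> anorm h <= 1 -> Q h.
  move=> sh nh; have nhh : anorm (h * h) <= 1.
    by rewrite anorm_sq// expr_le1 ?anorm_ge0.
  have shh : star (h * h) = h * h by rewrite starM sh.
  have sm := asqrt_star nhh shh; have mm := asqrt_sq nhh.
  have hm : h * asqrt 1 (h * h) = asqrt 1 (h * h) * h.
    by apply: asqrt_comm => //; rewrite mulrA.
  move: sm mm hm; set m := asqrt _ _ => sm mm hm; rewrite scale1r in mm.
  pose i := 'i%C *: m.
  have si : star i = - i by rewrite star_scalei sm.
  have ii : i * i = h * h - 1 by rewrite mulii mm opprB.
  have hi : h * i = i * h by rewrite /i -scalerAl -scalerAr hm.
  have u1 : unitary (h + i).
    split; rewrite starD sh si.
      have -> : (h - i) * (h + i) = h * h - i * i + (h * i - i * h) by ncring.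
      by rewrite hi subrr addr0 ii; ncring.
    have -> : (h + i) * (h - i) = h * h - i * i - (h * i - i * h) by ncring.
    by rewrite hi subrr subr0 ii; ncring.
  have u2 : unitary (h - i).
    by case: u1 => a1 a2; split; rewrite starB sh si opprK; rewrite starD sh si in a1 a2.
  have := QZ (2^-1)%:C _ (QD _ _ (QU _ u1) (QU _ u2)).
  rewrite addrACA subrr addr0 scalerDr -scalerDl -rmorphD /=.
  by rewrite (_ : 2^-1 + 2^-1 = 1) ?scale1r//; field.
have Qsa h : star h = h -> Q h.
  move=> sh; have n1 : 0 < anorm h + 1 by rewrite ltr_pwDr ?anorm_ge0.
  have -> : h = (anorm h + 1)%:C *: ((anorm h + 1)^-1%:C *: h).
    by rewrite scalerA -rmorphM divff ?scale1r// gt_eqF.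
  apply: QZ; apply: Qball; first by rewrite starZr sh.
  rewrite anormZr ger0_norm ?invr_ge0 ?(ltW n1)// mulrC ler_pdivrMr// mul1r; lra.
move=> a.
have -> : a = (2^-1)%:C *: (a + star a) + ('i%C * (2^-1)%:C) *: ('i%C *: (star a - a)).
  rewrite scalerA mulrAC -expr2 sqr_i mulN1r -rmorphN -[in RHS]opprB scalerN -scaleNr.
  rewrite -rmorphN opprK -scalerDr addrACA subrr addr0.
  by rewrite scalerDr -scalerDl -rmorphD (_ : 2^-1 + 2^-1 = 1 :> R) ?scale1r//; field.
apply: QD; apply: QZ; apply: Qsa; first by rewrite starD starK addrC.
by rewrite star_scalei starB starK -scalerN opprB.
Qed.

(** The unitary is b |b|^-1. Taking adjoints in the second relation gives b^* y = x b^*, so x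
    commutes with b^* b and therefore with |b|^-1. *)
Lemma polar_decomposition b s : b * s = 1 -> s * b = 1 -> exists t, unitary t /\
  forall x y, y * b = b * x -> star y * b = b * star x -> y * t = t * x.
Proof.
move=> bs sb; have [k [sk kk _ ck]] := positive_sqrt (positive_starM b).
(* Here k = |b|, d is the inverse of e = |b|^2, and m = |b|^-1. *)
pose e := star b * b; pose d := s * star s; pose m := k * d.
have sd : star d = d by rewrite starM starK.
have se : star e = e by rewrite starM starK.
have ed : e * d = 1.
  by rewrite /d /e mulrA -[star b * b * s]mulrA bs mulr1 -starM sb star1.
have de : d * e = 1 by rewrite -[LHS]starK starM sd se ed star1.
have eE : e = star b * b by [].
have dE : d = s * star s by [].
have ke : k * e = e * k by rewrite /e -kk mulrA.
have mE : m = k * d by [].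
rewrite -eE in kk ck; clearbody e d m.
have comm_d x : x * e = e * x -> x * d = d * x.
  move=> h; have : d * (e * x) * d = d * (x * e) * d by rewrite h.
  by rewrite !mulrA de mul1r -[_ * e * d]mulrA ed mulr1.
have kd := comm_d _ ke.
have mk : m * k = 1 by rewrite mE -mulrA -kd mulrA kk.
have km : k * m = 1 by rewrite mE mulrA kk.
have sm : star m = m by rewrite mE starM sd sk.
have mm : m * m = d by rewrite {1}mE kd -mulrA km mulr1.
exists (b * m); split.
  split; rewrite starM sm.
    by rewrite mulrA -[m * star b * b]mulrA -eE -kk mulrA mk mul1r km.
  rewrite mulrA -[b * m * m]mulrA mm dE !mulrA bs mul1r -starM bs star1//.
move=> x y h1 h2.
have sbx : star b * y = x * star b.
  by have := congr1 (@star _ _) h2; rewrite !starM !starK.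
have xe : x * e = e * x by rewrite eE mulrA -sbx -mulrA h1 mulrA.
have xk : x * k = k * x by apply: ck.
have xm : x * m = m * x by rewrite mE mulrA xk -!mulrA (comm_d _ xe).
by rewrite mulrA h1 -!mulrA xm.
Qed.

End Unitaries.

(** * Invertible contractions lie in the coefficient algebra *)

Section Diagonal.
Context {R : realType} {A : cstarAlgType R} {alpha : {lrmorphism A -> A}}.
Hypothesis salpha : star_morphism alpha.
Variable S : semicrossed_product alpha.
Local Notation j := (sp_embed S).
Local Notation E := (@sp_coef _ _ _ salpha S).
Implicit Types (x y u w : S).

Let E0_zmod : zmod_morphism (E 0%N). Proof. exact: sp_coefB. Qed.

Let E0_monoid : monoid_morphism (E 0%N).
Proof.
split; last exact: sp_coef0M.
by rewrite -(rmorph1 j) sp_coef_embed coef1.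
Qed.

Let E0_scalable : scalable (E 0%N). Proof. exact: sp_coefZ. Qed.

Definition sp_expect : {lrmorphism S -> A} :=
  lrmorphism_of E0_zmod E0_monoid E0_scalable.

Lemma sp_expectE x : sp_expect x = E 0%N x. Proof. by []. Qed.

Lemma sp_expectC a : sp_expect (j (skewC a)) = a.
Proof. by rewrite sp_expectE sp_coef_embed coef_skewC. Qed.

Lemma sp_expect_norm x : anorm (sp_expect x) <= anorm x.
Proof. exact: sp_coef_norm. Qed.

(** A state norming the coefficient x_(k+1) gives 1 + |x_(k+1)|^2 <= |x|^2 <= 1; Abel means then
    show that x is its constant term. *)
Lemma contraction_expect1 x : anorm x <= 1 -> sp_expect x = 1 -> x = 1.
Proof.
rewrite sp_expectE => nx x0.
have xk k : E k.+1 x = 0.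
  have [f hf] := exists_state (E k.+1 x).
  have := state_sp_coef_le salpha f x k; rewrite x0 star1 mulr1 state1 hf /= => h.
  have : anorm x ^+ 2 <= 1 by rewrite expr_le1 ?anorm_ge0.
  have := sqr_ge0 (anorm (E k.+1 x)) => h1 h2.
  apply: anorm0_eq0; apply/eqP; rewrite -sqrf_eq0; apply/eqP; lra.
apply/eqP; rewrite -subr_eq0; apply/eqP; apply: anorm_small => e e0.
have [p [hp p0 pk]] := sp_abel salpha x e0.
have p1 : p = 1.
  apply/polyP => -[|k]; first by rewrite p0 x0 coef1.
  by have [r ->] := pk k.+1; rewrite xk scaler0 coef1.
by move: hp; rewrite p1 rmorph1 => /ltW.
Qed.

(** The product of the constant term of w with u is a contraction with constant term 1, hence equal
    to 1. *)
Lemma invertible_contraction u w : u * w = 1 -> w * u = 1 -> anorm u <= 1 ->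
  anorm w <= 1 -> u = j (skewC (sp_expect u)) /\
    star (sp_expect u) = sp_expect w.
Proof.
move=> uw wu nu nw.
have ab : sp_expect u * sp_expect w = 1 by rewrite -lrmorphM uw lrmorph1.
have ba : sp_expect w * sp_expect u = 1 by rewrite -lrmorphM wu lrmorph1.
split; last first.
  by apply: contractive_inverse => //; apply: le_trans (sp_expect_norm _) _.
have h : j (skewC (sp_expect w)) * u = 1.
  apply: contraction_expect1.
    apply: le_trans (anormM _ _) _; rewrite mulr_ile1 ?anorm_ge0// sp_embedC_norm//.
    by apply: le_trans (sp_expect_norm _) _.
  by rewrite lrmorphM sp_expectC.
rewrite -[LHS]mul1r -(lrmorph1 j) -(lrmorph1 (@skewC _ _ alpha)) -ab !lrmorphM.
by rewrite -mulrA h mulr1.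
Qed.

End Diagonal.

Section IsomorphismDiagonal.
Context {R : realType} {A B : cstarAlgType R} {alpha : {lrmorphism A -> A}}
  {beta : {lrmorphism B -> B}}.
Hypotheses (salpha : star_morphism alpha) (sbeta : star_morphism beta).
Variables (SA : semicrossed_product alpha) (SB : semicrossed_product beta).
Variables (Phi : {lrmorphism SA -> SB}).
Hypothesis isoPhi : forall x, anorm (Phi x) = anorm x.
Local Notation jA := (sp_embed SA).
Local Notation jB := (sp_embed SB).

Definition diag_map : {lrmorphism A -> B} :=
  sp_expect sbeta SB \o Phi \o jA \o skewC.

(** Both claims are linear or antilinear in a, so unitaries suffice; an isometric isomorphism maps a
    unitary to a contraction with contractive inverse. *)
Lemma diag_mapP a : Phi (jA (skewC a)) = jB (skewC (diag_map a)) /\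
  diag_map (star a) = star (diag_map a).
Proof.
move: a; apply: unitary_ind => [v uv|a b [h1 h2] [h3 h4]|c a [h1 h2]].
- have usv : unitary (star v) by case: uv => ? ?; split; rewrite starK.
  have n w : unitary w -> anorm (Phi (jA (skewC w))) <= 1.
    by move=> /unitary_norm nw; rewrite isoPhi sp_embedC_norm// nw.
  have m w w' : w * w' = 1 -> Phi (jA (skewC w)) * Phi (jA (skewC w')) = 1.
    by move=> h; rewrite -!lrmorphM h !lrmorph1.
  have [e1 e2] := uv.
  by have [h ->] := invertible_contraction sbeta (m _ _ e2) (m _ _ e1) (n _ uv) (n _ usv).
- by rewrite starD !lrmorphD starD h1 h2 h3 h4.
- by rewrite starZ !lrmorphZ starZ h1 h2.
Qed.

End IsomorphismDiagonal.

Section StateSeminorm.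
Context {R : realType} {A : cstarAlgType R} (f : state A).

Lemma state_form_linearl (c : R[i]) (x y z : A) :
  f (star z * (c *: x + y)) = c * f (star z * x) + f (star z * y).
Proof. by rewrite mulrDr -scalerAr stateD stateZ. Qed.

Lemma state_formC (x y : A) : f (star x * y) = (f (star y * x))^*.
Proof. by rewrite -state_star starM starK. Qed.

(** The GNS inner product of f, before quotient and completion. *)
Definition state_form : psd_form A :=
  @PsdForm R A (fun x y => f (star y * x)) state_form_linearl state_formC
    (state_ge0 f).

Lemma state_norm_mul_le (x y : A) :
  fnorm state_form (x * y) <= anorm x * fnorm state_form y.
Proof.
rewrite -(@ler_pXn2r _ 2)// ?nnegrE ?mulr_ge0 ?fnorm_ge0 ?anorm_ge0//.
rewrite exprMn !fnorm_sq /= -lecR rmorphM /=.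
rewrite -!(form_Re state_form) /=.
exact: state_conj_le.
Qed.

Lemma state_norm_le (x : A) : fnorm state_form x <= anorm x.
Proof.
have := state_norm_mul_le x 1; rewrite mulr1 /fnorm /= star1 mulr1 state1 /=.
by rewrite sqrtr1 mulr1.
Qed.

End StateSeminorm.

(** * The twisted derivation attached to an isometric isomorphism *)

Section Isomorphism.
Context {R : realType} {A B : cstarAlgType R} {alpha : {lrmorphism A -> A}}
  {beta : {lrmorphism B -> B}}.
Hypotheses (salpha : star_morphism alpha) (sbeta : star_morphism beta).
Variables (SA : semicrossed_product alpha) (SB : semicrossed_product beta).
Variables (Phi : {lrmorphism SA -> SB}) (Psi : {lrmorphism SB -> SA}).
Hypotheses (PhiK : cancel Phi Psi) (PsiK : cancel Psi Phi).
Hypothesis isoPhi : forall x, anorm (Phi x) = anorm x.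
Local Notation jA := (sp_embed SA).
Local Notation jB := (sp_embed SB).
Local Notation EA := (sp_expect salpha SA).
Local Notation EB := (sp_expect sbeta SB).
Local Notation EB1 := (@sp_coef _ _ _ sbeta SB 1).

Lemma isoPsi y : anorm (Psi y) = anorm y.
Proof. by rewrite -isoPhi PsiK. Qed.

Definition gam : {lrmorphism A -> B} := diag_map sbeta Phi.
Definition gaminv : {lrmorphism B -> A} := diag_map salpha Psi.

Lemma Phi_const a : Phi (jA (skewC a)) = jB (skewC (gam a)).
Proof. by have [] := diag_mapP salpha sbeta isoPhi a. Qed.

Lemma Psi_const x : Psi (jB (skewC x)) = jA (skewC (gaminv x)).
Proof. by have [] := diag_mapP sbeta salpha isoPsi x. Qed.

Lemma gam_star : star_morphism gam.
Proof. by move=> a; have [] := diag_mapP salpha sbeta isoPhi a. Qed.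

Lemma gaminv_star : star_morphism gaminv.
Proof. by move=> a; have [] := diag_mapP sbeta salpha isoPsi a. Qed.

Lemma gamK : cancel gam gaminv.
Proof.
move=> a; have := Psi_const (gam a); rewrite -Phi_const PhiK.
by move/(congr1 EA); rewrite !sp_expectC.
Qed.

Lemma gaminvK : cancel gaminv gam.
Proof.
move=> x; have := Phi_const (gaminv x); rewrite -Psi_const PsiK.
by move/(congr1 EB); rewrite !sp_expectC.
Qed.

Let v' : SB := Phi (jA skewX).
Let w' : SA := Psi (jB skewX).
Let b0 : B := EB v'.
Let b1 : B := EB1 v'.
Let c0 : B := gam (EA w').

Let v'_norm : anorm v' <= 1.
Proof. by rewrite /v' isoPhi sp_embedX_le. Qed.

Let v'_cov a : jB (skewC (gam a)) * v' = v' * jB (skewC (gam (alpha a))).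
Proof. by rewrite -!Phi_const -!lrmorphM skewCX. Qed.

Let EB1C x : EB1 (jB (skewC x)) = 0.
Proof. by rewrite sp_coef_embed coef_skewC. Qed.

Let b0_cov a : gam a * b0 = b0 * gam (alpha a).
Proof.
have /(congr1 EB) := v'_cov a; by rewrite !lrmorphM !sp_expectC.
Qed.

(** First coefficients of [v'_cov]. This is the relation that the unitary part of b1 inherits. *)
Let b1_cov a : beta (gam a) * b1 = b1 * gam (alpha a).
Proof.
have /(congr1 EB1) := v'_cov a; rewrite !sp_coef1M !EB1C mul0r mulr0 addr0 add0r.
by rewrite -!sp_expectE !sp_expectC.
Qed.

Let c0_cov x : x * c0 = c0 * beta x.
Proof.
have : jA (skewC (gaminv x)) * w' = w' * jA (skewC (gaminv (beta x))).
  by rewrite -!Psi_const -!lrmorphM skewCX.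
move=> /(congr1 EA)/(congr1 gam).
by rewrite !lrmorphM !sp_expectC !gaminvK.
Qed.

(* If b0 had norm 1, a state f with f(b0^* b0) = 1 would kill all the higher
   coefficients of v', so that the evaluation of v' at c0, which is 0, would be
   b0 in the norm of f. *)
Lemma expect_generator_lt1 : anorm b0 < 1.
Proof.
have b0_le : anorm b0 <= 1 by apply: le_trans (sp_expect_norm _ _) v'_norm.
rewrite lt_neqAle b0_le andbT; apply/eqP => b01.
have [f hf] := exists_state b0; rewrite b01 expr1n in hf.
(* In the seminorm of f, b0 has length 1 and agrees with T p, whose norm is below 1/2. *)
have half : (0 : R) < 2^-1 by rewrite invr_gt0.
have [p [hp p0 pk]] := sp_abel sbeta v' half.
have fk k : fnorm (state_form f) (p : {poly B})`_k.+1 = 0.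
  have [r ->] := pk k.+1; rewrite fnormZ.
  have := state_sp_coef_le sbeta f v' k; rewrite -sp_expectE -/b0 hf /=.
  rewrite -(fnorm_sq (state_form f) (sp_coef sbeta k.+1 v')) => h.
  have : anorm v' ^+ 2 <= 1 by rewrite expr_le1 ?anorm_ge0.
  have := sqr_ge0 (fnorm (state_form f) (sp_coef sbeta k.+1 v')) => h1 h2.
  suff -> : fnorm (state_form f) (sp_coef sbeta k.+1 v') = 0 by rewrite mulr0.
  by apply/eqP; rewrite -sqrf_eq0; apply/eqP; lra.
(* The character w |-> c0 on polynomials. It factors through Psi and the constant term, so it is
   contractive, and T p is close to the image 0 of v'. *)
pose T : {lrmorphism skew_poly beta -> B} := skew_eval (rho := idfun) c0_cov.
have TE q : T q = gam (EA (Psi (jB q))).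
  apply: (skew_morph_eq (G := gam \o EA \o Psi \o jB)) => [x|].
    rewrite -[RHS]/(gam (EA (Psi (jB (skewC x))))).
    by rewrite /T skew_evalC Psi_const sp_expectC gaminvK.
  by rewrite /T skew_evalX.
have T_le : anorm (T p) < 2^-1.
  apply: le_lt_trans hp; rewrite anorm_distC -isoPsi lrmorphB PhiK.
  rewrite -[T p]subr0 -(lrmorph0 gam).
  have e0 : EA (jA skewX) = 0 by rewrite sp_expectE sp_coef_embed coefX.
  rewrite -e0 TE -!lrmorphB.
  apply: le_trans (star_morphism_contractive gam_star _) _.
  exact: sp_expect_norm.
have T0 : T p - b0 = \sum_(k < size (p : {poly B})) c0 ^+ k.+1 * (p : {poly B})`_k.+1.
  rewrite /T /skew_eval lrmorphism_ofE (@skew_linE _ _ _ _ _ _ (size (p : {poly B})).+1)//.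
  by rewrite big_ord_recl /= expr0 mul1r p0 -sp_expectE addrC addKr.
have fT : fnorm (state_form f) (T p - b0) <= 0.
  rewrite T0; elim/big_ind : _ => [|x y hx hy|k _].
  - by rewrite /fnorm form0l sqrtr0.
  - by apply: le_trans (fnormD _ _ _) _; rewrite -[0]addr0 lerD.
  - by apply: le_trans (state_norm_mul_le _ _ _) _; rewrite fk mulr0.
have := fnormB (state_form f) (T p) (T p - b0); rewrite opprB addrC subrK.
have := state_norm_le f (T p).
have -> : fnorm (state_form f) b0 = 1.
  by rewrite /fnorm /= hf sqrtr1.
lra.
Qed.

(** The image of b0 under alpha transported to B; this twist on the left makes the product rule of D
    compatible with b1, since beta(b0) b1 = b1 b0'. *)
Let b0' : B := gam (alpha (gaminv b0)).

(* The noncommutative (x^k - y^k) / (x - y) at x = b0', y = b0: the value at v^k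
   of the derivation D below. *)
Fixpoint difference_quotient (k : nat) : B :=
  if k is m.+1 then b0' * difference_quotient m + b0 ^+ m else 0.

Let Q := difference_quotient.

Let b0'_norm : anorm b0' <= anorm b0.
Proof.
apply: le_trans (star_morphism_contractive gam_star _) _.
apply: le_trans (star_morphism_contractive salpha _) _.
exact: star_morphism_contractive gaminv_star _.
Qed.

Let b0'_comm a : gam (alpha a) * b0' = b0' * gam (alpha (alpha a)).
Proof.
have := b0_cov a; move=> /(congr1 gaminv)/(congr1 alpha)/(congr1 gam).
by rewrite !lrmorphM !gamK.
Qed.

Let b0Xn_comm k a : gam a * b0 ^+ k = b0 ^+ k * gam (iter k alpha a).
Proof. exact: skew_evalXn. Qed.

Let Q_comm k a : gam (alpha a) * Q k = Q k * gam (iter k alpha a).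
Proof.
elim: k a => [|k IH] a; first by rewrite /= mulr0 mul0r.
rewrite [Q k.+1]/= mulrDr mulrDl mulrA b0'_comm -!mulrA -/Q IH iterSr.
by rewrite b0Xn_comm.
Qed.

(** The product rule of D on powers of the generator. *)
Let Q_add i k : Q (i + k) = b0' ^+ i * Q k + Q i * b0 ^+ k.
Proof.
elim: i => [|i IH]; first by rewrite expr0 mul1r mul0r addr0.
rewrite addSn [LHS]/= -/Q IH [Q i.+1]/= -/Q exprS mulrDl mulrDr !mulrA -addrA.
by rewrite exprD.
Qed.

Let D (p : skew_poly alpha) : B := skew_lin gam Q p.
Let ev : {lrmorphism skew_poly alpha -> B} := skew_eval b0_cov.

Let evE p : ev p = EB (Phi (jA p)).
Proof.
apply: (skew_morph_eq (G := EB \o Phi \o jA)) => [a|].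
  rewrite -[RHS]/(EB (Phi (jA (skewC a)))).
  by rewrite /ev skew_evalC Phi_const sp_expectC.
by rewrite /ev skew_evalX.
Qed.

(** On monomials this is [Q_add], once [Q_comm] and [b0Xn_comm] have moved the coefficient in the
    middle to the right. *)
Let DM p q : D (p * q) = gam (alpha (gaminv (ev p))) * D q + D p * ev q.
Proof.
rewrite /D; move: p; apply: (@skew_ind R A alpha) => [|p1 p2 h1 h2|i a].
- by rewrite mul0r !skew_lin0 !lrmorph0 !mul0r addr0.
- by rewrite mulrDl !lrmorphD !skew_linD !mulrDl h1 h2 addrACA.
move: q; apply: (@skew_ind R A alpha) => [|q1 q2 h1 h2|k d].
- by rewrite mulr0 skew_lin0 lrmorph0 !mulr0 addr0.
- by rewrite mulrDr !lrmorphD !skew_linD !mulrDr h1 h2 addrACA.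
rewrite mulrA -[skewX ^+ i * skewC a * _]mulrA skewCXn mulrA -exprD -mulrA.
rewrite -lrmorphM !skew_lin_monom Q_add !lrmorphM !lrmorphX.
have -> : ev skewX = b0 by exact: skew_evalX.
rewrite /ev !skew_evalC !gamK -/b0' -!mulrA mulrDl -!mulrA.
congr (_ + _); first by rewrite !mulrA -[_ * gam (alpha a) * Q k]mulrA Q_comm !mulrA.
by rewrite [gam a * _]mulrA b0Xn_comm !mulrA.
Qed.

Let rho := anorm b0.

Let D_bounded p : anorm (D p) <= ((1 - rho) ^+ 2)^-1 * anorm (jA p).
Proof.
have rho0 : 0 <= rho := anorm_ge0 b0.
have rho1 : 0 < 1 - rho by rewrite subr_gt0 expect_generator_lt1.
(* The recursion solves to s k = k rho^(k-1). *)
pose s := fix s k : R := if k is m.+1 then rho * s m + rho ^+ m else 0.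
have Qs k : anorm (Q k) <= s k.
  elim: k => [|k IH]; first by rewrite /= anorm0.
  rewrite [Q _]/= -/Q; apply: le_trans (anormD _ _) _; rewrite /= lerD//.
    apply: le_trans (anormM _ _) _.
    by rewrite ler_pM ?anorm_ge0.
  by rewrite anormX_le// anorm1.
have s0 k : 0 <= s k by apply: le_trans (Qs k); exact: anorm_ge0.
have geo n : \sum_(k < n) rho ^+ k <= (1 - rho)^-1.
  rewrite -(ler_pM2r rho1) mulVf ?gt_eqF//.
  have h := subrX1 rho n; set G := \sum_(_ < _) _ in h *.
  have -> : G * (1 - rho) = 1 - rho ^+ n.
    by rewrite mulrC -[1 - rho]opprB mulNr -h opprB.
  by rewrite lerBlDr lerDl exprn_ge0.
have sums n : \sum_(k < n) s k <= ((1 - rho) ^+ 2)^-1.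
  elim: n => [|n IH]; first by rewrite big_ord0 invr_ge0 sqr_ge0.
  rewrite big_ord_recl add0r /= big_split /= -mulr_sumr.
  (* The claimed bound is the fixed point of the recursion for the partial sums. *)
  have e : ((1 - rho) ^+ 2)^-1 = rho * ((1 - rho) ^+ 2)^-1 + (1 - rho)^-1.
    by field; rewrite gt_eqF.
  by rewrite [leRHS]e; apply: lerD; [exact: ler_wpM2l|exact: geo].
rewrite /D /skew_lin; apply: le_trans (anorm_sum _ _ _) _.
apply: (@le_trans _ _ (\sum_(k < size (p : {poly A})) s k * anorm (jA p))).
  apply: ler_sum => k _; apply: le_trans (anormM _ _) _.
  rewrite ler_pM ?anorm_ge0//.
  apply: le_trans (star_morphism_contractive gam_star _) _; exact: sp_coef_le.
by rewrite -mulr_suml ler_wpM2r ?anorm_ge0.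
Qed.

Theorem isomorphism_outer_conjugate : outer_conjugate alpha beta.
Proof.
have [F [FjA FB FZ FC]] := sp_extend (skew_lin_zmod _ _) (skew_lin_scalable _ _) D_bounded.
have FD p : F (jA p) = D p by exact: FjA.
have cvF := bounded_acvg FB FC.
have cvE : forall u (l : SA), acvg u l -> acvg (fun n => EB (Phi (u n))) (EB (Phi l)).
  move=> u l; apply: (bounded_acvg (F := EB \o Phi) (C := 1)).
    by move=> x y; rewrite /= !lrmorphB.
  by move=> x; rewrite mul1r /= -isoPhi sp_expect_norm.
have FM x y : F (x * y) = gam (alpha (gaminv (EB (Phi x)))) * F y + F x * EB (Phi y).
  have [p hp] := sp_limit x; have [q hq] := sp_limit y.
  apply: acvg_uniq (cvF _ _ (acvgM hp hq)) _.
  have ca : acvg (fun n => gam (alpha (gaminv (EB (Phi (jA (p n)))))))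
      (gam (alpha (gaminv (EB (Phi x))))).
    apply: (bounded_acvg (F := fun z => gam (alpha (gaminv z))) (C := 1)) (cvE _ _ hp).
      by move=> z t; rewrite !lrmorphB.
    move=> z; rewrite mul1r; apply: le_trans (star_morphism_contractive gam_star _) _.
    apply: le_trans (star_morphism_contractive salpha _) _.
    exact: star_morphism_contractive gaminv_star _.
  move=> e /(acvgD (acvgM ca (cvF _ _ hq)) (acvgM (cvF _ _ hp) (cvE _ _ hq)))[N hN].
  exists N => n /hN; cbv beta delta [comp].
  by rewrite -lrmorphM !FD -!evE DM.
have F_C a : F (jA (skewC a)) = 0.
  have := FjA (skewC a); have := skew_lin_monom (alpha := alpha) gam Q 0 a.
  by rewrite expr0 mul1r mul0r => ->.
pose C : R := ((1 - rho) ^+ 2)^-1.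
pose s := F w'.
have EB1_zmod : zmod_morphism EB1 by exact: sp_coefB.
(* The product rule for the first coefficient produces beta(b0) b1 = b1 b0', so b1 comes out on the
   left and the recursion of Q remains. *)
have v'X k : EB1 (v' ^+ k) = b1 * Q k.
  elim: k => [|k IH]; first by rewrite expr0 -(lrmorph1 jB) sp_coef_embed coef1 mulr0.
  rewrite exprS sp_coef1M -!sp_expectE -/b0 -/b1 IH lrmorphX -/b0 mulrA.
  have := b1_cov (gaminv b0); rewrite gaminvK -/b0' => ->.
  by rewrite [Q k.+1]/= -/Q mulrDr addrC mulrA.
have eq1 x : EB1 (Phi x) = b1 * F x.
  move: x; apply: (sp_morphism_eq (F := EB1 \o Phi) (G := fun x => b1 * F x)
    (C := 1) (D := anorm b1 * C)).
  - by move=> x y; rewrite /= lrmorphB EB1_zmod.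
  - by move=> x; rewrite mul1r -isoPhi; exact: sp_coef_norm.
  - by move=> x y; rewrite FB mulrBr.
  - move=> x; apply: le_trans (anormM _ _) _.
    by rewrite -mulrA ler_wpM2l ?anorm_ge0.
  move=> p; rewrite -[LHS]/(EB1 (Phi (jA p))) -[RHS]/(b1 * F (jA p)); move: p.
  apply: (@skew_ind R A alpha) => [|p q h1 h2|k a].
  - by rewrite FD /D skew_lin0 mulr0 !lrmorph0 -(lrmorph0 jB) sp_coef_embed coef0.
  - have EB1D z t : EB1 (z + t) = EB1 z + EB1 t.
      by have := EB1_zmod (z + t) t; rewrite addrK => ->; rewrite subrK.
    rewrite FD /D skew_linD -/(D p) -/(D q) -!FD mulrDr -h1 -h2.
    by rewrite !lrmorphD EB1D.
  - rewrite FD /D skew_lin_monom.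
    by rewrite !lrmorphM !lrmorphX Phi_const sp_coef1M EB1C mulr0 addr0
      -sp_expectE sp_expectC v'X mulrA.
(* Phi(w') = w has constant term 0, so only the second term of the product rule survives. *)
have w'X p : F (Psi (jB (skewX * p))) = s * (p : {poly B})`_0.
  rewrite !lrmorphM FM !PsiK -/w' -/s.
  have -> : EB (jB skewX) = 0 by rewrite sp_expectE sp_coef_embed coefX.
  by rewrite !lrmorph0 mul0r add0r sp_expectE sp_coef_embed.
have eq2 y : F (Psi y) = s * EB1 y.
  move: y; apply: (sp_morphism_eq (F := F \o Psi) (G := fun y => s * EB1 y)
    (C := C) (D := anorm s)).
  - by move=> x y; rewrite /= lrmorphB FB.
  - by move=> x; rewrite -isoPsi; exact: FC.
  - by move=> x y; rewrite EB1_zmod mulrBr.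
  - move=> x; apply: le_trans (anormM _ _) _.
    by rewrite ler_wpM2l ?anorm_ge0// sp_coef_norm.
  have FDD x y : F (x + y) = F x + F y.
    by have := FB (x + y) y; rewrite addrK => ->; rewrite subrK.
  move=> p; rewrite -[LHS]/(F (Psi (jB p))) -[RHS]/(s * EB1 (jB p)); move: p.
  apply: (@skew_ind R B beta) => [|p q h1 h2|k x].
  - by rewrite -(lrmorph0 (@skewC _ _ beta)) Psi_const F_C EB1C mulr0.
  - by rewrite sp_coef_embed coefD mulrDr -!(sp_coef_embed sbeta SB) -h1 -h2
      !lrmorphD FDD.
  case: k => [|k]; last by rewrite exprS -mulrA w'X sp_coef_embed coef_skewXM.
  by rewrite expr0 mul1r Psi_const F_C EB1C mulr0.
have EB1X : EB1 (jB skewX) = 1 by rewrite sp_coef_embed coefX.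
have FX : F (jA skewX) = 1.
  have := FjA skewX; have := skew_lin_monom (alpha := alpha) gam Q 1 1.
  by rewrite expr1 !lrmorph1 !mulr1 => -> /=; rewrite mulr0 add0r expr0.
have bs : b1 * s = 1 by rewrite -eq1 /w' PsiK.
have sb : s * b1 = 1 by rewrite -eq2 /v' PhiK.
have [t [[t1 t2] ht]] := polar_decomposition bs sb.
have tc a : beta (gam a) * t = t * gam (alpha a).
  apply: ht; first exact: b1_cov.
  have -> : star (beta (gam a)) = beta (gam (star a)) by rewrite (gam_star a) sbeta.
  have -> : star (gam (alpha a)) = gam (alpha (star a)).
    by rewrite salpha (gam_star (alpha a)).
  exact: b1_cov.
exists gam, gaminv, (gaminv (star t)); split=> //.
- exact: gam_star.
- exact: gamK.
- exact: gaminvK.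
- by split; rewrite -gaminv_star starK -lrmorphM ?t1 ?t2 lrmorph1.
- move=> a; rewrite -gaminv_star starK -!lrmorphM -mulrA tc mulrA t1 mul1r.
  by rewrite gamK.
Qed.

End Isomorphism.

(** * From an outer conjugacy to an isomorphism *)

Section Evaluation.
Context {R : realType} {A : cstarAlgType R} {alpha : {lrmorphism A -> A}}
  {H : hilbertType R} (c : covariant_rep alpha H).
Implicit Types (p q : skew_poly alpha) (x : H) (a : A).

Lemma cov_evalD p q x : cov_eval c (p + q) x = cov_eval c p x + cov_eval c q x.
Proof.
set N := maxn (size ((p + q : skew_poly alpha) : {poly A}))
  (maxn (size (p : {poly A})) (size (q : {poly A}))).
rewrite !(@cov_evalE _ _ _ _ N) ?leq_max ?leqnn ?orbT// -big_split /=.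
apply: eq_bigr => k _; rewrite coefD cov_piD.
move: (cov_pi c (p : {poly A})`_k x) (cov_pi c (q : {poly A})`_k x) => y z.
by elim: (nat_of_ord k) => //= i ->; rewrite raddfD.
Qed.

Lemma cov_eval0 x : cov_eval c 0 x = 0.
Proof. by rewrite (@cov_evalE _ _ _ _ 0) ?size_poly0// big_ord0. Qed.

(** The evaluation of 1 is pi(1), possibly not the identity. Left multiplication by the generator is
    still exactly V, because coefficients act before the powers of V. *)
Lemma cov_evalXM p x : cov_eval c (skewX * p) x = cov_V c (cov_eval c p x).
Proof.
pose q : skew_poly alpha := skewX * p; rewrite -/q.
pose N := (size (q : {poly A}) + size (p : {poly A}))%N.
rewrite (@cov_evalE _ _ _ _ N.+1); last exact: leq_trans (leq_addr _ _) (leqnSn _).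
rewrite (@cov_evalE _ _ _ _ N _ p) ?leq_addl// big_ord_recl coef_skewXM /= cov_pi0 add0r.
by rewrite raddf_sum; apply: eq_bigr => k _; rewrite coef_skewXM.
Qed.

Lemma cov_pi_iter k a x :
  cov_pi c a (iter k (cov_V c) x) = iter k (cov_V c) (cov_pi c (iter k alpha a) x).
Proof. by elim: k a => // k IH a; rewrite !iterS cov_covariant IH -iterSr. Qed.

Lemma cov_evalCM a p x : cov_eval c (skewC a * p) x = cov_pi c a (cov_eval c p x).
Proof.
move: p; apply: (@skew_ind R A alpha) => [|p q h1 h2|k b].
- by rewrite mulr0 !cov_eval0 raddf0.
- by rewrite mulrDr !cov_evalD raddfD h1 h2.
rewrite mulrA skewCXn -mulrA -lrmorphM.
have evX b' i : cov_eval c (skewX ^+ i * skewC b') x = iter i (cov_V c) (cov_pi c b' x).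
  elim: i => [|i IH]; first by rewrite expr0 mul1r cov_evalC.
  by rewrite exprS -mulrA cov_evalXM IH.
by rewrite !evX cov_piM cov_pi_iter.
Qed.

End Evaluation.

Section Intertwiner.
Context {R : realType} {A B : cstarAlgType R} {alpha : {lrmorphism A -> A}}
  {beta : {lrmorphism B -> B}} (gamma : {lrmorphism A -> B}) (w : B).
Hypotheses (sgamma : star_morphism gamma) (uw : unitary w).
Hypothesis gw : forall a, beta (gamma a) * w = w * gamma (alpha a).

Section PulledBack.
Context {H : hilbertType R} (c : covariant_rep beta H).

(** A contraction since w is unitary, and covariant by pi(gamma a) V pi(w) = V pi(beta(gamma a) w) =
    V pi(w) pi(gamma(alpha a)). *)
Definition pulled_V : {linear H -> H} := cov_V c \o cov_pi c w.

Let pulled_bounded a : bounded_op (cov_pi c (gamma a)).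
Proof. exact: cov_pi_bounded. Qed.

Let pulledD a b x :
  cov_pi c (gamma (a + b)) x = cov_pi c (gamma a) x + cov_pi c (gamma b) x.
Proof. by rewrite lrmorphD cov_piD. Qed.

Let pulledZ (d : R[i]) a x : cov_pi c (gamma (d *: a)) x = d *: cov_pi c (gamma a) x.
Proof. by rewrite lrmorphZ cov_piZ. Qed.

Let pulledM a b x :
  cov_pi c (gamma (a * b)) x = cov_pi c (gamma a) (cov_pi c (gamma b) x).
Proof. by rewrite lrmorphM cov_piM. Qed.

Let pulled_star a x y :
  inner (cov_pi c (gamma a) x) y = inner x (cov_pi c (gamma (star a)) y).
Proof. by rewrite cov_pi_star sgamma. Qed.

Let pulled_contraction x : rnorm (pulled_V x) <= rnorm x.
Proof.
apply: le_trans (cov_V_contraction c _) _; apply: le_trans (cov_pi_le c w x) _.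
by rewrite unitary_norm// mul1r.
Qed.

Let pulled_covariant a x :
  cov_pi c (gamma a) (pulled_V x) = pulled_V (cov_pi c (gamma (alpha a)) x).
Proof. by rewrite /= cov_covariant -!cov_piM gw. Qed.

Definition pulled_rep : covariant_rep alpha H :=
  CovariantRep pulled_bounded pulledD pulledZ pulledM pulled_star
    pulled_contraction pulled_covariant.
End PulledBack.

Let w_cov a : @skewC _ _ beta (gamma a) * (skewX * skewC w) =
  skewX * skewC w * skewC (gamma (alpha a)).
Proof. by rewrite mulrA skewCX -!mulrA -!lrmorphM gw. Qed.

Definition twist : {lrmorphism skew_poly alpha -> skew_poly beta} :=
  skew_eval (rho := skewC \o gamma) w_cov.

Lemma cov_eval_twist (H : hilbertType R) (c : covariant_rep beta H) p x :
  cov_eval c (twist p) x = cov_eval (pulled_rep c) p x.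
Proof.
rewrite /twist skew_evalE.
rewrite (big_morph (fun q => cov_eval c q x) (fun p q => cov_evalD c p q x)
  (cov_eval0 c x)).
apply: eq_bigr => k _ /=; elim: (nat_of_ord k) (p : {poly A})`__ => [|i IH] a.
  by rewrite expr0 mul1r; exact: cov_evalC.
by rewrite exprS -!mulrA cov_evalXM cov_evalCM iterS IH.
Qed.

Variables (SA : semicrossed_product alpha) (SB : semicrossed_product beta).

Lemma twist_extends : exists F : {lrmorphism SA -> SB},
  [/\ forall a, F (sp_embed SA (skewC a)) = sp_embed SB (skewC (gamma a)),
      F (sp_embed SA skewX) = sp_embed SB (skewX * skewC w) &
      forall x, anorm (F x) <= anorm x].
Proof.
have [p|F [hF FC]] := @sp_extend_lrmorphism _ _ _ SA SB (sp_embed SB \o twist) 1.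
  rewrite mul1r; apply: sp_embed_le => H c x hx; rewrite cov_eval_twist.
  exact: cov_eval_le.
exists F; split=> [a||x].
- by rewrite hF -[LHS]/(sp_embed SB (twist (skewC a))) /twist skew_evalC.
- by rewrite hF -[LHS]/(sp_embed SB (twist skewX)) /twist skew_evalX.
- by rewrite -[leRHS]mul1r.
Qed.

End Intertwiner.

(** Uniqueness of extension from the dense polynomials; it shows below that the two extended twists
    are mutually inverse. *)
Lemma sp_endomorphism_id (R : realType) (A : cstarAlgType R)
    (alpha : {lrmorphism A -> A}) (S : semicrossed_product alpha)
    (F : {lrmorphism S -> S}) :
  (forall x, anorm (F x) <= anorm x) ->
  (forall a, F (sp_embed S (skewC a)) = sp_embed S (skewC a)) ->
  F (sp_embed S skewX) = sp_embed S skewX -> forall x, F x = x.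
Proof.
move=> FC Fc FX x; apply: (sp_morphism_eq (G := idfun) (C := 1) (D := 1)) => //.
- by move=> y z; rewrite lrmorphB.
- by move=> y; rewrite mul1r.
- by move=> y; rewrite mul1r.
- exact: (skew_morph_eq (F := F \o sp_embed S) (G := sp_embed S)).
Qed.

(** Outer conjugacy is symmetric, so [twist_extends] applies in both directions; two mutually
    inverse contractions are isometric. *)
Lemma outer_conjugate_isomorphic (R : realType) (A B : cstarAlgType R)
    (alpha : {lrmorphism A -> A}) (beta : {lrmorphism B -> B})
    (SA : semicrossed_product alpha) (SB : semicrossed_product beta) :
  outer_conjugate alpha beta -> isometrically_isomorphic SA SB.
Proof.
move=> [g [h [v [sg gK hK [v1 v2] hv]]]].
have inj : injective g := can_inj gK.
(* [outer_conjugate] gives the inverse as a bare function; its algebraic structure is pulled back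
   along the injective g. *)
have hB : zmod_morphism h by move=> x y; apply: inj; rewrite lrmorphB !hK.
have hM : monoid_morphism h.
  by split=> [|x y]; apply: inj; rewrite ?lrmorph1 ?lrmorphM !hK.
have hZ : scalable h by move=> c x; apply: inj; rewrite lrmorphZ !hK.
pose h' : {lrmorphism B -> A} := lrmorphism_of hB hM hZ.
have sh : star_morphism h' by move=> x; apply: inj; rewrite sg !hK.
pose w := g (star v).
have uw : unitary w by split; rewrite /w -sg starK -lrmorphM ?v1 ?v2 lrmorph1.
have gw a : beta (g a) * w = w * g (alpha a).
  by rewrite hv !lrmorphM hK /w !mulrA -lrmorphM v1 lrmorph1 mul1r.
have gv x : alpha (h' x) * v = v * h' (beta x).
  by rewrite hv -mulrA v1 mulr1 hK.
have [F [Fc FX FC]] := twist_extends sg uw gw SA SB.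
have [G [Gc GX GC]] := twist_extends sh (conj v1 v2) gv SB SA.
have GF : forall x, G (F x) = x.
  apply: (sp_endomorphism_id (F := G \o F)) => [x|a|] /=.
  - exact: le_trans (GC _) (FC _).
  - by rewrite Fc Gc -[h' _]/(h _) gK.
  - by rewrite FX !lrmorphM GX Gc -!lrmorphM -mulrA -lrmorphM /w -[h' _]/(h _) gK v2 lrmorph1 mulr1.
have FG : forall y, F (G y) = y.
  apply: (sp_endomorphism_id (F := F \o G)) => [x|a|] /=.
  - exact: le_trans (FC _) (GC _).
  - by rewrite Gc Fc -[h' _]/(h _) hK.
  - by rewrite GX !lrmorphM FX Fc -!lrmorphM -mulrA -lrmorphM /w -lrmorphM v1 !lrmorph1 mulr1.
exists F; split=> [x|y]; last by exists (G y).
by apply/eqP; rewrite eq_le FC /= -{1}(GF x) GC.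
Qed.

Theorem theorem1p2 (R : realType) (A B : cstarAlgType R)
    (alpha : {lrmorphism A -> A}) (beta : {lrmorphism B -> B})
    (star_alpha : star_morphism alpha) (star_beta : star_morphism beta)
    (hyp : trivial_center A \/
           abelian_alg A \/
           finite_alg A \/
           finite_in (commutant (range alpha)) \/
           alpha @` radical alpha = radical alpha \/
           alpha @` ann (radical alpha) `<=` ann (radical alpha))
    (SA : semicrossed_product alpha) (SB : semicrossed_product beta) :
  isometrically_isomorphic SA SB <-> outer_conjugate alpha beta.
Proof.
split; last exact: outer_conjugate_isomorphic.
move=> [F [Fiso Fsurj]]; have [G FG] := choice Fsurj.
have inj : injective F.
  move=> x y /eqP; rewrite -subr_eq0 -lrmorphB => /eqP e.
  apply/eqP; rewrite -subr_eq0; apply/eqP/anorm0_eq0.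
  by rewrite -Fiso e anorm0.
have GF : cancel F G by move=> x; apply: inj; rewrite FG.
have GB : zmod_morphism G by move=> x y; apply: inj; rewrite lrmorphB !FG.
have GM : monoid_morphism G.
  by split=> [|x y]; apply: inj; rewrite ?lrmorph1 ?lrmorphM !FG.
have GZ : scalable G by move=> c x; apply: inj; rewrite lrmorphZ !FG.
exact: (isomorphism_outer_conjugate star_alpha star_beta
  (Psi := lrmorphism_of GB GM GZ) GF FG Fiso).
Qed.
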